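(* The following hold. (i) For every $\epsilon\in(0,1/2]$, if $r=r(n)\leq \log n/(4\epsilon n)$, then asymptotically almost surely there exists a disconnected $(1/2+\epsilon)$-subgraph of $G_1(n,r)$. (ii) For every $C>0$, there exists $\epsilon=\epsilon(C)\in(0,1/2]$ such that, for every $r=r(n)\leq C(\log n/n)^{1/2}$, asymptotically almost surely there exists a disconnected $(1/2+\epsilon)$-subgraph of $G_2(n,r)$.
   Context: The random geometric graph $G_d(n,r)$ has vertex set $[n]$; each vertex $i$ is assigned a position $X_i$, where $X_1,\dots,X_n$ are independent uniform random points in $[0,1]^d$, and $ij$ is an edge iff $\lVert X_i-X_j\rVert\le r$ (Euclidean norm). For $\alpha\in[0,1]$, an $\alpha$-subgraph of $G$ is a subgraph $H\subseteq G$ with $V(H)=V(G)$ and $d_H(v)\geq\alpha d_G(v)$ for all $v$. A.a.s. means with probability tending to $1$ as $n\to\infty$; $\log$ is the natural logarithm. *)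

(* Defs.v *)
From HB Require Import structures.
From mathcomp Require Import all_boot all_order all_algebra.
From mathcomp Require Import all_classical all_reals all_analysis.

Set Implicit Arguments.
Unset Strict Implicit.
Unset Printing Implicit Defensive.

Import Order.TTheory GRing.Theory Num.Theory.
Import numFieldNormedType.Exports.

Local Open Scope classical_set_scope.
Local Open Scope ring_scope.

Record sgraph (V : finType) := SGraph {
  adj :> rel V;
  adj_sym : symmetric adj;
  adj_irrefl : irreflexive adj }.

Definition degree (V : finType) (G : sgraph V) (v : V) : nat :=
  #|[set w | adj G v w]%SET|.

(* [V(H) = V(G)] holds because both graphs live on the type [V]. *)
Definition alpha_subgraph (R : realType) (alpha : R) (V : finType)
    (G H : sgraph V) : Prop :=
  subrel (adj H) (adj G) /\
  forall v, alpha * (degree G v)%:R <= (degree H v)%:R.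

Definition disconnected (V : finType) (G : sgraph V) : Prop :=
  exists u v : V, ~~ connect (adj G) u v.

(* The library norm on products is the sup norm, hence this definition. *)
Definition euclidean_dist (R : realType) (d : nat) (x y : d.-tuple R) : R :=
  Num.sqrt (\sum_(k < d) (tnth x k - tnth y k) ^+ 2).

Lemma euclidean_distC (R : realType) (d : nat) (x y : d.-tuple R) :
  euclidean_dist x y = euclidean_dist y x.
Proof.
rewrite /euclidean_dist; congr Num.sqrt; apply: eq_bigr => k _.
by rewrite -opprB sqrrN.
Qed.

(* The [d]-dimensional Lebesgue measure, by integrating over sections, as in
   the library's binary product measure; the base case is the unit mass on
   the one-point space. *)
Fixpoint lebesgue_tuple (R : realType) (d : nat) :
    set (d.-tuple R) -> \bar R :=
  match d return set (d.-tuple R) -> \bar R with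
  | 0%N => fun A => (\d_([tuple] : 0.-tuple R) A)%E
  | d'.+1 => fun A => (\int[@lebesgue_measure R]_x
      @lebesgue_tuple R d' [set t | A (cons_tuple (x : R) t)])%E
  end.

Definition unit_cube (R : realType) (d : nat) : set (d.-tuple R) :=
  [set t | forall k, 0 <= tnth t k <= 1].

(* No normalising constant: the cube has Lebesgue measure 1. *)
Definition uniform_on_cube (R : realType) (dO : measure_display)
    (Omega : measurableType dO) (P : probability Omega R) (d : nat)
    (X : {RV P >-> d.-tuple R}) : Prop :=
  forall A : set (d.-tuple R), measurable A ->
    P (X @^-1` A) = lebesgue_tuple (A `&` @unit_cube R d).

Definition mutually_independent (R : realType) (dO dT : measure_display)
    (Omega : measurableType dO) (T : measurableType dT)
    (P : probability Omega R) (I : finType) (X : I -> {RV P >-> T}) : Prop :=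
  forall (J : {set I}) (A : I -> set T), (forall i, measurable (A i)) ->
    P (\bigcap_(i in [set` J]) (X i @^-1` A i)) =
    (\prod_(i in J) P (X i @^-1` A i))%E.

Record uniform_points (R : realType) (d n : nat) := UniformPoints {
  up_display : measure_display;
  up_space : measurableType up_display;
  up_prob : probability up_space R;
  up_pos : 'I_n -> {RV up_prob >-> d.-tuple R};
  up_indep : mutually_independent up_pos;
  up_uniform : forall i, uniform_on_cube (up_pos i) }.

Section RandomGeometricGraph.
Variables (R : realType) (d n : nat) (M : uniform_points R d n) (r : R).
Variable (w : up_space M).

Definition rgg_adj : rel 'I_n := fun i j =>
  (i != j) && (euclidean_dist (up_pos M i w) (up_pos M j w) <= r).

Lemma rgg_adj_sym : symmetric rgg_adj.
Proof. by move=> i j; rewrite /rgg_adj eq_sym euclidean_distC. Qed.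

Lemma rgg_adj_irrefl : irreflexive rgg_adj.
Proof. by move=> i; rewrite /rgg_adj eqxx. Qed.

Definition rgg : sgraph 'I_n := SGraph rgg_adj_sym rgg_adj_irrefl.

End RandomGeometricGraph.

Definition aas_rgg (R : realType) (d : nat)
    (M : forall n, uniform_points R d n) (r : nat -> R)
    (Q : forall n, sgraph 'I_n -> Prop) : Prop :=
  up_prob (M n) [set w | Q n (rgg (r n) w)] @[n --> \oo] --> 1%E.

Definition has_disconnected_subgraph (R : realType) (alpha : R)
    (n : nat) (G : sgraph 'I_n) : Prop :=
  exists H : sgraph 'I_n, alpha_subgraph alpha G H /\ disconnected H.

(* Main.v *)
(** Cut the cube into a grid of boxes whose side is a fixed small fraction of
    the largest admissible radius.  Call template a prescription of the number
    of points in every box of a bounded cell: no point in a thin gap, [1 + h]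
    times the mean in a bounded region, the mean elsewhere.  A given cell
    follows the template with probability [n ^ (- c + o(1))], where [c log n]
    is the mean number of points in the gap plus [h ^ 2] times that in the
    raised region.  There are [n ^ (1 - o(1))] disjoint cells, so when [c < 1]
    the second moment method produces, a.a.s., a cell following the template.
    The subgraph is obtained by deleting the edges that cross the gap there.

    On the line the gap is an interval of length just below [4 eps] times the
    bound on [r], and a vertex near it loses less than a fraction
    [1/2 - eps] of its degree.  In the plane it is an annulus of large radius.
    A vertex outside the annulus keeps more than it loses because of the
    curvature.  For a vertex inside, the curvature works the other way, but the
    gap compensates a part of it and raising the density inside by a small
    factor [1 + h] the rest, while the cost [h ^ 2] of doing so is of lower
    order.  If [r] is below the width of the gap, no edge crosses. *)

From HB Require Import structures.
From mathcomp Require Import all_boot all_order all_algebra.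
From mathcomp Require Import zify ring lra.
Import Order.TTheory GRing.Theory Num.Theory.
Set Implicit Arguments.
Unset Strict Implicit.
Unset Printing Implicit Defensive.
Local Open Scope ring_scope.

(** * Multinomial counts and the second moment method *)

(** In the plane no area is computed: only order relations between numbers of lattice points are
    used. The four reference counts (lost and kept, for a vertex on either boundary of the gap) are
    fixed integers once [C] is given. After weighting by the densities, each lost count is below the
    kept one by at least one unit. The mean number of points per box tends to infinity, so this unit
    beats all rounding, and [eps] is the reciprocal of a multiple of the counts. The gap is [8 g]
    wide, the radius is [M = 8 (k l)^2 g] and the annulus has radius [k^2 M]. Across a disc of
    radius [M] the circle bends by about [M / k^2], so [h] has order [k^-2]. The bounds below give
    relative cost [O(1 / k)] for the raised region and [O(k^2 / l)] for the gap: [k] is chosen after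
    [C], then [l] after [k]. Finally [g = t^2] with [t] large makes the [g^2] points gained by
    crossing the gap outnumber the boundary layer of a disc. The number of points is fixed, so cells
    are dependent, and the probability for two cells is compared explicitly with the square. *)

Lemma multinomial_tuple (L : finType) (n : nat) (kappa : L -> nat) :
  (\sum_l kappa l = n)%N ->
  (#|[set t : n.-tuple L | [forall l, count_mem l t == kappa l]]|
     * \prod_l (kappa l)`! = n`!)%N.
Proof.
elim: n kappa => [|n IHn] kappa sum_kappa.
  have k0 l : kappa l = 0%N.
    by have /eqP := sum_kappa; rewrite sum_nat_eq0 => /forallP/(_ l)/eqP.
  rewrite big1 ?muln1; last by move=> l _; rewrite k0.
  rewrite (_ : [set _ | _] = [set [tuple]]) ?cards1//.
  apply/setP => t; rewrite !inE (tuple0 t) eqxx.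
  by apply/forallP => l; rewrite k0.
(* Induction on the first letter: a word starting with [l] continues as a word with counts [dec l],
   and the terms [kappa l * n!] add up to [(n + 1)!]. *)
pose dec l := fun l' => (kappa l' - (l' == l))%N.
pose S l := [set t : n.-tuple L | [forall l', count_mem l' t == dec l l']].
have -> : #|[set t : n.+1.-tuple L | [forall l, count_mem l t == kappa l]]|
    = (\sum_(l | (0 < kappa l)%N) #|S l|)%N.
  rewrite -sum1_card (partition_big (fun t : n.+1.-tuple L => thead t)
    (fun l => (0 < kappa l)%N)) /=; last first.
    move=> t; rewrite inE => /forallP/(_ (thead t))/eqP <-.
    by rewrite (tuple_eta t) theadE /= eqxx.
  apply: eq_bigr => l kl; rewrite sum1_card.
  rewrite -(card_imset (mem (S l)) (_ : injective (fun t : n.-tuple L => [tuple of l :: t]))).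
    apply: eq_card => t; rewrite [LHS]unfold_in inE; apply/andP/imsetP => [[H /eqP tl]|].
      exists [tuple of behead t]; last first.
        by rewrite -tl; exact: tuple_eta.
      rewrite inE; apply/forallP => l'; rewrite /dec.
      have /eqP <- := forallP H l'.
      by rewrite [in X in (_ == X)%N](tuple_eta t) tl /= [l == l']eq_sym addKn.
    case=> t'; rewrite inE => /forallP H ->; rewrite theadE; split => //.
    apply/forallP => l' /=; move/eqP: (H l') => ->.
    rewrite /dec; apply/eqP; have [<-|/negbTE ll] := eqVneq l l'; first by lia.
    by lia.
  by move=> t t' /(congr1 val) /= [] /val_inj.
rewrite big_distrl /= factS -{1}sum_kappa big_distrl /=.
rewrite [RHS](bigID (fun l => (0 < kappa l)%N)) /= [X in (_ + X)%N]big1 ?addn0;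
  last by move=> l; rewrite lt0n negbK => /eqP ->.
apply: eq_bigr => l kl.
have sdec : (\sum_l' dec l l' = n)%N.
  apply: succn_inj; rewrite -[RHS]sum_kappa.
  rewrite (bigD1 l) //= [RHS](bigD1 l) //= /dec eqxx.
  rewrite (eq_bigr kappa); first by lia.
  by move=> l' /negbTE ->; rewrite subn0.
rewrite -(IHn _ sdec) mulnCA; congr (_ * _)%N.
rewrite (bigD1 l) //= [in RHS](bigD1 l) //= mulnA; congr (_ * _)%N.
  by rewrite /dec eqxx -[in LHS](prednK kl) factS prednK // subn1.
by apply: eq_bigr => l' /negbTE H; rewrite /dec H subn0.
Qed.

Lemma multinomial_ffun (L : finType) (n : nat) (kappa : L -> nat) :
  (\sum_l kappa l = n)%N ->
  (#|[set g : {ffun 'I_n -> L} | [forall l, #|[set i | g i == l]| == kappa l]]|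
     * \prod_l (kappa l)`! = n`!)%N.
Proof.
move=> /multinomial_tuple <-; congr (_ * _)%N.
pose h (g : {ffun 'I_n -> L}) := [tuple g i | i < n].
have hbij : bijective h.
  exists (fun t : n.-tuple L => [ffun i => tnth t i]).
    by move=> g; apply/ffunP => i; rewrite ffunE tnth_mktuple.
  by move=> t; apply: eq_from_tnth => i; rewrite tnth_mktuple ffunE.
rewrite -(on_card_preimset (f := h)); last by apply: onW_bij.
apply: eq_card => g; rewrite !inE; apply: eq_forallb => l; congr (_ == _).
rewrite /h /= count_map -sum1_card -sum1_count big_enum_cond /=.
by apply: eq_bigl => i; rewrite !inE.
Qed.

Lemma big_option (V : Type) (idx : V) (op : Monoid.com_law idx) (X : finType)
    (F : option X -> V) :
  \big[op/idx]_l F l = op (F None) (\big[op/idx]_x F (Some x)).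
Proof.
rewrite (bigD1 None) //=; congr (op _ _).
rewrite (reindex_omap Some id) => [|[]//].
by apply: eq_bigl => x; rewrite eqxx.
Qed.

(** Independent labels stay independent when [phi] merges some of them, with the merged weights. *)
Lemma sum_pushforward (R : comNzRingType) (L L' : finType) (n : nat)
    (phi : L -> L') (p : L -> R) (Q : pred {ffun 'I_n -> L'}) :
  \sum_(f : {ffun 'I_n -> L} | Q [ffun i => phi (f i)]) \prod_i p (f i) =
  \sum_(g | Q g) \prod_i \sum_(l | phi l == g i) p l.
Proof.
rewrite (partition_big (fun f : {ffun 'I_n -> L} => [ffun i => phi (f i)]) Q) //=.
apply: eq_bigr => g Qg; rewrite bigA_distr_big_dep.
apply: eq_bigl => f; apply/andP/familyP => [[_ /eqP <-] i|H].
  by rewrite ffunE unfold_in /= eqxx.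
suff -> : [ffun i => phi (f i)] = g by rewrite eqxx.
by apply/ffunP => i; rewrite ffunE; apply/eqP; exact: H.
Qed.

(* Law of the box containing a uniform point, when the boxes [X] have volume [a];
   [None] stands for a point outside all boxes. *)
Definition cell_weight (R : comNzRingType) (X : finType) (a : R) (l : option X) : R :=
  if l is Some _ then a else 1 - #|X|%:R * a.

Definition has_counts (X B : finType) (n : nat) (iota : B -> X) (kappa : B -> nat)
    (f : {ffun 'I_n -> option X}) : bool :=
  [forall b, #|[set i | f i == Some (iota b)]| == kappa b].

Lemma sum_cell_weight (R : comNzRingType) (X : finType) (a : R) :
  \sum_(l : option X) cell_weight a l = 1.
Proof.
rewrite big_option /= (eq_bigr (fun=> a)) // sumr_const -mulr_natl.
by ring.
Qed.

Lemma prod_fibers (R : comNzRingType) (L : finType) (n : nat) (p : L -> R)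
    (g : {ffun 'I_n -> L}) :
  \prod_i p (g i) = \prod_l p l ^+ #|[set i | g i == l]|.
Proof.
rewrite (partition_big (fun i => g i) predT) //=; apply: eq_bigr => l _.
rewrite (eq_bigr (fun=> p l)); last by move=> i /eqP ->.
by rewrite prodr_const; congr (_ ^+ _); apply: eq_card => i; rewrite !inE.
Qed.

(** All labels outside the image of [iota] are merged into one. The number of points carrying it is
    then forced to be [n - k], and the event becomes a single multinomial outcome. *)
Lemma sum_has_counts (R : numFieldType) (X B : finType) (n : nat) (iota : B -> X)
    (kappa : B -> nat) (a : R) (k := (\sum_b kappa b)%N) :
  injective iota -> (k <= n)%N ->
  \sum_(f : {ffun 'I_n -> option X} | has_counts iota kappa f)
     \prod_i cell_weight a (f i) =
  (n ^_ k)%:R / (\prod_b (kappa b)`!)%:R * a ^+ k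
    * (1 - #|B|%:R * a) ^+ (n - k).
Proof.
move=> iota_inj kn.
pose phi (l : option X) : option B := [pick b | l == Some (iota b)].
have phiE l b : (phi l == Some b) = (l == Some (iota b)).
  rewrite /phi; case: pickP => [b' /eqP ->|H]; last by rewrite H.
  by apply/eqP/eqP => -[] => [->|/iota_inj ->].
pose Q (g : {ffun 'I_n -> option B}) :=
  [forall b, #|[set i | g i == Some b]| == kappa b].
rewrite (eq_bigl (fun f : {ffun 'I_n -> option X} => Q [ffun i => phi (f i)])); last first.
  move=> f; apply: eq_forallb => b; congr (_ == _); apply: eq_card => i.
  by rewrite !inE ffunE phiE.
rewrite sum_pushforward.
have wS b : \sum_(l | phi l == Some b) cell_weight a l = a.
  rewrite (eq_bigl (pred1 (Some (iota b)))); last by move=> l; rewrite phiE.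
  by rewrite big_pred1_eq.
have wN : \sum_(l | phi l == None) cell_weight a l = 1 - #|B|%:R * a.
  have := sum_cell_weight X a.
  rewrite (partition_big phi predT) //= big_option /=.
  rewrite [X in _ + X](eq_bigr (fun=> a)); last by move=> b _; exact: wS.
  by rewrite sumr_const -[a *+ _]mulr_natl => H; apply/eqP; rewrite eq_sym subr_eq H.
pose kappa' (l : option B) := if l is Some b then kappa b else (n - k)%N.
have skappa' : (\sum_l kappa' l = n)%N.
  by rewrite big_option /= -/k subnK.
have QE g : Q g = [forall l, #|[set i | g i == l]| == kappa' l].
  apply/forallP/forallP => [H [b|] /=|H b]; [exact: H| |exact: (H (Some b))].
  have : (\sum_l #|[set i | g i == l]| = n)%N.
    rewrite -[RHS]card_ord -sum1_card (partition_big (fun i => g i) predT) //=.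
    by apply: eq_bigr => l _; rewrite -sum1_card; apply: eq_bigl => i; rewrite inE.
  rewrite big_option /= (eq_bigr kappa); last by move=> b _; exact/eqP/H.
  by rewrite -/k => /(congr1 (subn^~ k)) <-; rewrite addnK.
rewrite (eq_bigr (fun=> a ^+ k * (1 - #|B|%:R * a) ^+ (n - k))); last first.
  move=> g; rewrite QE => /forallP H.
  rewrite (prod_fibers (fun l' => \sum_(l | phi l == l') cell_weight a l)).
  rewrite big_option /= wN mulrC; congr (_ * _); last by rewrite (eqP (H None)).
  rewrite (eq_bigr (fun b => a ^+ kappa b)) -?expr_sum//.
  by move=> b _; rewrite wS (eqP (H (Some b))).
rewrite (eq_bigl (mem [set g : {ffun 'I_n -> option B} |
  [forall l, #|[set i | g i == l]| == kappa' l]])); last first.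
  by move=> g; rewrite QE !inE.
rewrite sumr_const -[_ *+ #|_|]mulr_natl -[RHS]mulrA; congr (_ * _).
have := multinomial_ffun skappa'; rewrite big_option /= => H.
have fp : (\prod_b (kappa b)`!)%:R != 0 :> R.
  by rewrite pnatr_eq0 -lt0n prodn_gt0 // => b; rewrite fact_gt0.
apply: (mulIf fp); rewrite mulfVK // -natrM; congr (_%:R).
apply/eqP; rewrite -(eqn_pmul2r (fact_gt0 (n - k))) ffact_fact // -H.
by rewrite -mulnA [(\prod_b _ * _)%N]mulnC eqxx.
Qed.

(* Chebyshev's inequality for the number of [c] such that [E c]. *)
Lemma second_moment (R : realFieldType) (Om C : finType) (W : Om -> R)
    (E : C -> pred Om) (p1 p2 : R) :
  (forall f, 0 <= W f) -> \sum_f W f = 1 -> 0 < p1 -> (0 < #|C|)%N ->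
  (forall c, \sum_(f | E c f) W f = p1) ->
  (forall c c', c != c' -> \sum_(f | E c f && E c' f) W f <= p2 * p1 ^+ 2) ->
  0 <= p2 ->
  \sum_(f | ~~ [exists c, E c f]) W f <= (#|C|%:R * p1)^-1 + p2 - 1.
Proof.
move=> W0 W1 p1_gt0 C0 EE1 EE2 p20.
pose Y f : R := \sum_c (E c f)%:R.
pose N : R := #|C|%:R; have N0 : 0 < N by rewrite ltr0n.
have sumE (P : pred Om) : \sum_f (P f)%:R * W f = \sum_(f | P f) W f.
  rewrite [RHS]big_mkcond; apply: eq_bigr => f _.
  by case: (P f); rewrite ?mul1r ?mul0r.
have EY : \sum_f Y f * W f = N * p1.
  under eq_bigr do rewrite mulr_suml.
  rewrite exchange_big /= (eq_bigr (fun=> p1)); last by move=> c _; rewrite sumE.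
  by rewrite sumr_const mulr_natl.
have EYY : \sum_f Y f ^+ 2 * W f <= N * p1 + N ^+ 2 * (p2 * p1 ^+ 2).
  have -> : \sum_f Y f ^+ 2 * W f =
      \sum_c \sum_c' \sum_(f | E c f && E c' f) W f.
    transitivity (\sum_f \sum_c \sum_c' (E c f && E c' f)%:R * W f).
      apply: eq_bigr => f _; rewrite expr2 {1}/Y mulr_suml mulr_suml.
      apply: eq_bigr => c _; rewrite /Y mulr_sumr mulr_suml.
      by apply: eq_bigr => c' _; rewrite -natrM mulnb.
    rewrite exchange_big /=; apply: eq_bigr => c _.
    rewrite exchange_big /=; apply: eq_bigr => c' _.
    exact: (sumE (fun f => E c f && E c' f)).
  apply: (@le_trans _ _ (\sum_(c : C) (p1 + N * (p2 * p1 ^+ 2)))).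
    apply: ler_sum => c _; rewrite (bigD1 c) //=; apply: lerD.
      by under eq_bigl do rewrite andbb; rewrite EE1.
    apply: (@le_trans _ _ (\sum_(c' | c' != c) p2 * p1 ^+ 2)).
      by apply: ler_sum => c' cc'; apply: EE2; rewrite eq_sym.
    rewrite sumr_const -[p2 * _ *+ _]mulr_natl ler_wpM2r ?mulr_ge0 ?sqr_ge0 ?(ltW p1_gt0)//.
    by rewrite /N ler_nat max_card.
  by rewrite sumr_const -[(_ + _) *+ _]mulr_natl -/N mulrDr expr2 !mulrA.
have m0 : 0 < N * p1 by rewrite mulr_gt0.
have key : (\sum_(f | ~~ [exists c, E c f]) W f) * (N * p1) ^+ 2 <=
    \sum_f (Y f - N * p1) ^+ 2 * W f.
  rewrite mulr_suml big_mkcond; apply: ler_sum => f _.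
  case: ifPn => [/existsPn nE|_]; last by rewrite mulr_ge0 ?sqr_ge0.
  rewrite (_ : Y f = 0) ?sub0r ?sqrrN 1?mulrC//.
  by rewrite /Y big1 // => c _; rewrite (negbTE (nE c)).
have var : \sum_f (Y f - N * p1) ^+ 2 * W f =
    \sum_f Y f ^+ 2 * W f - (N * p1) ^+ 2.
  have -> : \sum_f (Y f - N * p1) ^+ 2 * W f = \sum_f Y f ^+ 2 * W f
      - 2 * (N * p1) * (\sum_f Y f * W f) + (N * p1) ^+ 2 * \sum_f W f.
    rewrite !mulr_sumr -sumrB -big_split /=; apply: eq_bigr => f _; ring.
  by rewrite EY W1; ring.
rewrite -(ler_pM2r (exprn_gt0 2 m0)); apply: (le_trans key); rewrite var.
have -> : ((N * p1)^-1 + p2 - 1) * (N * p1) ^+ 2 =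
   N * p1 + N ^+ 2 * (p2 * p1 ^+ 2) - (N * p1) ^+ 2.
  by field; rewrite (gt_eqF p1_gt0) (gt_eqF N0).
exact: lerB.
Qed.

Lemma ffactnD n k l : (n ^_ (k + l) = n ^_ k * (n - k) ^_ l)%N.
Proof.
elim: l => [|l IHl]; first by rewrite addn0 muln1.
by rewrite addnS !ffactnSr IHl mulnA subnDA.
Qed.

Lemma leq_ffact n m k : (n <= m)%N -> (n ^_ k <= m ^_ k)%N.
Proof.
by move=> nm; rewrite !ffact_prod; apply: leq_prod => i _; exact: leq_sub2r.
Qed.

Lemma bernoulli_ineq (R : realFieldType) (x : R) (n : nat) :
  0 <= x <= 1 -> 1 - n%:R * x <= (1 - x) ^+ n.
Proof.
move=> /andP[x0 x1]; elim: n => [|n IHn]; first by rewrite expr0; lra.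
rewrite exprS; apply: (@le_trans _ _ ((1 - x) * (1 - n%:R * x))).
  rewrite -natr1; have : 0 <= n%:R * x * x by rewrite !mulr_ge0 ?ler0n.
  by lra.
by apply: ler_wpM2l => //; lra.
Qed.

Definition count_prob (R : fieldType) (B : finType) (n : nat) (kappa : B -> nat)
    (a : R) : R :=
  let k := (\sum_b kappa b)%N in
  (n ^_ k)%:R / (\prod_b (kappa b)`!)%:R * a ^+ k * (1 - #|B|%:R * a) ^+ (n - k).

(** Two cells together amount to prescribed counts on [bool * B]. Their joint probability exceeds
    the square of the single one by a factor of at most [(1 - 2 k beta)^-1]: one has
    [n ^_ (2k) <= (n ^_ k)^2] and [(1 - 2 beta)^(n - 2k) <= (1 - beta)^(2 (n - 2k))], and the
    missing [(1 - beta)^(2k)] is bounded below by Bernoulli's inequality. *)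
Lemma no_cell_bound (R : realFieldType) (C B : finType) (n : nat)
    (kappa : B -> nat) (a : R) (k := (\sum_b kappa b)%N) (beta := #|B|%:R * a) :
  (0 < #|C|)%N -> 0 < a -> #|{: C * B}|%:R * a <= 1 -> (2 * k <= n)%N ->
  beta < 1 -> 2 * k%:R * beta < 1 ->
  \sum_(f : {ffun 'I_n -> option (C * B)} |
      ~~ [exists c, has_counts (pair c) kappa f]) \prod_i cell_weight a (f i)
  <= (#|C|%:R * count_prob n kappa a)^-1 + (1 - 2 * k%:R * beta)^-1 - 1.
Proof.
move=> C0 a0 CBa k2n beta1 kb1.
have kn : (k <= n)%N by lia.
have b0 : 0 <= beta by rewrite mulr_ge0 ?ler0n ?ltW.
have fp : 0 < (\prod_b (kappa b)`!)%:R :> R.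
  by rewrite ltr0n prodn_gt0 // => b; rewrite fact_gt0.
have w0 l : 0 <= @cell_weight R (C * B)%type a l.
  by case: l => [_|] /=; [exact: ltW|lra].
have cp0 : 0 < count_prob n kappa a.
  rewrite /count_prob -/k -/beta !mulr_gt0 ?invr_gt0 ?exprn_gt0 ?subr_gt0 //.
  by rewrite ltr0n ffact_gt0.
apply: second_moment => //.
- by move=> f; apply: prodr_ge0.
- rewrite -(bigA_distr_bigA (fun _ : 'I_n => @cell_weight R (C * B)%type a)) /=.
  by rewrite big1 // => i _; exact: sum_cell_weight.
- by move=> c; rewrite (sum_has_counts _ (iota := pair c)) // => b b' [].
- move=> c c' cc'.
  pose iota (xb : bool * B) := (if xb.1 then c else c', xb.2).
  pose kap (xb : bool * B) := kappa xb.2.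
  have iinj : injective iota.
    move=> [[] b] [[] b'] /= []; rewrite /iota /=; try by move=> ->.
    - by move=> ccE; rewrite ccE eqxx in cc'.
    - by move=> ccE; rewrite ccE eqxx in cc'.
  have sk : (\sum_b kap b = k + k)%N.
    rewrite -(pair_bigA _ (fun x b => kappa b)) /= big_bool /=.
    by rewrite addnn.
  have pk : (\prod_b (kap b)`! = (\prod_b (kappa b)`!) ^ 2)%N.
    by rewrite -(pair_bigA _ (fun x b => (kappa b)`!)) /= big_bool /= mulnn.
  have -> : \sum_(f | has_counts (pair c) kappa f && has_counts (pair c') kappa f)
       \prod_(i < n) @cell_weight R (C * B)%type a (f i) =
      \sum_(f | has_counts iota kap f) \prod_(i < n) cell_weight a (f i).
    apply: eq_bigl => f; apply/andP/forallP.
      by move=> [/forallP H /forallP H'] [[] b]; [exact: H|exact: H'].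
    by move=> H; split; apply/forallP => b; [exact: (H (true, b))|exact: (H (false, b))].
  rewrite sum_has_counts ?sk //; last by rewrite addnn -mul2n.
  rewrite pk card_prod card_bool natrM -[2%:R * _ * a]mulrA -/beta.
  rewrite [leRHS]mulrC ler_pdivlMr; last by lra.
  rewrite /count_prob -/k -/beta.
  set F : R := (\prod_b (kappa b)`!)%:R.
  have -> : ((\prod_b (kappa b)`!) ^ 2)%N%:R = F ^+ 2 :> R by rewrite natrX.
  (* Two distinct cells have joint volume at most [1], which keeps [1 - 2 beta] nonnegative. *)
  have C2 : (2 <= #|C|)%N by have := max_card (mem [set c; c']); rewrite cards2 cc'.
  have beta2 : 2 * beta <= 1.
    apply: le_trans CBa; rewrite card_prod natrM -mulrA ler_wpM2r //.
    by rewrite ler_nat.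
  have uv0 : 0 <= (1 - 2 * beta) ^+ (n - (k + k)) * (1 - 2 * k%:R * beta).
    by rewrite mulr_ge0 ?exprn_ge0 //; lra.
  have ff : (n ^_ (k + k))%:R <= (n ^_ k)%:R ^+ 2 :> R.
    by rewrite -natrX ler_nat ffactnD -mulnn leq_mul2l leq_ffact ?orbT ?leq_subr.
  have pp : (1 - 2 * beta) ^+ (n - (k + k)) * (1 - 2 * k%:R * beta)
       <= ((1 - beta) ^+ (n - k)) ^+ 2.
    have -> : ((1 - beta) ^+ (n - k)) ^+ 2 =
        ((1 - beta) ^+ 2) ^+ (n - (k + k)) * (1 - beta) ^+ (2 * k).
      rewrite -!exprM -exprD; congr (_ ^+ _).
      by move: (k) k2n; clear => x Hx; lia.
    apply: ler_pM; [by apply: exprn_ge0; lra|by lra| |].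
      apply: lerXn2r; rewrite ?nnegrE ?sqr_ge0 //; first by lra.
      by have := sqr_ge0 beta; lra.
    by rewrite -natrM; apply: bernoulli_ineq; lra.
  rewrite exprD.
  move: (ler0n R (n ^_ (k + k))) ff pp uv0.
  move: (n ^_ (k + k))%:R (n ^_ k)%:R ((1 - 2 * beta) ^+ _) (1 - 2 * k%:R * beta)
    ((1 - beta) ^+ _) (a ^+ k) => x y u v z ak x0 ff pp uv0.
  have F0 : F != 0 by rewrite gt_eqF.
  rewrite [leLHS](_ : _ = x * (ak / F) ^+ 2 * (u * v)); last by field.
  rewrite [leRHS](_ : _ = y ^+ 2 * (ak / F) ^+ 2 * z ^+ 2); last by field.
  apply: ler_pM => //.
  + by rewrite mulr_ge0 ?sqr_ge0 ?x0.
  + by rewrite ler_wpM2r ?sqr_ge0.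
- by rewrite invr_ge0; lra.
Qed.

(** * Lattice points in discs and annuli *)

Definition grid_point (W : nat) (b : {ffun 'I_2 -> 'I_(2 * W).+1}) : int * int :=
  ((b ord0)%:Z - W%:Z, (b ord_max)%:Z - W%:Z).

Definition in_grid (W : nat) (p : int * int) : bool :=
  (`|p.1| <= W%:Z) && (`|p.2| <= W%:Z).

Definition grid_box (W : nat) (p : int * int) : {ffun 'I_2 -> 'I_(2 * W).+1} :=
  [ffun i : 'I_2 => inord (if i == ord0 then absz (p.1 + W%:Z) else absz (p.2 + W%:Z))].

Lemma grid_boxK W p : in_grid W p -> grid_point (grid_box W p) = p.
Proof.
case: p => x y /andP[/= hx hy]; rewrite /grid_point /grid_box !ffunE /=.
by rewrite !inordK; [congr (_, _); lia|lia|lia].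
Qed.

Lemma grid_pointK W b : grid_box W (grid_point b) = b.
Proof.
apply/ffunP => i; rewrite ffunE /grid_point /=; apply: val_inj => /=.
have [i0|i1] := eqVneq i ord0.
  by rewrite i0 inordK; have := ltn_ord (b ord0); lia.
have -> : i = ord_max by apply: val_inj => /=; case: i i1 => [[|[|]]].
by rewrite inordK; have := ltn_ord (b ord_max); lia.
Qed.

Lemma grid_point_in W (b : {ffun 'I_2 -> 'I_(2 * W).+1}) : in_grid W (grid_point b).
Proof.
by rewrite /in_grid /grid_point /=; have := ltn_ord (b ord0);
  have := ltn_ord (b ord_max); lia.
Qed.

Definition lattice_count (W : nat) (P : pred (int * int)) : nat :=
  #|[set b : {ffun 'I_2 -> 'I_(2 * W).+1} | P (grid_point b)]|.

(** Plays the part of a change of variables: reflections, translations and rounded rotations enter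
    the counts only as injections into a region that fits into its grid. *)
Lemma lattice_count_inj W W' (P Q : pred (int * int)) (f : int * int -> int * int) :
  injective f -> (forall p, P p -> Q (f p) && in_grid W' (f p)) ->
  (lattice_count W P <= lattice_count W' Q)%N.
Proof.
move=> finj PQ; pose F (b : {ffun 'I_2 -> 'I_(2 * W).+1}) := grid_box W' (f (grid_point b)).
have FK b : P (grid_point b) -> grid_point (F b) = f (grid_point b).
  by move=> /PQ /andP[_ H]; rewrite grid_boxK.
rewrite /lattice_count -(@card_in_imset _ _ F); last first.
  move=> b b'; rewrite !inE => Pb Pb' FF.
  apply: (can_inj (@grid_pointK W)); apply: finj.
  by rewrite -FK // FF FK.
apply: subset_leq_card; apply/subsetP => _ /imsetP[b + ->].
by rewrite !inE => Pb; rewrite FK //; have /andP[] := PQ _ Pb.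
Qed.

Lemma lattice_count_sub W (P Q : pred (int * int)) :
  (forall p, P p -> Q p) -> (lattice_count W P <= lattice_count W Q)%N.
Proof.
by move=> PQ; apply: subset_leq_card; apply/subsetP => b; rewrite !inE; exact: PQ.
Qed.

Lemma lattice_countU W (P Q S : pred (int * int)) :
  (forall p, P p -> Q p || S p) ->
  (lattice_count W P <= lattice_count W Q + lattice_count W S)%N.
Proof.
move=> H; rewrite /lattice_count.
apply: leq_trans (leq_card_setU _ _); apply: subset_leq_card.
by apply/subsetP => b; rewrite !inE; exact: H.
Qed.

Lemma lattice_count_disj W (P Q S : pred (int * int)) :
  (forall p, P p -> S p) -> (forall p, Q p -> S p && ~~ P p) ->
  (lattice_count W P + lattice_count W Q <= lattice_count W S)%N.
Proof.
move=> PS QS; rewrite /lattice_count -cardsUI.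
rewrite [X in (_ + X)%N]eq_card0 ?addn0; last first.
  by move=> b; rewrite !inE; apply/negP => /andP[Pb /QS /andP[_ /negP]].
apply: subset_leq_card; apply/subsetP => b; rewrite !inE => /orP[/PS//|/QS/andP[]//].
Qed.

Lemma card_spread (n w : nat) (A : {set 'I_n}) :
  (forall x y, x \in A -> y \in A -> (x < y + w)%N) -> (#|A| <= w)%N.
Proof.
move=> H; have [->|/set0Pn [x0 Ax0]] := eqVneq A set0; first by rewrite cards0.
case: (arg_minnP (fun x : 'I_n => val x) Ax0) => y Ay ymin.
have w0 : (0 < w)%N by have := H _ _ Ay Ay; lia.
case: w w0 H => // w _ H.
rewrite -[X in (_ <= X)%N]card_ord -(@card_in_imset _ _ (fun x : 'I_n => inord (x - y) : 'I_w.+1)).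
  exact: max_card.
move=> x x' Ax Ax' /(congr1 val) /=.
have b1 := H _ _ Ax Ay; have b2 := H _ _ Ax' Ay.
have m1 := ymin _ Ax; have m2 := ymin _ Ax'.
by rewrite !inordK /= in m1 m2 * => [E| |]; [apply: val_inj => /=|..]; lia.
Qed.

(** On either side of the zero of [x + c], two members satisfy [(x - y)^2 <= |(x + c)^2 - (y + c)^2|
    < w^2], so they differ by less than [w]. *)
Lemma card_square_window (n w : nat) (c X : int) (A : {set 'I_n}) :
  (forall x, x \in A -> X <= (x%:Z + c) ^+ 2 < X + w%:Z ^+ 2) -> (#|A| <= 2 * w)%N.
Proof.
move=> H; rewrite -(cardsID [set x : 'I_n | 0 <= x%:Z + c] A) mul2n -addnn.
have w0 x : x \in A -> 0 < w%:Z ^+ 2 by move=> /H; lia.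
apply: leq_add; apply: card_spread => x y; rewrite !inE => /andP[];
  [move=> Ax hx /andP[Ay hy]|move=> hx Ax /andP[hy Ay]];
  have := H _ Ax; have := H _ Ay; have := w0 _ Ax;
  move: hx hy; rewrite -?ltNge; move: (x : nat) (y : nat) => {Ax}x {Ay}y; nia.
Qed.

(** Replaces the area of an annulus: on a horizontal line the squares of the abscissae fill a window
    whose length does not depend on the line. The price is that every row is charged like the widest
    one. *)
Lemma lattice_count_rows W (P : pred (int * int)) (m r : nat) (c : int) (X : int -> int) :
  (forall a b, P (a, b) ->
    (`|b| <= m%:Z) && (X b <= (a + c) ^+ 2 < X b + r%:Z ^+ 2)) ->
  (lattice_count W P <= (2 * m + 1) * (2 * r))%N.
Proof.
move=> H.
pose pr (b : {ffun 'I_2 -> 'I_(2 * W).+1}) := (b ord0, b ord_max).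
have prinj : injective pr.
  move=> b b' [] H0 H1; apply/ffunP => i.
  case: i => [[|[|//]] hi].
    by rewrite (_ : Ordinal hi = ord0) ?H0 //; apply: val_inj.
  by rewrite (_ : Ordinal hi = ord_max) ?H1 //; apply: val_inj.
pose S := pr @: [set b | P (grid_point b)].
rewrite /lattice_count -(card_imset _ prinj) -/S.
have PS x y : (x, y) \in S -> P (x%:Z - W%:Z, y%:Z - W%:Z).
  by case/imsetP => b; rewrite inE => Pb [-> ->].
pose Y := [set y : 'I_(2 * W).+1 | `|y%:Z - W%:Z| <= m%:Z].
have Ym : (#|Y| <= 2 * m + 1)%N.
  by apply: card_spread => x y; rewrite !inE; lia.
rewrite -sum1_card (partition_big (fun xy => xy.2) (mem Y)) /=; last first.
  by move=> [x y] /PS /H /andP[Hy _]; rewrite inE.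
apply: (@leq_trans (\sum_(y in Y) 2 * r)%N); last first.
  by rewrite sum_nat_const leq_mul2r Ym orbT.
apply: leq_sum => y _; rewrite sum1_card.
pose A := [set x | (x, y) \in S].
have -> : #|[pred xy | (xy \in S) && (xy.2 == y)]| = #|A|.
  rewrite -(card_imset (mem A) (_ : injective (fun x => (x, y)))); last by move=> x x' [].
  apply: eq_card => -[x y']; rewrite !inE /=; apply/andP/imsetP.
    by move=> [xyS /eqP yy]; subst y'; exists x; rewrite ?inE.
  by case=> x'; rewrite inE => x'S [-> ->].
apply: (@card_square_window _ r (c - W%:Z) (X (y%:Z - W%:Z))) => x.
rewrite inE => /PS /H /andP[_ /=].
by rewrite (_ : x%:Z - W%:Z + c = x%:Z + (c - W%:Z)) //; ring.
Qed.

Lemma lattice_count_rect W (P : pred (int * int)) (x0 y0 : int) (m r : nat) :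
  (forall i j : nat, (i < m)%N -> (j < r)%N -> P (x0 + i%:Z, y0 + j%:Z) &&
    in_grid W (x0 + i%:Z, y0 + j%:Z)) -> (m * r <= lattice_count W P)%N.
Proof.
move=> H; rewrite -[m in (m * _)%N]card_ord -[r in (_ * r)%N]card_ord -card_prod.
pose F (ij : 'I_m * 'I_r) := grid_box W (x0 + ij.1%:Z, y0 + ij.2%:Z).
have FK ij : grid_point (F ij) = (x0 + ij.1%:Z, y0 + ij.2%:Z).
  by rewrite grid_boxK //; have /andP[] := H _ _ (ltn_ord ij.1) (ltn_ord ij.2).
rewrite -cardsT -(@card_imset _ _ F); last first.
  move=> ij ij' /(congr1 (@grid_point W)); rewrite !FK => -[H1 H2].
  by case: ij ij' H1 H2 => [i j] [i' j'] /= H1 H2; congr (_, _); apply: val_inj => /=; lia.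
apply: subset_leq_card; apply/subsetP => _ /imsetP[ij _ ->].
by rewrite inE FK; have /andP[] := H _ _ (ltn_ord ij.1) (ltn_ord ij.2).
Qed.

(** [u] is a displacement from [(rho, 0)]: the disc of radius [m] around that point is cut by the
    circle of radius [c] around the origin. The clause [0 <= m] keeps [m * m] from describing a disc
    of radius [- m]. *)
Definition ball_in (m rho c : int) (u : int * int) : bool :=
  (0 <= m) && (u.1 * u.1 + u.2 * u.2 <= m * m) &&
  ((rho + u.1) * (rho + u.1) + u.2 * u.2 < c * c).

Definition ball_out (m rho c : int) (u : int * int) : bool :=
  (0 <= m) && (u.1 * u.1 + u.2 * u.2 <= m * m) &&
  (c * c <= (rho + u.1) * (rho + u.1) + u.2 * u.2).

Definition annulus (m m' : int) (u : int * int) : bool :=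
  (m * m < u.1 * u.1 + u.2 * u.2) && (u.1 * u.1 + u.2 * u.2 <= m' * m').

Definition shell (x y : int) (u : int * int) : bool :=
  (x * x <= u.1 * u.1 + u.2 * u.2) && (u.1 * u.1 + u.2 * u.2 < y * y).

Lemma ball_inE m rho c a b : ball_in m rho c (a, b) =
  (0 <= m) && (a * a + b * b <= m * m) && ((rho + a) * (rho + a) + b * b < c * c).
Proof. by []. Qed.

Lemma ball_outE m rho c a b : ball_out m rho c (a, b) =
  (0 <= m) && (a * a + b * b <= m * m) && (c * c <= (rho + a) * (rho + a) + b * b).
Proof. by []. Qed.

Lemma annulusE m m' a b : annulus m m' (a, b) =
  (m * m < a * a + b * b) && (a * a + b * b <= m' * m').
Proof. by []. Qed.

Lemma sqr_le_abs (a m : int) : 0 <= m -> a * a <= m * m -> - m <= a <= m.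
Proof. by move=> m0 H; apply/andP; split; nia. Qed.

Lemma in_grid_of_ball (V : nat) (m : int) u : m <= V%:Z ->
  (0 <= m) && (u.1 * u.1 + u.2 * u.2 <= m * m) -> in_grid V u.
Proof.
case: u => a b mV /andP[m0 H]; rewrite /in_grid; cbn [fst snd] in *.
have s1 : 0 <= a * a by rewrite -expr2 sqr_ge0.
have s2 : 0 <= b * b by rewrite -expr2 sqr_ge0.
have /andP[h1 h1'] : - m <= a <= m by apply: sqr_le_abs => //; lia.
have /andP[h2 h2'] : - m <= b <= m by apply: sqr_le_abs => //; lia.
by rewrite !ler_norml; lia.
Qed.

(** Moving the centre out by [8 g] raises the squared norm by at least [16 g (R - M)]. This
    dominates [20 (R + 8 g)], the difference of the squares of [R + 8 g + 5] and [R + 8 g - 5]. *)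
Lemma ball_out_shift (M R g : int) u : 40 <= g -> 8 * g <= M -> 4 * M <= R ->
  ball_out (M - 7) R (R + 8 * g - 5) u -> ball_out (M - 7) (R + 8 * g) (R + 8 * g + 5) u.
Proof.
case: u => a b; rewrite ?ball_outE => g40 Mg RM /andP[/andP[-> H1] H2].
rewrite H1 /=; have /andP[h1 h2] : - (M - 7) <= a <= M - 7 by apply: sqr_le_abs; nia.
set A := (R + a) * (R + a) + b * b in H2.
have -> : (R + 8 * g + a) * (R + 8 * g + a) + b * b =
  A + 16 * g * (R + a) + 64 * g * g by rewrite /A; ring.
have : 16 * g * (R - M) <= 16 * g * (R + a) by nia.
nia.
Qed.

Lemma ball_in_shift (M R g : int) u : 40 <= g -> 8 * g <= M -> 4 * M <= R ->
  ball_in (M - 7) (R + 8 * g) (R + 5) u -> ball_in (M - 7) R (R - 5) u.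
Proof.
case: u => a b; rewrite ?ball_inE => g40 Mg RM /andP[/andP[-> H1] H2].
rewrite H1 /=; have /andP[h1 h2] : - (M - 7) <= a <= M - 7 by apply: sqr_le_abs; nia.
have E : (R + 8 * g + a) * (R + 8 * g + a) + b * b =
  (R + a) * (R + a) + b * b + 16 * g * (R + a) + 64 * g * g by ring.
have : 16 * g * (R - M) <= 16 * g * (R + a) by nia.
move: H2; rewrite E; nia.
Qed.

Definition negp (u : int * int) : int * int := (- u.1, - u.2).

Lemma negpE a b : negp (a, b) = (- a, - b). Proof. by []. Qed.

Lemma negp_inj : injective negp.
Proof. by case=> a b [c d] [] /oppr_inj -> /oppr_inj ->. Qed.

(* The unit is the side of a box.  The connection radius is [M], the gap is the
   annulus between the radii [R] and [R + 8 g], and the discs are centred at a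
   point of its boundary.  The margins [5] and [7] absorb the rounding errors
   of rotations and of positions inside boxes.  Since [g] is a square, so are
   [M] and [R * g] up to constant factors. *)
Section ReferenceCounts.
Variables (k l t : nat).
Let j := (k * l)%N.
Let g := (t * t)%N.
Let M := (8 * j * j * g)%N.
Let R := (k * k * M)%N.
Let sig := (8 * l * l * g)%N.
Hypotheses (k2 : (9 <= k)%N) (l1 : (1 <= l)%N) (t_large : (1000 * j * j * j <= t)%N).

Let W := (M + 7)%N.
Notation cnt := (lattice_count W).
Definition inner_kept := cnt (ball_in (M%:Z - 7) R%:Z (R%:Z - 5)).
Definition inner_lost := cnt (ball_out (M%:Z + 7) R%:Z (R%:Z + 8 * g%:Z - 5)).
Definition outer_kept := cnt (ball_out (M%:Z - 7) (R%:Z + 8 * g%:Z) (R%:Z + 8 * g%:Z + 5)).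
Definition outer_lost := cnt (ball_in (M%:Z + 7) (R%:Z + 8 * g%:Z) (R%:Z + 5)).
Let ann := cnt (annulus (M%:Z - 7) (M%:Z + 7)).

Let j9 : (9 <= j)%N. Proof. by rewrite /j; nia. Qed.
Let t9 : (1000 <= t)%N.
Proof. apply: leq_trans t_large; move: (j) j9; clear; nia. Qed.
Let g40 : (1000 * t <= g)%N. Proof. by apply: leq_mul => //; move: t9; clear; lia. Qed.
Let Mg : (648 * g <= M)%N. Proof. by apply: leq_mul => //; have := j9; move: (j); clear; nia. Qed.
Let RM : (81 * M <= R)%N. Proof. by apply: leq_mul => //; move: k2; clear; nia. Qed.

(** The origin of [t_large]: the layer has order [M * (j t)], that is [j^3 t^3], against
    [g^2 = t^4]. *)
Lemma annulus_count : (ann < g * g)%N.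
Proof.
(* The squared radii differ by [28 M = 224 (j t)^2], just below [(15 j t)^2]. *)
have H := @lattice_count_rows W (annulus (M%:Z - 7) (M%:Z + 7)) (M + 7) (15 * (j * t))
  0 (fun y => (M%:Z - 7) * (M%:Z - 7) + 1 - y * y).
apply: leq_ltn_trans (H _) _.
  move=> a b; rewrite ?annulusE => /andP[h1 h2].
  have ME : (28 * M <= (15 * (j * t)) * (15 * (j * t)))%N.
    have -> : M = (8 * ((j * t) * (j * t)))%N by rewrite /M /g; ring.
    by move: (j * t)%N; clear; nia.
  have aa : 0 <= a * a by rewrite -expr2 sqr_ge0.
  rewrite addr0 !expr2; apply/andP; split.
    have /andP[x y] : - (M%:Z + 7) <= b <= M%:Z + 7 by apply: sqr_le_abs; lia.
    by lia.
  move: (15 * (j * t))%N ME h1 h2; move: (M); clear => m r ME h1 h2.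
  have MEz : 28 * m%:Z <= r%:Z * r%:Z by rewrite -!PoszM lez_nat.
  lia.
have -> : M = (8 * (j * t) * (j * t))%N by rewrite /M /g; ring.
have b1 : (1000 * j * j * (j * t) <= t * t)%N by nia.
rewrite /g; move: (t) (j) t9 j9 b1; clear => u v u9 v9 b1.
have b2 : (1 <= v * u)%N by nia.
nia.
Qed.

Definition rect (x0 x1 y1 : int) (u : int * int) : bool :=
  (x0 <= u.1 < x1) && (0 <= u.2 < y1).

Lemma rectE x0 x1 y1 a b : rect x0 x1 y1 (a, b) = (x0 <= a < x1) && (0 <= b < y1).
Proof. by []. Qed.

Lemma rect_count (x0 y1 : int) (m r : nat) (x1 := x0 + m%:Z) :
  y1 = r%:Z -> - W%:Z <= x0 -> x1 <= W%:Z -> y1 <= W%:Z ->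
  (m * r <= cnt (rect x0 x1 y1))%N.
Proof.
move=> yr h0 h1 h2; apply: (@lattice_count_rect W _ x0 0) => i j' hi hj.
by rewrite /rect /in_grid /= /x1 in h1 *; lia.
Qed.

(* Up to a boundary layer, counted by [ann], moving the centre across the gap
   only adds points, among them those of a [g * g] square. *)
Lemma inner_lost_lt_outer_kept : (inner_lost < outer_kept)%N.
Proof.
have H1 : (inner_lost <= cnt (ball_out (M%:Z - 7) R (R%:Z + 8 * g%:Z - 5)) + ann)%N.
  apply: lattice_countU => -[a b]; rewrite ?ball_outE ?annulusE => /andP[/andP[_ h1] ->].
  by have := Mg; have := g40; have := t9; move: h1; clear; lia.
have H2 : (cnt (ball_out (M%:Z - 7) R (R%:Z + 8 * g%:Z - 5)) +
    cnt (rect g%:Z (g%:Z + g%:Z) g%:Z) <= outer_kept)%N.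
  apply: lattice_count_disj => u.
    by apply: ball_out_shift; have := RM; have := Mg; have := g40; have := t9; clear; lia.
  case: u => a b; rewrite ?rectE ?ball_outE => /andP[/andP[ha ha'] /andP[hb hb']].
  have := RM; have := Mg; have := g40; have := t9.
  move: (g) (M) (R) (t) ha ha' hb hb'; clear => g M R t ha ha' hb hb' h1 h2 h3 h4.
  have aa : a * a <= (2 * g%:Z) * (2 * g%:Z) by apply: ler_pM; lia.
  have bb : b * b <= g%:Z * g%:Z by apply: ler_pM; lia.
  have MM : (3 * g%:Z) * (3 * g%:Z) <= (M%:Z - 7) * (M%:Z - 7) by apply: ler_pM; lia.
  have b0 : 0 <= b * b by apply: mulr_ge0.
  apply/andP; split; last first.
    apply/negP => /andP[_]; apply/negP; rewrite -ltNge.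
    have : (R%:Z + a) * (R%:Z + a) <= (R%:Z + 2 * g%:Z) * (R%:Z + 2 * g%:Z).
      by apply: ler_pM; lia.
    have : (R%:Z + 7 * g%:Z) * (R%:Z + 7 * g%:Z) <=
        (R%:Z + 8 * g%:Z - 5) * (R%:Z + 8 * g%:Z - 5) by apply: ler_pM; lia.
    have : 0 <= R%:Z * g%:Z by apply: mulr_ge0.
    nia.
  have : (R%:Z + 8 * g%:Z + 5) * (R%:Z + 8 * g%:Z + 5) <=
    (R%:Z + 8 * g%:Z + a) * (R%:Z + 8 * g%:Z + a) by apply: ler_pM; lia.
  by lia.
have H3 : (g * g <= cnt (rect g%:Z (g%:Z + g%:Z) g%:Z))%N.
  by apply: rect_count => //; have := Mg; rewrite /W; lia.
by have := annulus_count; lia.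
Qed.

(** Moving the centre inward across the gap keeps points inside the circle ([ball_in_shift]) and
    gains a [g * g] square with abscissae from [- 5 g] to [- 4 g]: it is inside the circle seen from
    [R] and outside seen from [R + 8 g]. *)
Lemma outer_lost_lt_inner_kept : (outer_lost < inner_kept)%N.
Proof.
have H1 : (outer_lost <= cnt (ball_in (M%:Z - 7) (R%:Z + 8 * g%:Z) (R%:Z + 5)) + ann)%N.
  apply: lattice_countU => -[a b]; rewrite ?ball_inE ?annulusE => /andP[/andP[_ h1] ->].
  by have := Mg; have := g40; have := t9; move: h1; clear; lia.
have H2 : (cnt (ball_in (M%:Z - 7) (R%:Z + 8 * g%:Z) (R%:Z + 5)) +
    cnt (rect (- (5 * g%:Z)) (- (5 * g%:Z) + g%:Z) g%:Z) <= inner_kept)%N.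
  apply: lattice_count_disj => u.
    by apply: ball_in_shift; have := RM; have := Mg; have := g40; have := t9; clear; lia.
  case: u => a b; rewrite ?rectE ?ball_inE => /andP[/andP[ha ha'] /andP[hb hb']].
  have := RM; have := Mg; have := g40; have := t9.
  move: (g) (M) (R) (t) ha ha' hb hb'; clear => g M R t ha ha' hb hb' h1 h2 h3 h4.
  have aa : (- a) * (- a) <= (5 * g%:Z) * (5 * g%:Z) by apply: ler_pM; lia.
  have bb : b * b <= g%:Z * g%:Z by apply: ler_pM; lia.
  have MM : (6 * g%:Z) * (6 * g%:Z) <= (M%:Z - 7) * (M%:Z - 7) by apply: ler_pM; lia.
  have b0 : 0 <= b * b by apply: mulr_ge0.
  apply/andP; split; last first.
    apply/negP => /andP[_]; apply/negP; rewrite -leNgt.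
    have : (R%:Z + 5) * (R%:Z + 5) <=
        (R%:Z + 8 * g%:Z + a) * (R%:Z + 8 * g%:Z + a) by apply: ler_pM; lia.
    by lia.
  have : (R%:Z + a) * (R%:Z + a) <= (R%:Z - 4 * g%:Z) * (R%:Z - 4 * g%:Z).
    by apply: ler_pM; lia.
  have : (R%:Z - 2 * g%:Z) * (R%:Z - 2 * g%:Z) <=
        (R%:Z - 5) * (R%:Z - 5) by apply: ler_pM; lia.
  have : g%:Z * g%:Z <= R%:Z * g%:Z by apply: ler_pM; lia.
  have : 81 * (648 * g%:Z) * g%:Z <= R%:Z * g%:Z by apply: ler_pM; lia.
  nia.
have H3 : (g * g <= cnt (rect (- (5 * g%:Z)) (- (5 * g%:Z) + g%:Z) g%:Z))%N.
  by apply: rect_count => //; have := Mg; rewrite /W; lia.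
by have := annulus_count; lia.
Qed.

(** Convexity of the disc: a displacement from the boundary to a point well inside has first
    coordinate below [- 5], so the opposite displacement leads outside. *)
Lemma inner_kept_le_outer_kept : (inner_kept <= outer_kept)%N.
Proof.
apply: (@lattice_count_inj W W _ _ negp negp_inj) => -[a b].
rewrite ?ball_inE ?ball_outE ?negpE => /andP[h0 h]; apply/andP; split; last first.
  by apply: (@in_grid_of_ball W (M%:Z - 7)); rewrite /W /= ?mulrNN //; lia.
rewrite !mulrNN h0 /=; move/andP: h0 => [h1 h2].
have := RM; have := Mg; have := g40; have := t9.
move: (g) (M) (R) (t) h h1 h2; clear => g M R t h h1 h2 h3 h4 h5 h6.
have b0 : 0 <= b * b by rewrite -expr2 sqr_ge0.
have a5 : a < -5 by nia.
have : (R%:Z + 8 * g%:Z + 5) * (R%:Z + 8 * g%:Z + 5) <=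
    (R%:Z + 8 * g%:Z - a) * (R%:Z + 8 * g%:Z - a) by apply: ler_pM; lia.
by lia.
Qed.

Let sigE : (k * k * sig = M)%N.
Proof. by rewrite /sig /M /j; ring. Qed.

Let Rsig : (R * sig = M * M)%N.
Proof. by rewrite /R mulnAC sigE. Qed.

Let Mk : (1000 * (k * k) <= M)%N.
Proof.
rewrite -sigE mulnC; apply: leq_mul => //; rewrite /sig.
have := g40; have := t9; have : (1 <= l * l)%N by move: l1; clear; nia.
have -> : (8 * l * l * g = 8 * (l * l * g))%N by ring.
by move: (l * l)%N (g) (t); clear; nia.
Qed.

Let sigM : (81 * sig <= M)%N.
Proof. by rewrite -sigE; apply: leq_mul => //; move: k2; clear; nia. Qed.

Let M0 : (1000 <= M)%N.
Proof. by have := Mg; have := g40; have := t9; clear; lia. Qed.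

(** A rectangle of sides [half - sig] and [half], to the left of the strip of half-width [sig], lies
    inside the circle because [R * sig = M^2] dominates the quadratic terms. The bound makes a strip
    of order [M * sig = M^2 / k^2] a fraction of order [1 / k^2] of [inner_kept]. *)
Lemma inner_kept_ge : (M * M <= 8 * inner_kept)%N.
Proof.
pose half := (4 * j * j * g)%N.
have halfE : M = (2 * half)%N by rewrite /M /half; ring.
have H1 : (cnt (rect (- half%:Z) (- half%:Z + (half - sig)%N%:Z) half%:Z) <= inner_kept)%N.
  apply: lattice_count_sub => -[a b]; rewrite ?rectE ?ball_inE.
  move=> /andP[/andP[ha ha'] /andP[hb hb']].
  have := Rsig; have := sigM; have := Mk; have := RM; have := M0.
  have : R = (k * k * M)%N by [].
  move: (half) (M) (R) (sig) (k * k)%N halfE ha ha' hb hb'; clear.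
  move=> half M R sig kk halfE ha ha' hb hb' RE h1 h2 h3 h4 h5.
  have aa : (- a) * (- a) <= half%:Z * half%:Z by apply: ler_pM; lia.
  have bb : b * b <= half%:Z * half%:Z by apply: ler_pM; lia.
  have hM : 2 * (half%:Z * half%:Z) <= (M%:Z - 7) * (M%:Z - 7) by nia.
  apply/andP; split; first by apply/andP; split; lia.
  have ra : R%:Z * a <= R%:Z * (- sig%:Z) by apply: ler_wpM2l; lia.
  have R10 : 10 * R%:Z <= M%:Z * M%:Z by rewrite RE PoszM; nia.
  have RsigZ : R%:Z * sig%:Z = M%:Z * M%:Z by rewrite -!PoszM h5.
  have hM2 : 2 * (half%:Z * half%:Z) <= M%:Z * M%:Z by nia.
  lia.
have H2 := @rect_count (- half%:Z) half%:Z (half - sig) half erefl.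
apply: leq_trans (leq_mul (leqnn 8) H1).
have h3 : (81 * sig <= 2 * half)%N by rewrite -halfE sigM.
apply: leq_trans (leq_mul (leqnn 8) (H2 _ _ _)); rewrite ?/W; try (move: halfE h3; clear; lia).
move: h3; rewrite halfE; move: (half) (sig); clear; nia.
Qed.

(* [sig] bounds the sagitta [M ^ 2 / R] of the circle, so the two sides differ by
   a strip of width [2 sig] up to a reflection. *)
Lemma inner_lost_le : (k * k * (inner_lost + 1) <= k * k * inner_kept + 72 * inner_kept)%N.
Proof.
pose core u := ball_out (M%:Z - 7) R (R%:Z + 8 * g%:Z - 5) u.
pose right (u : int * int) := core u && (sig%:Z <= u.1).
pose strip (u : int * int) := (`|u.1| <= sig%:Z) && (`|u.2| <= M%:Z).
have H1 : (inner_lost <= cnt core + ann)%N.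
  apply: lattice_countU => -[a b]; rewrite /core ?ball_outE ?annulusE => /andP[/andP[_ h1] ->].
  by have := Mg; have := g40; have := t9; move: h1; clear; lia.
have H2 : (cnt core <= cnt strip + cnt right)%N.
  apply: lattice_countU => -[a b]; rewrite /right /core /strip ?ball_outE.
  move=> /andP[/andP[h1 h2] h3]; rewrite h1 h2 h3 /=.
  have /andP[b1 b2] : - (M%:Z - 7) <= b <= M%:Z - 7.
    by apply: sqr_le_abs => //; have : 0 <= a * a by [rewrite -expr2 sqr_ge0]; lia.
  have [//|sa] := leP sig%:Z a; first by rewrite orbT.
  rewrite orbF; apply/andP; split; last by lia.
  rewrite ler_norml (ltW sa) andbT.
  have := Rsig; have := RM; have := M0; have := g40; have := t9.
  move: (M) (R) (sig) (g) (t) h1 h2 h3 sa b1 b2; clear.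
  move=> M R sig g t h1 h2 h3 sa b1 b2 t9 g40 M0 RM Rsig.
  have RsigZ : R%:Z * sig%:Z = M%:Z * M%:Z by rewrite -!PoszM Rsig.
  rewrite leNgt; apply/negP => a_lt.
  have ra : R%:Z * a <= R%:Z * (- sig%:Z) by apply: ler_wpM2l; lia.
  have RR : R%:Z * R%:Z <= (R%:Z + 8 * g%:Z - 5) * (R%:Z + 8 * g%:Z - 5) by apply: ler_pM; lia.
  nia.
have H3 : (cnt right <= inner_kept)%N.
  apply: (@lattice_count_inj W W _ _ negp negp_inj) => -[a b].
  rewrite /right /core ?ball_inE ?ball_outE ?negpE => /andP[/andP[h0 h] sa].
  cbn [fst] in sa.
  apply/andP; split; last first.
    by apply: (@in_grid_of_ball W (M%:Z - 7)); rewrite /W /= ?mulrNN //; lia.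
  rewrite !mulrNN h0 /=; move/andP: h0 => [h1 h2].
  have := Rsig; have := Mk; have := M0; have : R = (k * k * M)%N by [].
  move: (M) (R) (sig) (k * k)%N h1 h2 sa; clear => M R sig kk h1 h2 sa RE M0 Mk Rsig.
  have RsigZ : R%:Z * sig%:Z = M%:Z * M%:Z by rewrite -!PoszM Rsig.
  have ra : R%:Z * sig%:Z <= R%:Z * a by apply: ler_wpM2l; lia.
  have R10 : 10 * R%:Z <= M%:Z * M%:Z by rewrite RE PoszM; nia.
  lia.
have H4 : (cnt strip <= (2 * M + 1) * (2 * (sig + 1)))%N.
  apply: (@lattice_count_rows _ _ M (sig + 1) 0 (fun=> 0)) => a b.
  rewrite /strip; cbn [fst snd].
  move=> /andP[ha ->]; rewrite addr0 sqr_ge0 add0r andTb.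
  move: ha; rewrite ler_norml => /andP[]; move: (sig) => x; clear; rewrite !expr2; nia.
have H5 := annulus_count; have H6 := inner_kept_ge.
have kg : (k * k * g <= M)%N.
  by rewrite -sigE; apply: leq_mul => //; rewrite /sig; apply: leq_pmull;
    move: l1; clear; nia.
have := sigE; have := Mk; have := M0; have := Mg; have := sigM.
move: (k * k)%N inner_lost inner_kept ann (cnt right) (cnt core) (cnt strip) (g) (M) (sig) H1 H2 H3 H4 H5 H6 kg; clear.
move=> kk o i an c0 c s g M sig H1 H2 H3 H4 H5 H6 kg h1 h2 h3 h4 h5.
(* The strict bound [ann < g * g] absorbs the [+ 1]. After multiplication by [k^2] the strip and the
   layer are at most [7 M^2] and [M^2]. Since [M^2 <= 8 inner_kept], this is at most
   [64 inner_kept], within the [72] of the statement. *)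
have o_le : (o + 1 <= i + (2 * M + 1) * (2 * (sig + 1)) + g * g)%N by lia.
have X : (kk * (o + 1) <= kk * (i + (2 * M + 1) * (2 * (sig + 1)) + g * g))%N by apply: leq_mul.
have Y : (kk * ((2 * M + 1) * (2 * (sig + 1))) <= 7 * (M * M))%N.
  have -> : (kk * ((2 * M + 1) * (2 * (sig + 1))) = (2 * M + 1) * (2 * (M + kk)))%N.
    by rewrite -h5; ring.
  by move: h3 h4; clear; nia.
have Z : (kk * (g * g) <= M * M)%N.
  by rewrite mulnA; apply: leq_mul => //; move: h2; clear; lia.
move: X Y Z H5 H6; rewrite !mulnDr; clear; lia.
Qed.

(** The squared radii differ by [16 g R + 64 g^2], at most [192 (k j g)^2], whence [14 k j g].
    Counting by rows exceeds the true area by a factor of order [k j], which is affordable because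
    [l] is taken large after [k]. *)
Lemma gap_count W' : (j * lattice_count W' (shell R%:Z (R%:Z + 8 * g%:Z))
  <= 15 * (k * k * k * (M * M)))%N.
Proof.
have H := @lattice_count_rows W' (shell R%:Z (R%:Z + 8 * g%:Z))
  (R + 8 * g) (14 * k * j * g) 0 (fun y => R%:Z * R%:Z - y * y).
apply: leq_trans (leq_mul (leqnn j) (H _)) _.
  move=> a b /andP[]; cbn [fst snd] => h1 h2; rewrite addr0.
  have w2 : (16 * g * R + 64 * g * g <= (14 * k * j * g) * (14 * k * j * g))%N.
    have -> : (16 * g * R + 64 * g * g = 128 * ((k * j * g) * (k * j * g)) + 64 * (g * g))%N.
      by rewrite /R /M; ring.
    have -> : (14 * k * j * g = 14 * (k * j * g))%N by ring.
    have : (g <= k * j * g)%N by apply: leq_pmull; move: j9 k2; clear; nia.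
    by move: (k * j * g)%N (g); clear; nia.
  apply/andP; split.
    have : 0 <= a * a by rewrite -expr2 sqr_ge0.
    by move: h2; clear; nia.
  rewrite expr2; move: h1 h2 w2; move: (14 * k * j * g)%N (R) (g); clear; nia.
have RE : R = (8 * k * k * j * j * g)%N by rewrite /R /M; ring.
have b1 : (2 * (R + 8 * g) + 1 <= 17 * k * k * j * j * g)%N.
  have a1 : (81 * 81 * g <= k * k * j * j * g)%N.
    by apply: leq_mul => //; move: k2 j9; clear; nia.
  by have := g40; have := t9; rewrite RE; move: a1; clear; nia.
apply: leq_trans (leq_mul (leqnn j) (leq_mul b1 (leqnn _))) _.
have -> : (j * (17 * k * k * j * j * g * (2 * (14 * k * j * g))) =
   476 * (k * k * k * (j * j * g * (j * j * g))))%N by ring.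
have -> : (M = 8 * (j * j * g))%N by rewrite /M; ring.
by move: (j * j * g)%N (k * k * k)%N; clear; nia.
Qed.

(** The squared radii differ by less than [6 R M], and [R = k^2 M] gives [(3 k M)^2]. The rows
    overcount by a factor of order [k], harmless against [h^2] of order [k^-4]. *)
Lemma raised_count W' : (lattice_count W' (shell (R%:Z - 3 * M%:Z) R%:Z)
  <= 19 * (k * k * k * (M * M)))%N.
Proof.
have H := @lattice_count_rows W' (shell (R%:Z - 3 * M%:Z) R%:Z) R (3 * k * M) 0
  (fun y => (R%:Z - 3 * M%:Z) * (R%:Z - 3 * M%:Z) - y * y).
apply: leq_trans (H _) _.
  move=> a b /andP[]; cbn [fst snd] => h1 h2; rewrite addr0.
  have w2 : (6 * R * M <= (3 * k * M) * (3 * k * M))%N.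
    by rewrite /R; move: (M) (k); clear; nia.
  apply/andP; split.
    have : 0 <= a * a by rewrite -expr2 sqr_ge0.
    by move: h2; clear; nia.
  rewrite expr2; move: h1 h2 w2; move: (3 * k * M)%N (R) (M); clear; nia.
have b1 : (2 * R + 1 <= 3 * k * k * M)%N.
  by rewrite /R; have := M0; move: k2; clear; nia.
apply: leq_trans (leq_mul b1 (leqnn _)) _.
have -> : (3 * k * k * M * (2 * (3 * k * M)) = 18 * (k * k * k * (M * M)))%N by ring.
by rewrite leq_mul2r orbT.
Qed.

End ReferenceCounts.

(* Imported only here: [classical_sets] shadows [setP], [set0], [subsetP] and
   the set comprehensions of [finset]. *)
Require Import Defs.
From mathcomp Require Import all_classical all_reals all_analysis.
From mathcomp Require Import measurable_realfun.
Import numFieldNormedType.Exports.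
Local Open Scope classical_set_scope.
Local Open Scope ring_scope.

(** * Probability of a template *)

Lemma factorial_expR_le (R : realType) (k : nat) :
  k`!%:R * expR k%:R <= expR 1 * (k%:R + 1) * k%:R ^+ k :> R.
Proof.
case: k => [|k].
  by rewrite fact0 expR0 expr0 !mulr1 add0r mulr1 -expR0 ler_expR.
(* For a positive argument the factor [k + 1] can be lowered to [k], and this sharper bound is the
   one that passes through the induction. *)
apply: (@le_trans _ _ (expR 1 * k.+1%:R * k.+1%:R ^+ k.+1)); last first.
  by rewrite ler_wpM2r ?exprn_ge0 ?ler0n// ler_wpM2l ?expR_ge0// lerDl.
elim: k => [|k IHk]; first by rewrite (_ : 1`! = 1%N) // mul1r expr1 !mulr1.
(* With [m = k + 2], this is [exp (- 1 / m) >= 1 - 1 / m] raised to the power [m]. *)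
have step : expR 1 * k.+1%:R ^+ k.+2 <= k.+2%:R ^+ k.+2 :> R.
  rewrite -ler_pdivlMl ?expR_gt0// -expRN.
  have k2 : 0 < k.+2%:R :> R by rewrite ltr0n.
  rewrite -ler_pdivrMr ?exprn_gt0// -expr_div_n.
  have -> : -1 = k.+2%:R * (- k.+2%:R^-1) :> R by rewrite mulrN mulfV ?gt_eqF.
  rewrite expRM_natl lerXn2r ?nnegrE ?expR_ge0 ?divr_ge0 ?ler0n//.
  apply: le_trans (expR_ge1Dx _).
  by rewrite ler_pdivrMr // mulrBl mul1r mulVf ?gt_eqF // -[k.+2%:R]natr1 addrK.
rewrite factS natrM -[X in expR X]natr1 expRD.
have H : k.+2%:R * expR 1 * (k.+1`!%:R * expR k.+1%:R) <=
   k.+2%:R * expR 1 * (expR 1 * k.+1%:R * k.+1%:R ^+ k.+1) :> R.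
  by rewrite ler_wpM2l // mulr_ge0 ?expR_ge0.
rewrite [leLHS](_ : _ = k.+2%:R * expR 1 * (k.+1`!%:R * expR k.+1%:R)); last by ring.
apply: (le_trans H).
rewrite [leLHS](_ : _ = expR 1 * k.+2%:R * (expR 1 * k.+1%:R ^+ k.+2)).
  by rewrite ler_wpM2l // mulr_ge0 ?expR_ge0.
by rewrite [in RHS]exprS; ring.
Qed.

(* Stirling's bound [k! <= e (k + 1) (k / e) ^ k] and [(1 + h) ^ k <= e ^ (h k)]. *)
Lemma poisson_weight_ge (R : realType) (lam h : R) (k := Num.trunc ((1 + h) * lam)) :
  0 <= lam -> 0 <= h <= 1 ->
  expR (lam * (1 - h ^+ 2)) / (expR 2 * (2 * lam + 1)) <= lam ^+ k / k`!%:R.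
Proof.
move=> l0 /andP[h0 h1].
have x0 : 0 <= (1 + h) * lam by rewrite mulr_ge0 // addr_ge0.
have /andP[k1 k2] : k%:R <= (1 + h) * lam < k.+1%:R by exact: trunc_itv.
have f0 : 0 < k`!%:R :> R by rewrite ltr0n fact_gt0.
have q0 : 0 < expR 2 * (2 * lam + 1) by rewrite mulr_gt0 ?expR_gt0 //; lra.
rewrite ler_pdivrMr // mulrAC ler_pdivlMr //.
have E : expR (lam * (1 - h ^+ 2)) <= expR (k%:R * (1 - h)) * expR 1.
  rewrite -expRD ler_expR.
  have : 0 <= (k.+1%:R - (1 + h) * lam) * (1 - h) by rewrite mulr_ge0 //; lra.
  by rewrite -natr1; lra.
apply: (@le_trans _ _ (expR (k%:R * (1 - h)) * expR 1 * k`!%:R)).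
  by rewrite ler_wpM2r // ltW.
have -> : expR (k%:R * (1 - h)) * expR 1 * k`!%:R =
    expR 1 * expR (- (k%:R * h)) * (k`!%:R * expR k%:R).
  by rewrite mulrBr mulr1 expRD; ring.
apply: (@le_trans _ _ (expR 1 * expR (- (k%:R * h)) *
    (expR 1 * (2 * lam + 1) * ((1 + h) * lam) ^+ k))).
  rewrite ler_wpM2l ?mulr_ge0 ?expR_ge0 //.
  apply: (le_trans (factorial_expR_le R k)).
  apply: ler_pM; rewrite ?mulr_ge0 ?exprn_ge0 ?expR_ge0 ?ler0n //.
    by rewrite ler_wpM2l ?expR_ge0 // lerD2r; apply: (le_trans k1); nra.
  by rewrite lerXn2r ?nnegrE ?ler0n.
have hk : (1 + h) ^+ k <= expR (k%:R * h).
  by rewrite expRM_natl lerXn2r ?nnegrE ?expR_ge0 ?expR_ge1Dx // addr_ge0.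
rewrite exprMn (_ : expR 2 = expR 1 * expR 1); last by rewrite -expRD.
rewrite [leLHS](_ : _ = (expR 1 * expR 1 * (2 * lam + 1) * lam ^+ k) *
  ((1 + h) ^+ k * expR (- (k%:R * h)))); last by ring.
rewrite [leRHS](_ : _ = (expR 1 * expR 1 * (2 * lam + 1) * lam ^+ k) * 1);
  last by ring.
rewrite ler_wpM2l ?mulr_ge0 ?exprn_ge0 ?expR_ge0 //; first by lra.
by rewrite expRN ler_pdivrMr ?expR_gt0 // mul1r.
Qed.

(** For [beta <= 1 / 2], [- ln (1 - beta) <= beta / (1 - beta) <= beta + 2 beta^2]. *)
Lemma expR_le_pow (R : realType) (beta : R) (n : nat) : 0 <= beta <= 1 / 2 ->
  expR (- (n%:R * (beta + 2 * beta ^+ 2))) <= (1 - beta) ^+ n.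
Proof.
move=> /andP[b0 b1]; rewrite -mulrN expRM_natl lerXn2r ?nnegrE ?expR_ge0 //; first by lra.
have b2 : 0 < 1 - beta by lra.
apply: (@le_trans _ _ (expR (- (beta / (1 - beta))))).
  rewrite ler_expR lerN2 ler_pdivrMr //.
  by have := sqr_ge0 beta; nra.
rewrite expRN -[leRHS]invrK lef_pV2 ?posrE ?expR_gt0 ?invr_gt0 //.
apply: le_trans (expR_ge1Dx _).
by rewrite -[X in _ <= X + _](@mulfV _ (1 - beta)) ?gt_eqF // -mulrDl subrK mul1r.
Qed.

Definition template_count (R : realType) (B : finType) (gap : pred B) (h : B -> R)
    (lam : R) (b : B) : nat :=
  if gap b then 0%N else Num.trunc ((1 + h b) * lam).

(* To first order, minus the logarithm of the probability that a given cell
   follows the template, divided by the mean number of points in a box. *)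
Definition template_cost (R : realType) (B : finType) (gap : pred B) (h : B -> R) : R :=
  \sum_b (if gap b then 1 else h b ^+ 2).

Section CountProb.
Variables (R : realType) (B : finType) (gap : pred B) (h : B -> R).
Hypothesis h01 : forall b, 0 <= h b <= 1.
Variables (n : nat) (a lam : R).
Hypothesis n0 : (0 < n)%N.
Hypothesis a0 : 0 < a.
Hypothesis lamE : lam = n%:R * a.
Hypothesis n_large : 16 * ((#|B|%:R + 1) * (lam + 1)) ^+ 2 <= n%:R.

Let kappa := template_count gap h lam.
Let k := (\sum_b kappa b)%N.
Let beta := #|B|%:R * a.

Let nR0 : 0 < n%:R :> R. Proof. by rewrite ltr0n. Qed.
Let lam0 : 0 < lam. Proof. by rewrite lamE mulr_gt0. Qed.
Let B0 : 0 <= #|B|%:R :> R. Proof. exact: ler0n. Qed.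

Lemma template_count_le b : (kappa b)%:R <= 2 * lam.
Proof.
rewrite /kappa /template_count; case: ifP => _; first by rewrite mulr_ge0 // ltW.
have /andP[h0 h1] := h01 b.
have x0 : 0 <= (1 + h b) * lam by rewrite mulr_ge0 ?ltW //; lra.
have /andP[H _] := trunc_itv x0.
by apply: (le_trans H); rewrite ler_pM2r //; lra.
Qed.

Lemma template_total_le : k%:R <= 2 * (#|B|%:R * lam).
Proof.
rewrite natr_sum; apply: (@le_trans _ _ (\sum_(b : B) 2 * lam)).
  by apply: ler_sum => b _; exact: template_count_le.
by rewrite sumr_const -[_ *+ #|_|]mulr_natl; lra.
Qed.

Lemma Blam_sq_le : 16 * (#|B|%:R * lam) ^+ 2 <= n%:R.
Proof.
apply: le_trans n_large; rewrite ler_pM2l //.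
have := lam0; have := B0; move: #|B|%:R (lam) => x y x0 y0.
by rewrite lerXn2r ?nnegrE //; nra.
Qed.

Lemma Blam_le : 16 * (#|B|%:R * lam) <= n%:R.
Proof.
apply: le_trans n_large; rewrite ler_pM2l //.
have := lam0; have := B0; move: #|B|%:R (lam) => x y x0 y0.
rewrite expr2; apply: (@le_trans _ _ (((x + 1) * (y + 1)) * 1)).
  by nra.
by rewrite ler_wpM2l //; nra.
Qed.

Lemma template_total2_le : (2 * k <= n)%N.
Proof.
rewrite -(ler_nat R) natrM; have := template_total_le; have := Blam_le.
have : 0 <= #|B|%:R * lam by rewrite mulr_ge0 // ltW.
lra.
Qed.

Lemma betaE : n%:R * beta = #|B|%:R * lam.
Proof. by rewrite /beta lamE; ring. Qed.

Lemma beta_le : 0 <= beta <= 1 / 16.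
Proof.
apply/andP; split; first by rewrite mulr_ge0 // ltW.
rewrite -(ler_pM2l nR0) betaE; have := Blam_le; lra.
Qed.

Lemma k_beta_le : 2 * k%:R * beta <= 4 * (#|B|%:R * lam) ^+ 2 / n%:R.
Proof.
rewrite ler_pdivlMr //.
have -> : 2 * k%:R * beta * n%:R = 2 * k%:R * (#|B|%:R * lam).
  by rewrite -betaE; ring.
have := template_total_le; have : 0 <= #|B|%:R * lam by rewrite mulr_ge0 // ltW.
by move: (#|B|%:R * lam) k%:R => y x; nra.
Qed.

(** Poisson approximation. The falling factorial is at least [n^k / 2], and [(1 - beta)^(n - k)] is
    at least [exp (- 1) * exp (- #|B| * lam)]. A box outside the gap contributes
    [exp (lam (1 - h^2))] up to a factor linear in [lam], a gap box only [1]. Against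
    [exp (- #|B| * lam)] each box is thus left with its share of [exp (- cost * lam)]. *)
Lemma count_prob_ge :
  expR (- 1) / 2 * expR (- (template_cost gap h * lam))
    / (expR 2 * (2 * lam + 1)) ^+ #|B| <= count_prob n kappa a.
Proof.
have kn : (k <= n)%N by have := template_total2_le; lia.
have q0 : 0 < expR 2 * (2 * lam + 1).
  by rewrite mulr_gt0 ?expR_gt0 //; have := lam0; lra.
have f0 : 0 < (\prod_b (kappa b)`!)%:R :> R.
  by rewrite ltr0n prodn_gt0 // => b; rewrite fact_gt0.
have ffact_ge : n%:R ^+ k / 2 <= (n ^_ k)%:R :> R.
  have H1 : (n - k)%:R ^+ k <= (n ^_ k)%:R :> R.
    rewrite -natrX ler_nat ffact_prod -[k in (_ ^ k)%N]card_ord -prod_nat_const.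
    by apply: leq_prod => i _; rewrite leq_sub2l // ltnW.
  apply: le_trans H1; rewrite natrB //.
  have -> : n%:R - k%:R = n%:R * (1 - k%:R / n%:R) :> R by field; rewrite gt_eqF.
  rewrite exprMn ler_pM2l ?exprn_gt0 //.
  have kn' : 0 <= (k%:R / n%:R : R) <= 1.
    by apply/andP; split; rewrite ?divr_ge0 ?ler0n ?ler_pdivrMr ?mul1r ?ler_nat.
  apply: le_trans (bernoulli_ineq k kn').
  suff : k%:R * (k%:R / n%:R) <= 1 / 2 :> R by lra.
  rewrite mulrA ler_pdivrMr //; have := Blam_sq_le; have := template_total_le.
  have : 0 <= k%:R :> R by exact: ler0n.
  by move: (#|B|%:R * lam) k%:R => y x x0 xy ny; nra.
have prod_ge : expR (#|B|%:R * lam - template_cost gap h * lam)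
    / (expR 2 * (2 * lam + 1)) ^+ #|B| <=
    lam ^+ k / (\prod_b (kappa b)`!)%:R.
  have -> : lam ^+ k / (\prod_b (kappa b)`!)%:R =
      \prod_b (lam ^+ kappa b / (kappa b)`!%:R).
    by rewrite prodf_div natr_prod /k expr_sum.
  have -> : expR (#|B|%:R * lam - template_cost gap h * lam)
    / (expR 2 * (2 * lam + 1)) ^+ #|B| =
    \prod_b (expR (lam * (1 - (if gap b then 1 else h b ^+ 2))) /
       (expR 2 * (2 * lam + 1))).
    rewrite prodf_div prodr_const -expR_sum; congr (expR _ / _).
    rewrite -mulr_sumr sumrB sumr_const /template_cost mulrBr mulrC.
    by congr (_ - _); rewrite mulrC.
  apply: ler_prod => b _; rewrite divr_ge0 ?expR_ge0 ?(ltW q0) //=.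
  rewrite /kappa /template_count; case: ifP => _; last first.
    by apply: poisson_weight_ge; rewrite ?h01 // ltW.
  rewrite subrr mulr0 expR0 expr0 fact0 divr1 ler_pdivrMr // mul1r.
  have e2 : 1 <= expR 2 :> R by rewrite -expR0 ler_expR.
  by have := lam0; nra.
have beta_bound : expR (- 1) * expR (- (#|B|%:R * lam)) <= (1 - beta) ^+ (n - k).
  apply: (@le_trans _ _ ((1 - beta) ^+ n)); last first.
    apply: ler_wiXn2l; rewrite ?leq_subr //; have := beta_le; lra.
  apply: le_trans (expR_le_pow n _); last by have := beta_le; lra.
  rewrite -expRD ler_expR.
  have -> : n%:R * (beta + 2 * beta ^+ 2) =
     #|B|%:R * lam + 2 * (#|B|%:R * lam) ^+ 2 / n%:R.
    by rewrite -betaE; field; rewrite gt_eqF.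
  suff : 2 * (#|B|%:R * lam) ^+ 2 / n%:R <= 1 by lra.
  by rewrite ler_pdivrMr // mul1r; have := Blam_sq_le; have := sqr_ge0 (#|B|%:R * lam); lra.
rewrite /count_prob -/k -/beta.
apply: (@le_trans _ _ (1 / 2 * (expR (#|B|%:R * lam - template_cost gap h * lam)
    / (expR 2 * (2 * lam + 1)) ^+ #|B|) * (expR (- 1) * expR (- (#|B|%:R * lam))))).
  rewrite [expR (#|B|%:R * lam - _)]expRD [expR (- (#|B|%:R * lam))]expRN.
  rewrite le_eqVlt; apply/orP; left; apply/eqP; field.
  by rewrite !gt_eqF ?expR_gt0 // exprn_gt0.
have pn a' : 0 <= a' -> 0 <= a' / (expR 2 * (2 * lam + 1)) ^+ #|B|.
  by move=> ?; rewrite divr_ge0 // exprn_ge0 // ltW.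
apply: ler_pM => //.
  by apply: mulr_ge0; [lra|apply: pn; exact: expR_ge0].
apply: (@le_trans _ _ (1 / 2 * (lam ^+ k / (\prod_b (kappa b)`!)%:R))).
  by rewrite ler_wpM2l.
rewrite lamE exprMn.
have fa : 0 <= a ^+ k / (\prod_b (kappa b)`!)%:R.
  by rewrite divr_ge0 ?exprn_ge0 ?ler0n // ltW.
have := ler_wpM2r fa ffact_ge; move: (n ^_ k)%:R (n%:R ^+ k) => u v; lra.
Qed.

End CountProb.

(** * Grid boxes and the law of the box assignment *)

Lemma measure_fibers d (T : measurableType d) (R : realType)
    (P : probability T R) (L : finType) (g : T -> L) (S : pred L) :
  (forall l, measurable (g @^-1` [set l])) ->
  P [set w | S (g w)] = (\sum_(l | S l) P (g @^-1` [set l]))%E.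
Proof.
move=> mg.
have -> : [set w | S (g w)] = \bigcup_(l in [set` S]) (g @^-1` [set l]).
  by apply/seteqP; split => [w Sgw|w [l Sl /= gl]] /=; [exists (g w)|rewrite gl].
rewrite measure_fin_bigcup //; last first.
  by move=> l l' _ _ [w /= [gl gl']]; rewrite -gl -gl'.
by rewrite -(@bigfs _ _ _ _ (index_enum L)) ?index_enum_uniq // => l _; rewrite mem_index_enum.
Qed.

Lemma measurable_fiber_pred d (T : measurableType d) (L : finType) (g : T -> L)
    (S : set L) :
  (forall l, measurable (g @^-1` [set l])) -> measurable (g @^-1` S).
Proof.
move=> mg.
have -> : g @^-1` S = \bigcup_(l in S) (g @^-1` [set l]).
  by apply/seteqP; split => [w Sgw|w [l Sl /= gl]] /=; [exists (g w)|rewrite gl].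
exact: fin_bigcup_measurable.
Qed.

Lemma lebesgue_tuple0 (R : realType) d : lebesgue_tuple (set0 : set (d.-tuple R)) = 0%E.
Proof.
case: d => [|d] /=; first by rewrite dirac0.
by apply: integral0_eq => x _; elim: d => [|d IHd] /=; [rewrite dirac0|apply: integral0_eq].
Qed.

Lemma lebesgue_tuple_box (R : realType) d (l : 'I_d -> R) (s : R) : 0 <= s ->
  lebesgue_tuple [set t : d.-tuple R | forall k, l k <= tnth t k < l k + s] =
  (s ^+ d)%:E.
Proof.
move=> s0; elim: d l => [|d IHd] l.
  by rewrite /= diracE mem_set // => -[].
pose I := [set` `[l ord0, l ord0 + s[].
transitivity (\int[@lebesgue_measure R]_x ((s ^+ d)%:E * (\1_I x)%:E))%E.
  apply: eq_integral => x _; rewrite indicE; have [xI|xI] := boolP (x \in I).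
    rewrite mule1 -(IHd (fun k => l (lift ord0 k))); congr lebesgue_tuple.
    apply/seteqP; split => t /= H k.
      by have := H (lift ord0 k); rewrite tnthS.
    case: (unliftP ord0 k) => [j ->|->]; first by rewrite tnthS.
    by move: xI; rewrite inE /I /= in_itv /= tnth0.
  rewrite mule0 -[RHS](lebesgue_tuple0 R d); congr lebesgue_tuple.
  apply/seteqP; split => t //= /(_ ord0); rewrite tnth0 => H.
  by move: xI; rewrite notin_setE /I /= in_itv.
rewrite ge0_integralZl //=; last 2 first.
- by apply/measurable_EFinP; apply: measurable_indic; exact: measurable_itv.
- by rewrite lee_fin exprn_ge0.
have muI : lebesgue_measure I = s%:E.
  rewrite /I lebesgue_measure_itv /= lte_fin ltrDl; case: ifPn => [_|].
    by rewrite -EFinB addrC addKr.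
  by rewrite -leNgt => s0'; congr EFin; apply/eqP; rewrite eq_le s0.
rewrite integral_indic //; last exact: measurable_itv.
by rewrite setIT exprSr EFinM; congr (_ * _)%E.
Qed.

Section GridCells.
Variables (R : realType) (d N T : nat) (s : R).
Hypothesis s_gt0 : 0 < s.
Hypothesis grid_le1 : (T * N)%:R * s <= 1.

Let C := {ffun 'I_d -> 'I_T}.
Let B := {ffun 'I_d -> 'I_N}.

(** Division with remainder by [N] splits the index of a box into its cell and its position in the
    cell, so a point has at most one label. *)
Definition in_box (cb : C * B) (x : d.-tuple R) : bool :=
  [forall k, Num.floor (tnth x k / s) == (cb.1 k * N + cb.2 k)%N%:Z].

Definition box_of (x : d.-tuple R) : option (C * B) := [pick cb | in_box cb x].

Lemma box_ofE x cb : (box_of x == Some cb) = in_box cb x.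
Proof.
rewrite /box_of; case: pickP => [cb' H'|H]; last by rewrite H.
apply/eqP/idP => [[<-]//|H]; congr Some.
case: cb cb' H H' => [c b] [c' b'] /forallP /= H /forallP /= H'.
have E k : (c k * N + b k = c' k * N + b' k)%N.
  by have := H k; rewrite (eqP (H' k)) eqz_nat => /eqP ->.
by congr (_, _); apply/ffunP => k; apply/val_inj => /=;
  [have := congr1 (divn^~ N) (E k)|have := congr1 (modn^~ N) (E k)];
  rewrite ?modnMDl ?divnMDl ?(leq_ltn_trans _ (ltn_ord (b k))) // ?modn_small //
    ?divn_small // ?addn0.
Qed.

Lemma in_boxE cb x : in_box cb x <->
  forall k, (cb.1 k * N + cb.2 k)%:R * s <= tnth x k <
            (cb.1 k * N + cb.2 k)%:R * s + s.
Proof.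
split => [/forallP H k|H]; [have := H k|apply/forallP => k; have := H k];
  rewrite floor_eq ler_pdivlMr // ltr_pdivrMr // intrD;
  by rewrite mulrDl mul1r.
Qed.

Lemma measurable_in_box cb : measurable [set x | in_box cb x].
Proof.
pose I k := [set` `[(cb.1 k * N + cb.2 k)%:R * s, (cb.1 k * N + cb.2 k)%:R * s + s[] : set R.
have -> : [set x | in_box cb x] = \bigcap_(k in setT) ((fun x => tnth x k) @^-1` I k).
  apply/seteqP; split => x /= H.
    by move=> k _; move/in_boxE: H => /(_ k); rewrite /I /= in_itv.
  by apply/in_boxE => k; have := H k Logic.I; rewrite /I /= in_itv.
apply: fin_bigcap_measurable => // k _.
rewrite -[X in measurable X]setTI; apply: measurable_tnth => //.
exact: measurable_itv.
Qed.

Lemma in_box_cube cb x : in_box cb x -> unit_cube x.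
Proof.
move=> /in_boxE H k; have /andP[H1 H2] := H k; apply/andP; split.
  by apply: le_trans H1; rewrite mulr_ge0 ?ler0n // ltW.
apply: le_trans grid_le1; apply: le_trans (ltW H2) _.
rewrite -[X in _ + X]mul1r -mulrDl natr1 ler_pM2r // ler_nat.
by have := ltn_ord (cb.1 k); have := ltn_ord (cb.2 k); nia.
Qed.

Lemma measurable_box_of l : measurable (box_of @^-1` [set l]).
Proof.
case: l => [cb|].
  rewrite (_ : _ @^-1` _ = [set x | in_box cb x]); first exact: measurable_in_box.
  by apply/seteqP; split => x /=; rewrite -box_ofE => /eqP.
rewrite (_ : _ @^-1` _ = ~` (\bigcup_(cb in setT) [set x | in_box cb x])).
  apply: measurableC; apply: fin_bigcup_measurable => [|cb _]; first exact: finite_finset.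
  exact: measurable_in_box.
apply/seteqP; split => x /=.
  by move=> bx [cb _] /=; rewrite -box_ofE bx.
move=> H; case E : (box_of x) => [cb|//]; case: H; exists cb => //=.
by rewrite -box_ofE E.
Qed.

Variables (n : nat) (M : uniform_points R d n).

Lemma prob_box i l :
  up_prob M ((box_of \o up_pos M i) @^-1` [set l]) = (cell_weight (s ^+ d) l)%:E.
Proof.
have mX l' : measurable ((box_of \o up_pos M i) @^-1` [set l']).
  rewrite comp_preimage -[X in measurable X]setTI.
  by apply: measurable_funP => //; exact: measurable_box_of.
have pS cb : up_prob M ((box_of \o up_pos M i) @^-1` [set Some cb]) = (s ^+ d)%:E.
  rewrite comp_preimage up_uniform; last exact: measurable_box_of.
  rewrite -(@lebesgue_tuple_box R d (fun k => (cb.1 k * N + cb.2 k)%:R * s)) ?ltW//.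
  congr lebesgue_tuple; apply/seteqP; split => x /=.
    by move=> [/eqP]; rewrite box_ofE => /in_boxE.
  move=> /in_boxE H; split; last exact: in_box_cube H.
  by apply/eqP; rewrite box_ofE.
case: l => [cb|]; first exact: pS.
have := measure_fibers (up_prob M) predT mX.
rewrite (_ : [set w | predT _] = setT) ?probability_setT; last by apply/seteqP.
rewrite big_option (eq_bigr (fun=> (s ^+ d)%:E)) => [|cb _]; last exact: pS.
rewrite sumEFin sumr_const /=.
set q := up_prob M _; have : q \is a fin_num by exact: fin_num_measure.
move: q => [q| |]// _ [] H; congr EFin.
by apply/eqP; rewrite eq_sym subr_eq mulr_natl H.
Qed.

Lemma prob_boxes (f : {ffun 'I_n -> option (C * B)}) :
  up_prob M [set w | [ffun i => box_of (up_pos M i w)] = f] =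
  (\prod_i cell_weight (s ^+ d) (f i))%:E.
Proof.
have := up_indep M [set: 'I_n]%SET (A := fun i => box_of @^-1` [set f i])
  (fun i => measurable_box_of (f i)).
rewrite (eq_bigr (fun i => (cell_weight (s ^+ d) (f i))%:E)); last first.
  by move=> i _; exact: prob_box.
rewrite (eq_bigl predT) => [|i]; last by rewrite inE.
rewrite prodEFin => <-; congr (up_prob M _).
apply/seteqP; split => w /=.
  by move=> <- i _ /=; rewrite ffunE.
by move=> H; apply/ffunP => i; rewrite ffunE; apply: H; rewrite /= inE.
Qed.

Lemma measurable_boxes (f : {ffun 'I_n -> option (C * B)}) :
  measurable [set w | [ffun i => box_of (up_pos M i w)] = f].
Proof.
have -> : [set w | [ffun i => box_of (up_pos M i w)] = f] =
    \bigcap_(i in setT) (up_pos M i @^-1` (box_of @^-1` [set f i])).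
  apply/seteqP; split => w /=; first by move=> <- i _ /=; rewrite ffunE.
  by move=> H; apply/ffunP => i; rewrite ffunE; exact: H.
apply: fin_bigcap_measurable => // i _; rewrite -[X in measurable X]setTI.
by apply: measurable_funP => //; exact: measurable_box_of.
Qed.

End GridCells.

Lemma sgraph_ext (V : finType) (G G' : sgraph V) : adj G =2 adj G' -> G = G'.
Proof.
case: G G' => [e s i] [e' s' i'] /= ee'.
have E : e = e' by apply/funext => x; apply/funext => y.
by subst e'; congr SGraph; exact: Prop_irrelevance.
Qed.

Lemma measurable_euclidean_dist (R : realType) (d n : nat)
    (M : uniform_points R d n) (i j : 'I_n) :
  measurable_fun setT (fun w => euclidean_dist (up_pos M i w) (up_pos M j w)).
Proof.
apply: (@measurableT_comp _ _ _ _ _ _ (@Num.sqrt R)).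
  apply: nondecreasing_measurable => // x y; exact: ler_wsqrtr.
apply: measurable_sum => k; apply: measurable_funX; apply: measurable_funB.
  apply: (@measurableT_comp _ _ _ _ _ _ (fun x : d.-tuple R => tnth x k)) => //.
  exact: measurable_tnth.
apply: (@measurableT_comp _ _ _ _ _ _ (fun x : d.-tuple R => tnth x k)) => //.
exact: measurable_tnth.
Qed.

(** Finitely many measurable comparisons of distances determine the graph, so each of its properties
    is a finite union of events. *)
Lemma measurable_rgg_event (R : realType) (d n : nat) (M : uniform_points R d n)
    (r : R) (Q : sgraph 'I_n -> Prop) :
  measurable [set w : up_space M | Q (rgg r w)].
Proof.
pose g (w : up_space M) := [ffun ij : 'I_n * 'I_n => rgg_adj r w ij.1 ij.2].
rewrite (_ : [set w | _] = g @^-1` [set e | exists2 w, g w = e & Q (rgg r w)]).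
  apply: measurable_fiber_pred => e.
  rewrite (_ : _ @^-1` _ = \bigcap_(ij in setT)
      ((fun w => rgg_adj r w ij.1 ij.2) @^-1` [set e ij])); last first.
    apply/seteqP; split => w /=; first by move=> <- ij _; rewrite /g ffunE.
    by move=> H; apply/ffunP => ij; rewrite ffunE; exact: H.
  apply: fin_bigcap_measurable => [|[i j] _]; first exact: finite_finset.
  rewrite -[X in measurable X]setTI /=.
  have mf : measurable_fun setT (fun w : up_space M => rgg_adj r w i j).
    rewrite /rgg_adj; apply: measurable_and; first exact: measurable_cst.
    by apply: measurable_fun_ler => //; exact: measurable_euclidean_dist.
  exact: mf.
apply/seteqP; split => w /=; first by move=> Qw; exists w.
move=> [w' gw Qw']; rewrite (_ : rgg r w = rgg r w') //.
apply: sgraph_ext => i j /=; have := congr1 (fun h : {ffun _} => h (i, j)) gw.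
by rewrite /= !ffunE /= => ->.
Qed.

(** Passes from the given probability space to the finite space of box assignments, on which the
    second moment method runs. *)
Lemma rgg_prob_ge (R : realType) (d n N T : nat) (s r : R)
    (kappa : {ffun 'I_d -> 'I_N} -> nat) (Q : sgraph 'I_n -> Prop)
    (M : uniform_points R d n) :
  0 < s -> (T * N)%:R * s <= 1 ->
  (forall w : up_space M,
     (exists c : {ffun 'I_d -> 'I_T}, forall b : {ffun 'I_d -> 'I_N},
        #|[set i | [forall k, Num.floor (tnth (up_pos M i w) k / s)
                                == (c k * N + b k)%N%:Z]]%SET| = kappa b) ->
     Q (rgg r w)) ->
  ((1 - \sum_(f : {ffun 'I_n -> option ({ffun 'I_d -> 'I_T} * {ffun 'I_d -> 'I_N})} |
         ~~ [exists c, has_counts (pair c) kappa f])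
       \prod_i cell_weight (s ^+ d) (f i))%:E
   <= up_prob M [set w | Q (rgg r w)])%E.
Proof.
move=> s0 TN HQ.
pose good (f : {ffun 'I_n -> option ({ffun 'I_d -> 'I_T} * {ffun 'I_d -> 'I_N})}) :=
  [exists c, has_counts (pair c) kappa f].
pose lab (w : up_space M) := [ffun i => @box_of R d N T s (up_pos M i w)].
have mlab f : measurable (lab @^-1` [set f]) by exact: measurable_boxes.
have plab f : up_prob M (lab @^-1` [set f]) = (\prod_i cell_weight (s ^+ d) (f i))%:E.
  exact: prob_boxes.
have pall := measure_fibers (up_prob M) predT mlab.
have := measure_fibers (up_prob M) good mlab.
have mgood : measurable [set w | good (lab w)].
  exact: (@measurable_fiber_pred _ _ _ _ [set f | good f] mlab).
have -> : (\sum_(l | good l) up_prob M (lab @^-1` [set l]) =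
    (1 - \sum_(f | ~~ good f) \prod_i cell_weight (s ^+ d) (f i))%:E)%E.
  move: pall; rewrite (_ : [set w | predT _] = setT); last by apply/seteqP.
  rewrite probability_setT (bigID good) /=.
  rewrite !(eq_bigr _ (fun f _ => plab f)) !sumEFin => -[] H; congr EFin.
  by rewrite [X in X - _]H addrK.
move=> <-; apply: le_measure; rewrite ?inE //; first exact: measurable_rgg_event.
move=> w /= /existsP[c /forallP H]; apply: HQ; exists c => b.
rewrite -(eqP (H b)); apply: eq_card => i; rewrite !inE ffunE.
by rewrite box_ofE.
Qed.

(** * Asymptotics: a cell following the template exists *)

Lemma near_ln_ge (R : realType) (A : R) : \forall n \near \oo, A <= ln (n%:R : R).
Proof.
near=> n; rewrite -[A]expRK ler_ln ?posrE ?expR_gt0 //; last first.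
  by near: n; exact: nbhs_infty_gtr.
by near: n; exact: nbhs_infty_ger.
Unshelve. all: by end_near. Qed.

Lemma near_polylog_le (R : realType) (D gam eta : R) (m : nat) :
  0 < D -> 0 < gam -> 0 < eta ->
  \forall n \near \oo, (D * ln (n%:R : R) + 1) ^+ m * expR (- (gam * ln n%:R)) <= eta.
Proof.
move=> D0 g0 e0.
(* Chosen so that [c (D x + 1) <= 1 + gam x / (m + 1)], whose power of exponent [m + 1] is at most
   [exp (gam x)]. The one factor beyond exponent [m] tends to infinity and beats the constants. *)
pose c := Num.min 1 (gam / (m.+1%:R * D)).
have c0 : 0 < c by rewrite lt_min ltr01 divr_gt0 // mulr_gt0 // ltr0n.
near=> n.
have x0 : 0 <= ln (n%:R : R) by near: n; exact: near_ln_ge.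
have xD : (eta * c ^+ m.+1)^-1 / D <= ln (n%:R : R) by near: n; exact: near_ln_ge.
move: (ln n%:R) x0 xD => x x0 xD.
have Dx0 : 0 < D * x + 1 by rewrite ltr_wpDl // mulr_ge0 // ltW.
have xlarge : (eta * c ^+ m.+1)^-1 <= D * x + 1.
  by move: xD; rewrite ler_pdivrMr //; lra.
have lin : c * (D * x + 1) <= 1 + gam * x / m.+1%:R.
  have c1 : c <= 1 by rewrite /c ge_min lexx.
  have c2 : c * D <= gam / m.+1%:R.
    by rewrite -ler_pdivlMr // -mulrA -invfM /c ge_min lexx orbT.
  have := ler_wpM2r x0 c2; rewrite [gam / _ * x]mulrAC.
  by move: (gam * x / _) => v; lra.
have key : (c * (D * x + 1)) ^+ m.+1 <= expR (gam * x).
  have -> : gam * x = m.+1%:R * (gam * x / m.+1%:R) by rewrite [RHS]mulrC divfK // pnatr_eq0.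
  rewrite expRM_natl lerXn2r ?nnegrE ?expR_ge0 //; first by rewrite mulr_ge0 // ltW.
  exact: le_trans lin (expR_ge1Dx _).
rewrite expRN ler_pdivrMr ?expR_gt0 //.
apply: le_trans (_ : eta * (c * (D * x + 1)) ^+ m.+1 <= _); last first.
  by rewrite ler_wpM2l // ltW.
rewrite exprMn [(D * x + 1) ^+ m.+1]exprSr.
rewrite [leRHS](_ : _ = (D * x + 1) ^+ m * (eta * c ^+ m.+1 * (D * x + 1))); last by ring.
rewrite ler_peMr ?exprn_ge0 ?(ltW Dx0) // -ler_pdivrMl ?mulr1 //.
by rewrite mulr_gt0 // exprn_gt0.
Unshelve. all: by end_near. Qed.

Section CellFailure.
Variables (R : realType) (d N : nat).
Let B := {ffun 'I_d -> 'I_N}.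
Variables (D s : R) (n : nat).
Let lam := n%:R * s ^+ d.
Let x := ln (n%:R : R).
Hypotheses (d0 : (0 < d)%N) (N0 : (0 < N)%N) (n0 : (0 < n)%N).
Hypotheses (D0 : 0 < D) (s0 : 0 < s) (lamD : lam <= D * x).
Hypothesis n_large : 16 * ((#|B|%:R + 1) * (D * x + 1)) ^+ 2 <= n%:R.
Let T := Num.trunc (N%:R * s)^-1.

Let nR : 0 < n%:R :> R. Proof. by rewrite ltr0n. Qed.
Let NR : 0 < N%:R :> R. Proof. by rewrite ltr0n. Qed.
Let lam0 : 0 < lam. Proof. by rewrite mulr_gt0 // exprn_gt0. Qed.

Lemma n_large_lam : 16 * ((#|B|%:R + 1) * (lam + 1)) ^+ 2 <= n%:R.
Proof.
apply: le_trans n_large; have := lamD; have := lam0; have : 0 <= #|B|%:R :> R by [].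
move: #|B|%:R (lam) (D * x) => u v w u0 v0 vw.
rewrite ler_pM2l // lerXn2r ?nnegrE ?mulr_ge0 //; try lra.
by rewrite ler_wpM2l //; lra.
Qed.

Let beta := #|B|%:R * s ^+ d.
Let betaN : beta = (N%:R * s) ^+ d.
Proof. by rewrite /beta card_ffun !card_ord natrX exprMn. Qed.

Lemma cell_side_le : N%:R * s <= 1.
Proof.
rewrite leNgt; apply/negP => H.
have /andP[_ b16] : 0 <= beta <= 1 / 16.
  exact: (@beta_le R B n (s ^+ d) lam n0 (exprn_gt0 d s0) erefl n_large_lam).
have : 1 <= beta by rewrite betaN exprn_ege1 // ltW.
lra.
Qed.

Let Ns0 : 0 < N%:R * s. Proof. exact: mulr_gt0. Qed.

Lemma cells_fit : (T * N)%:R * s <= 1.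
Proof.
have /andP[H _] : T%:R <= (N%:R * s)^-1 < T.+1%:R.
  by apply: trunc_itv; rewrite invr_ge0 ltW.
by rewrite natrM -mulrA -ler_pdivlMr // mul1r.
Qed.

Lemma cells_many : (2 * (N%:R * s))^-1 <= T%:R.
Proof.
have /andP[_ H] : T%:R <= (N%:R * s)^-1 < T.+1%:R.
  by apply: trunc_itv; rewrite invr_ge0 ltW.
have H1 : 1 <= (N%:R * s)^-1 by rewrite invf_ge1 // cell_side_le.
have T1 : (1 <= T)%N.
  by rewrite -ltnS -(ltr_nat R); apply: le_lt_trans H.
have T1R : 1 <= T%:R :> R by rewrite ler1n.
rewrite invfM; rewrite -natr1 in H; lra.
Qed.

End CellFailure.

(** Inverts the lower bound on the expected number of good cells, with powers and exponentials
    replaced by atoms for [field]. *)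
Lemma inv_lower_identity (F : numFieldType) (p g q e c sd l : F) :
  p != 0 -> g != 0 -> q != 0 -> e != 0 -> c != 0 -> l != 0 -> sd != 0 ->
  ((p * sd)^-1 * (e^-1 / 2 * c^-1 / (q * g)))^-1 =
  p * (2 * e) * q * (l * g * (c * (sd / l))).
Proof.
move=> p0 g0 q0 e0 c0 l0 s0; field.
by rewrite p0 g0 q0 e0 c0 l0 s0.
Qed.

(** There are at least [(2 N s)^(- d)] cells, which is [n / lam] up to a constant, and each follows
    the template with probability at least [exp (- cost * lam)] up to powers of [lam]. With
    [lam <= D x] and [n = exp x], the expected number of good cells is at least
    [exp ((1 - D cost) x)] up to polylogarithmic factors, and its inverse gives the first term. The
    second bounds [(1 - z)^-1 - 1 <= 2 z], the effect of dependence between cells. *)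
Lemma cell_failure_le (R : realType) (d N : nat) (B := {ffun 'I_d -> 'I_N})
    (gap : pred B) (h : B -> R) (D s : R) (n : nat)
    (lam := n%:R * s ^+ d) (x := ln (n%:R : R)) (cost := template_cost gap h)
    (T := Num.trunc (N%:R * s)^-1) (kappa := template_count gap h lam)
    (K : R := (2 * N%:R) ^+ d * (2 * expR 1) * (2 * expR 2) ^+ #|B|) :
  (forall b, 0 <= h b <= 1) -> (0 < d)%N -> (0 < N)%N -> (0 < n)%N ->
  0 < D -> 0 < s -> lam <= D * x ->
  16 * ((#|B|%:R + 1) * (D * x + 1)) ^+ 2 <= n%:R ->
  \sum_(f : {ffun 'I_n -> option ({ffun 'I_d -> 'I_T} * B)} |
         ~~ [exists c, has_counts (pair c) kappa f])
       \prod_i cell_weight (s ^+ d) (f i) <=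
  K * ((D * x + 1) ^+ #|B|.+1 * expR (- ((1 - D * cost) * x)))
   + 8 * #|B|%:R ^+ 2 * ((D * x + 1) ^+ 2 * expR (- (1 * x))).
Proof.
move=> h01 d0 N0 n0 D0 s0 lamD n_large.
have nR : 0 < n%:R :> R by rewrite ltr0n.
have NR : 0 < N%:R :> R by rewrite ltr0n.
have lam0 : 0 < lam by rewrite mulr_gt0 // exprn_gt0.
have nE : n%:R = expR x by rewrite lnK ?posrE.
have Ns0 : 0 < N%:R * s by exact: mulr_gt0.
have betaN : #|B|%:R * s ^+ d = (N%:R * s) ^+ d.
  by rewrite card_ffun !card_ord natrX exprMn.
have a0 : 0 < s ^+ d by rewrite exprn_gt0.
have nl : 16 * ((#|B|%:R + 1) * (lam + 1)) ^+ 2 <= n%:R.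
  exact: (@n_large_lam R d N D s n).
have /andP[b0 b1] := @beta_le R B n (s ^+ d) lam n0 a0 erefl nl.
have kb := @k_beta_le R B gap h h01 n (s ^+ d) lam n0 a0 erefl.
have Bl := @Blam_sq_le R B n (s ^+ d) lam n0 a0 erefl nl.
have cp := @count_prob_ge R B gap h h01 n (s ^+ d) lam n0 a0 erefl nl.
have k2 := @template_total2_le R B gap h h01 n (s ^+ d) lam n0 a0 erefl nl.
set k := (\sum_b template_count gap h lam b)%N in kb k2.
set z := 2 * k%:R * (#|B|%:R * s ^+ d) in kb.
have z0 : 0 <= z by rewrite !mulr_ge0 ?ler0n // ltW.
have z12 : z <= 1 / 2.
  by apply: (le_trans kb); rewrite ler_pdivrMr //; have := nR; move: Bl; clear; lra.
have cmany : (2 * (N%:R * s))^-1 <= T%:R by exact: (@cells_many R d N D s n).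
have T0 : (0 < T)%N.
  by rewrite -(ltr_nat R); apply: lt_le_trans cmany; rewrite invr_gt0 mulr_gt0.
have CT : #|{: {ffun 'I_d -> 'I_T}}|%:R = T%:R ^+ d :> R.
  by rewrite card_ffun !card_ord natrX.
have q0 : 0 < expR 2 * (2 * lam + 1) :> R.
  by rewrite mulr_gt0 ?expR_gt0 //; move: lam0; clear; lra.
have cp0 : 0 < count_prob n kappa (s ^+ d).
  by apply: lt_le_trans cp; rewrite !mulr_gt0 ?invr_gt0 ?expR_gt0 ?exprn_gt0.
apply: (le_trans (no_cell_bound _ a0 _ k2 _ _)).
- by rewrite card_ffun !card_ord expn_gt0 T0.
- rewrite card_prod natrM -mulrA betaN CT -exprMn mulrA -natrM.
  by apply: exprn_ile1; rewrite ?mulr_ge0 ?ler0n ?(ltW s0) //; exact: cells_fit.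
- by apply: le_lt_trans b1 _; clear; lra.
- by rewrite -/k -/z; move: z12; clear; lra.
rewrite -/k -/z -addrA; apply: lerD; last first.
  apply: (@le_trans _ _ (2 * z)).
    have z1 : 0 < 1 - z by move: z12; clear; lra.
    by rewrite lerBlDr -div1r ler_pdivrMr //; move: z0 z12; clear; nra.
  rewrite mul1r expRN -nE.
  rewrite [leRHS](_ : _ = 8 * (#|B|%:R * (D * x + 1)) ^+ 2 / n%:R); last by ring.
  rewrite ler_pdivlMr //; rewrite ler_pdivlMr // in kb.
  have : (#|B|%:R * lam) ^+ 2 <= (#|B|%:R * (D * x + 1)) ^+ 2.
    have lx : lam <= D * x + 1 by move: lamD; clear; lra.
    have l0 : 0 <= lam by exact: ltW.
    apply: lerXn2r; rewrite ?nnegrE; [exact: mulr_ge0| |exact: ler_wpM2l].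
    by apply: mulr_ge0 => //; exact: le_trans l0 lx.
  by move: kb; clear; lra.
have lower : (2 * (N%:R * s))^-1 ^+ d * (expR (- 1) / 2 * expR (- (cost * lam))
    / (expR 2 * (2 * lam + 1)) ^+ #|B|) <=
  #|{: {ffun 'I_d -> 'I_T}}|%:R * count_prob n kappa (s ^+ d).
  rewrite CT; apply: ler_pM => //.
  - by rewrite exprn_ge0 // invr_ge0 mulr_ge0 // ltW.
  - by rewrite !mulr_ge0 ?invr_ge0 ?exprn_ge0 ?expR_ge0 // ltW.
  - by rewrite lerXn2r ?nnegrE ?invr_ge0 ?ler0n // mulr_ge0 // ltW.
have l1 : 0 < (2 * (N%:R * s))^-1 ^+ d * (expR (- 1) / 2 * expR (- (cost * lam))
    / (expR 2 * (2 * lam + 1)) ^+ #|B|).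
  have N2 : 0 < 2 * (N%:R * s) by exact: mulr_gt0.
  apply: mulr_gt0; first by rewrite exprn_gt0 // invr_gt0.
  apply: mulr_gt0; last by rewrite invr_gt0 exprn_gt0.
  by apply: mulr_gt0; rewrite ?divr_gt0 ?expR_gt0.
apply: (@le_trans _ _ ((2 * (N%:R * s))^-1 ^+ d * (expR (- 1) / 2 * expR (- (cost * lam))
    / (expR 2 * (2 * lam + 1)) ^+ #|B|))^-1).
  by rewrite lef_pV2 ?posrE // (lt_le_trans l1).
have sE : expR (- x) = s ^+ d / lam.
  by rewrite expRN -nE /lam invfM mulrCA mulfV ?mulr1 // gt_eqF.
rewrite [leLHS](_ : _ = (2 * N%:R) ^+ d * (2 * expR 1) * expR 2 ^+ #|B| *
  (lam * (2 * lam + 1) ^+ #|B| * (expR (cost * lam) * expR (- x)))); last first.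
  rewrite sE [expR (- 1)]expRN [expR (- (cost * lam))]expRN exprVn.
  have -> : (2 * (N%:R * s)) ^+ d = (2 * N%:R) ^+ d * s ^+ d by rewrite mulrA exprMn.
  rewrite [(expR 2 * _) ^+ _]exprMn.
  have p0 : (2 * N%:R) ^+ d != 0 :> R by rewrite expf_neq0 // mulf_neq0 ?gt_eqF.
  have g0 : (2 * lam + 1) ^+ #|B| != 0 :> R.
    by rewrite expf_neq0 // gt_eqF //; move: lam0; clear; lra.
  have e2 : expR 2 ^+ #|B| != 0 :> R by rewrite expf_neq0 // gt_eqF ?expR_gt0.
  have e1 : expR 1 != 0 :> R by rewrite gt_eqF ?expR_gt0.
  have c1 : expR (cost * lam) != 0 by rewrite gt_eqF ?expR_gt0.
  have l0 : lam != 0 by rewrite gt_eqF.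
  have s1 : s ^+ d != 0 by rewrite gt_eqF.
  exact: inv_lower_identity.
rewrite /K; move: #|B| => m; rewrite [(2 * expR 2) ^+ m]exprMn.
have reorder (u v w y t : R) : u * (v * w) * (y * t) = u * w * (v * y * t) by ring.
rewrite reorder.
have cost0 : 0 <= cost.
  by apply: sumr_ge0 => b _; case: ifP => // _; exact: sqr_ge0.
have lx : lam <= D * x + 1 by move: lamD; clear; lra.
have ll := lam0.
have l21 : 0 <= 2 * lam + 1 <= 2 * (D * x + 1) by apply/andP; move: ll lamD; clear; lra.
have /andP[l2 l3] := l21.
have l4 : 0 <= lam * (2 * lam + 1) ^+ m by rewrite mulr_ge0 ?exprn_ge0 // ltW.
apply: ler_wpM2l; first by rewrite !mulr_ge0 ?exprn_ge0 ?expR_ge0 // mulr_ge0 // ltW.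
apply: ler_pM => //.
  rewrite exprS [leRHS]mulrCA -exprMn; apply: ler_pM => //; [exact: ltW|exact: exprn_ge0|].
  by rewrite lerXn2r ?nnegrE // (le_trans l2 l3).
rewrite -expRD ler_expR; have := ler_wpM2l cost0 lamD; clear; lra.
Qed.

(* [s n] is the side of the boxes, and the cell has its corner at [s n * z]. *)
Lemma template_aas (R : realType) (d N : nat) (gap : pred {ffun 'I_d -> 'I_N})
    (h : {ffun 'I_d -> 'I_N} -> R) (D : R) (s r : nat -> R)
    (Q : forall n, sgraph 'I_n -> Prop) (M : forall n, uniform_points R d n) :
  (0 < d)%N -> (0 < N)%N -> (forall b, 0 <= h b <= 1) -> 0 < D ->
  D * template_cost gap h < 1 ->
  (\forall n \near \oo, 0 < s n /\ n%:R * s n ^+ d <= D * ln n%:R) ->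
  (\forall n \near \oo, forall (w : up_space (M n)) (z : 'I_d -> int),
     (forall b : {ffun 'I_d -> 'I_N},
        #|[set i | [forall k, Num.floor (tnth (up_pos (M n) i w) k / s n)
                                == z k + (b k)%:Z]]%SET|
        = template_count gap h (n%:R * s n ^+ d) b) ->
     Q n (rgg (r n) w)) ->
  aas_rgg M r Q.
Proof.
move=> d0 N0 h01 D0 Dcost scale Qok.
have [m mE] : exists m, #|{ffun 'I_d -> 'I_N}| = m by exists #|{ffun 'I_d -> 'I_N}|.
pose cB : R := m%:R.
pose K : R := (2 * N%:R) ^+ d * (2 * expR 1) * (2 * expR 2) ^+ m.
have NR : 0 < N%:R :> R by rewrite ltr0n.
have K0 : 0 < K by rewrite /K !mulr_gt0 ?exprn_gt0 ?mulr_gt0 ?expR_gt0.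
have cB0 : 0 <= cB by rewrite ler0n.
have cB1 : 0 < 16 * (cB + 1) ^+ 2 by rewrite mulr_gt0 // exprn_gt0 // ltr_wpDl.
have cB2 : 0 < 8 * cB ^+ 2 + 1 by rewrite ltr_wpDl // mulr_ge0 // sqr_ge0.
have fin n : up_prob (M n) [set w | Q n (rgg (r n) w)] \is a fin_num.
  by apply: fin_num_measure; exact: measurable_rgg_event.
apply/fine_cvgP; split; first by near=> n; exact: fin.
apply/cvgrPdist_le => /= e e0.
near=> n.
have n0 : (0 < n)%N by near: n; exact: nbhs_infty_gt.
have nR : 0 < n%:R :> R by rewrite ltr0n.
have [sn0 lamD] : 0 < s n /\ n%:R * s n ^+ d <= D * ln n%:R by near: n.
(* Since [exp (- ln n)] is [1 / n], this is the size condition on [n] of [cell_failure_le], in the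
   form that [near_polylog_le] provides. *)
have large : (D * ln n%:R + 1) ^+ 2 * expR (- (1 * ln n%:R)) <= (16 * (cB + 1) ^+ 2)^-1.
  by near: n; apply: near_polylog_le => //; rewrite invr_gt0.
have small1 : (D * ln n%:R + 1) ^+ m.+1 *
    expR (- ((1 - D * template_cost gap h) * ln n%:R)) <= e / 2 / K.
  by near: n; apply: near_polylog_le => //; rewrite ?subr_gt0 ?divr_gt0.
have small2 : (D * ln n%:R + 1) ^+ 2 * expR (- (1 * ln n%:R)) <=
    e / 2 / (8 * cB ^+ 2 + 1).
  near: n; apply: near_polylog_le => //; rewrite ?divr_gt0 //.
have n_large : 16 * ((cB + 1) * (D * ln n%:R + 1)) ^+ 2 <= n%:R.
  move: large; rewrite mul1r expRN lnK ?posrE // ler_pdivrMr // ler_pdivlMl //.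
  by move=> H; rewrite exprMn mulrA.
have fail := @cell_failure_le R d N gap h D (s n) n h01 d0 N0 n0 D0 sn0 lamD.
rewrite mE in fail; have {}fail := fail n_large.
pose T := Num.trunc (N%:R * s n)^-1.
have fit : (T * N)%:R * s n <= 1 by exact: cells_fit.
have QokN : forall (w : up_space (M n)) (z : 'I_d -> int),
     (forall b : {ffun 'I_d -> 'I_N},
        #|[set i | [forall k, Num.floor (tnth (up_pos (M n) i w) k / s n)
                                == z k + (b k)%:Z]]%SET|
        = template_count gap h (n%:R * s n ^+ d) b) -> Q n (rgg (r n) w) by near: n.
have := @rgg_prob_ge R d n N T (s n) (r n)
  (template_count gap h (n%:R * s n ^+ d)) (Q n) (M n) sn0 fit.
have /fineK <- := fin n.
have p1 : fine (up_prob (M n) [set w | Q n (rgg (r n) w)]) <= 1.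
  rewrite -lee_fin fineK //; apply: probability_le1; exact: measurable_rgg_event.
move: p1; set p := fine _ => p1 /= H.
have {H} : 1 - \sum_(f : {ffun 'I_n -> option ({ffun 'I_d -> 'I_T} * {ffun 'I_d -> 'I_N})} |
         ~~ [exists c, has_counts (pair c) (template_count gap h (n%:R * s n ^+ d)) f])
       \prod_i cell_weight (s n ^+ d) (f i) <= p.
  rewrite -lee_fin; apply: H => w [c Hc]; apply: (QokN w (fun k => (c k * N)%N%:Z)) => b.
  rewrite -Hc; apply: eq_card => i; rewrite !inE; exact: eq_forallb.
move=> H; rewrite ger0_norm ?subr_ge0 //.
have {H fail}H := le_trans (lerB (lexx 1) fail) H.
have : 8 * cB ^+ 2 * ((D * ln n%:R + 1) ^+ 2 * expR (- (1 * ln n%:R))) <= e / 2.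
  rewrite ler_pdivlMr in small2; last by [].
  have : 0 <= (D * ln n%:R + 1) ^+ 2 * expR (- (1 * ln n%:R)) by rewrite mulr_ge0 ?sqr_ge0 ?expR_ge0.
  by move: small2; lra.
have : K * ((D * ln n%:R + 1) ^+ m.+1 *
    expR (- ((1 - D * template_cost gap h) * ln n%:R))) <= e / 2.
  by rewrite mulrC -ler_pdivlMr.
move: H; rewrite -/K -/cB; move: (K * _) (8 * _ * _) => u v; clear; lra.
Unshelve. all: by end_near. Qed.

(** * Cutting a graph; dimension one *)

Lemma near_ln_gt0 (R : realType) : \forall n \near \oo, (1 < n)%N /\ 0 < ln (n%:R : R).
Proof.
near=> n; have n1 : (1 < n)%N by near: n; exact: nbhs_infty_gt.
by split => //; rewrite ln_gt0 // ltr1n.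
Unshelve. all: by end_near. Qed.

(** All edges between [A] and its complement are deleted. The hypothesis is
    [(1 / 2 + eps) (kept + lost) <= kept], rearranged. *)
Lemma cut_subgraph (R : realType) (eps : R) (n : nat) (G : sgraph 'I_n)
    (A : pred 'I_n) :
  (exists u, A u) -> (exists v, ~~ A v) ->
  (forall v, (1 / 2 + eps) * #|[set w | adj G v w && (A w != A v)]%SET|%:R <=
             (1 / 2 - eps) * #|[set w | adj G v w && (A w == A v)]%SET|%:R) ->
  has_disconnected_subgraph (1 / 2 + eps) G.
Proof.
move=> [u Au] [v Av] cut.
pose e := [rel x y | adj G x y && (A y == A x)].
have es : symmetric e by move=> x y /=; rewrite adj_sym eq_sym.
have ei : irreflexive e by move=> x /=; rewrite adj_irrefl.
exists (SGraph es ei); split.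
  split; first by move=> x y /andP[].
  move=> x; have := cut x; rewrite /degree /=.
  have -> : #|[set w | adj G x w]%SET| = (#|[set w | adj G x w && (A w == A x)]%SET| +
      #|[set w | adj G x w && (A w != A x)]%SET|)%N.
    rewrite -(cardsID [set w | A w == A x]%SET); congr (_ + _)%N;
      by apply: eq_card => y; rewrite !inE // andbC.
  rewrite natrD; move: #|_|%:R #|_|%:R => a b; lra.
exists u, v; apply/negP => /= uv.
have : fingraph.closed e A.
  by move=> x y /= /andP[_ /eqP xy]; rewrite /in_mem /= xy.
by move=> /closed_connect /(_ _ _ uv); rewrite /in_mem /= Au (negbTE Av).
Qed.

(** [l] and [i] stand for numbers of points in regions around a vertex. The [1] is the vertex
    itself, which lies in its own region but is not its own neighbour. *)
Lemma cut_ineq (R : realType) (eps : R) (epsb : 0 < eps <= 1 / 2) (lost kept l i : nat) : (lost <= l)%N -> (i <= kept + 1)%N ->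
  (1 / 2 + eps) * l%:R <= (1 / 2 - eps) * (i%:R - 1) :> R ->
  (1 / 2 + eps) * lost%:R <= (1 / 2 - eps) * kept%:R :> R.
Proof.
have /andP[e0 e1] := epsb.
rewrite -(ler_nat R) -(ler_nat R i) natrD => h1 h2 h3.
apply: (@le_trans _ _ ((1 / 2 + eps) * l%:R)); first by apply: ler_wpM2l => //; lra.
by apply: le_trans h3 _; apply: ler_wpM2l; lra.
Qed.

Lemma line_count (n a b k : nat) (q : 'I_n -> int) :
  (forall j : nat, (a <= j < b)%N -> #|[set i | q i == j%:Z]%SET| = k) ->
  #|[set i | a%:Z <= q i < b%:Z]%SET| = ((b - a) * k)%N.
Proof.
elim: b => [|b IH] H.
  by apply/eqP; rewrite sub0n mul0n cards_eq0; apply/eqP/setP => i; rewrite !inE; lia.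
have [ab|ba] := leqP a b; last first.
  have -> : (b.+1 - a = 0)%N by lia.
  by apply/eqP; rewrite mul0n cards_eq0; apply/eqP/setP => i; rewrite !inE; lia.
rewrite (_ : [set i | _]%SET = [set i | a%:Z <= q i < b%:Z]%SET :|: [set i | q i == b%:Z]%SET);
  last by apply/setP => i; rewrite !inE; lia.
rewrite cardsU (_ : _ :&: _ = finset.set0); last by apply/setP => i; rewrite !inE; lia.
rewrite cards0 subn0 IH ?H ?leqnn ?ab // => [|j jb]; last by apply: H; lia.
by rewrite subSn // mulSn addnC.
Qed.

Section LineTemplate.
Variables (R : realType) (eps : R) (n : nat) (G : sgraph 'I_n) (q : 'I_n -> int).
Variables (M g k : nat).
Hypotheses (epsb : 0 < eps <= 1 / 2) (M_gt0 : (0 < M)%N) (k_gt0 : (0 < k)%N).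
Hypotheses
  (full : forall j : nat, (j < M)%N || (M + g <= j < 2 * M + g)%N ->
     #|[set i | q i == j%:Z]%SET| = k)
  (gap : forall j : nat, (M <= j < M + g)%N -> #|[set i | q i == j%:Z]%SET| = 0%N).

Let A (i : 'I_n) : bool := q i < M%:Z.

Lemma left_vertex : exists u, A u.
Proof.
have : (0 < #|[set i | q i == 0%N%:Z]%SET|)%N by rewrite full ?M_gt0.
by case/card_gt0P => i; rewrite inE => /eqP qi; exists i; rewrite /A qi.
Qed.

Lemma right_vertex : exists v, ~~ A v.
Proof.
have : (0 < #|[set i | q i == (M + g)%N%:Z]%SET|)%N by rewrite full //; lia.
by case/card_gt0P => i; rewrite inE => /eqP qi; exists i; rewrite /A qi; lia.
Qed.

Lemma right_of_gap i : ~~ A i -> (M + g)%N%:Z <= q i.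
Proof.
rewrite /A -leNgt => Mq; rewrite leNgt; apply/negP => qM.
have /gap/eqP : (M <= `|q i| < M + g)%N by lia.
rewrite cards_eq0 => /eqP/setP/(_ i); rewrite !inE; lia.
Qed.

Lemma line_no_crossing :
  (forall i j, adj G i j -> `|q i - q j| <= g%:Z) ->
  has_disconnected_subgraph (1 / 2 + eps) G.
Proof.
move=> near; apply: (@cut_subgraph R eps n G A left_vertex right_vertex) => v.
rewrite (_ : [set w | adj G v w && (A w != A v)]%SET = finset.set0) ?cards0.
  by rewrite mulr0 mulr_ge0 //; move: epsb; lra.
apply/setP => w; rewrite !inE; apply/negbTE; apply/negP => /andP[/near vw].
have := @right_of_gap v; have := @right_of_gap w.
rewrite /A; case: (ltP (q w)) => hw; case: (ltP (q v)) => hv //= rw rv _.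
  by have := rv isT; lia.
by have := rw isT; lia.
Qed.

Hypotheses
  (adj_near : forall i j, adj G i j -> `|q i - q j| <= M%:Z)
  (near_adj : forall i j, i != j -> `|q i - q j| < M%:Z -> adj G i j).
Hypothesis ineq : (1 / 2 + eps) * ((M - g) * k)%:R <= (1 / 2 - eps) * ((M * k)%:R - 1) :> R.

(** The boxes from [a] to [b] are kept, all of them within reach of [v]; those from [c] to [e]
    include every box across the gap that [v] can reach. Both intervals must avoid the gap and stay
    in the template, where the counts are known. *)
Lemma line_cut_vertex v (a b c e : nat) :
  (b - a = M)%N -> (e - c <= M - g)%N ->
  (forall j : nat, (a <= j < b)%N -> (j < M)%N || (M + g <= j < 2 * M + g)%N) ->
  (forall j : nat, (c <= j < e)%N -> (j < M)%N || (M + g <= j < 2 * M + g)%N) ->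
  (forall i, a%:Z <= q i < b%:Z -> (A i == A v) && (`|q v - q i| < M%:Z)) ->
  (forall i, adj G v i -> A i != A v -> c%:Z <= q i < e%:Z) ->
  (1 / 2 + eps) * #|[set w | adj G v w && (A w != A v)]%SET|%:R <=
  (1 / 2 - eps) * #|[set w | adj G v w && (A w == A v)]%SET|%:R.
Proof.
move=> ba ec kab kce keep lose.
have Hk : (M * k <= #|[set w | adj G v w && (A w == A v)]%SET| + 1)%N.
  rewrite -ba -(@line_count n a b k q); last by move=> j /kab/full.
  apply: (@leq_trans #|[set v]%SET :|: [set w | adj G v w && (A w == A v)]%SET|); last first.
    by apply: leq_trans (leq_card_setU _ _) _; rewrite cards1 addnC.
  apply: subset_leq_card; apply/fintype.subsetP => i; rewrite !inE => /keep/andP[Ai vi].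
  by have [//|vi'] := eqVneq i v; rewrite Ai near_adj // eq_sym.
have Hl : (#|[set w | adj G v w && (A w != A v)]%SET| <= (M - g) * k)%N.
  apply: (@leq_trans ((e - c) * k)); last by rewrite leq_mul2r ec orbT.
  rewrite -(@line_count n c e k q); last by move=> j /kce/full.
  apply: subset_leq_card; apply/fintype.subsetP => i; rewrite !inE => /andP[vi Ai].
  exact: lose.
have /andP[e0 e1] := epsb.
exact: (@cut_ineq R eps epsb _ _ _ _ Hl Hk ineq).
Qed.

(** Points outside the template are not controlled, yet every vertex is covered: one without a
    crossing edge loses nothing, and one with a crossing edge is so close to the gap that all boxes
    it is compared on belong to the template. *)
Lemma line_subgraph : has_disconnected_subgraph (1 / 2 + eps) G.
Proof.
apply: (@cut_subgraph R eps n G A left_vertex right_vertex) => v.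
have [none|/set0Pn[w]] := eqVneq [set w | adj G v w && (A w != A v)]%SET finset.set0.
  rewrite none cards0 mulr0 mulr_ge0 //; have /andP[e0 e1] := epsb; lra.
rewrite inE => /andP[vw Aw]; have cvw := adj_near vw.
have [Av|Av] : A v \/ ~~ A v by case: (A v); [left|right].
  have Awn : ~~ A w by move: Aw; rewrite Av; case: (A w).
  have rw := right_of_gap Awn.
  have Av' := Av; rewrite /A in Av'.
  (* The edge to [w] forces [q v >= g], so [absz] acts on a nonnegative number, and [q v < M] leaves
     at most [M - g] reachable boxes. *)
  apply: (@line_cut_vertex v 0 M (M + g) (absz (q v + M%:Z + 1))).
  - by rewrite subn0.
  - lia.
  - by move=> j; lia.
  - by move=> j; lia.
  - by move=> i H; rewrite Av /A; lia.
  - move=> i vi; rewrite Av => Ai; have {}Ai : ~~ A i by case: (A i) Ai.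
    by have := right_of_gap Ai; have := adj_near vi; lia.
have Aw' : A w by move: Aw; rewrite (negbTE Av); case: (A w).
have rv := right_of_gap Av.
rewrite /A in Aw'.
apply: (@line_cut_vertex v (M + g) (2 * M + g) (absz (q v - M%:Z)) M).
- lia.
- lia.
- by move=> j; lia.
- by move=> j; lia.
- by move=> i H; rewrite (negbTE Av) /A; lia.
- move=> i vi; rewrite (negbTE Av) => Ai; have {}Ai : A i by case: (A i) Ai.
  by have := adj_near vi; rewrite /A in Ai; lia.
Qed.

End LineTemplate.

Lemma euclidean_dist1 (R : realType) (x y : 1.-tuple R) :
  euclidean_dist x y = `|tnth x ord0 - tnth y ord0|.
Proof. by rewrite /euclidean_dist big_ord1 sqrtr_sqr. Qed.

Lemma floor_dist (R : realType) (s x y : R) (z : int) : 0 < s ->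
  let m := (`|(Num.floor (x / s) - z) - (Num.floor (y / s) - z)|)%:~R : R in
  m - 1 < `|x - y| / s < m + 1.
Proof.
move=> s0 /=; rewrite opprB addrA subrK intr_norm.
have -> : `|x - y| / s = `|x / s - y / s|.
  by rewrite -mulrBl normrM normfV (gtr0_norm s0).
have dist1 : `|(Num.floor (x / s) - Num.floor (y / s))%:~R - (x / s - y / s)| < 1.
  have := floor_itv (x / s); have := floor_itv (y / s).
  rewrite !intrD intrN ltr_norml; move: (x / s) (y / s) (Num.floor _)%:~R (Num.floor _)%:~R.
  clear=> a b c d; lra.
have := le_lt_trans (ler_dist_dist _ _) dist1; rewrite ltr_norml.
by move: `|_| `|_| => a b; clear; lra.
Qed.

Lemma line_template_cost (R : realType) (N a g : nat) :
  template_cost (fun b : {ffun 'I_1 -> 'I_N} => (a <= b ord0 < a + g)%N) (fun=> 0 : R) <= g%:R.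
Proof.
rewrite /template_cost; under eq_bigr do rewrite expr0n /=.
rewrite -big_mkcond sumr_const ler_nat.
rewrite cardE -(size_map (fun b : {ffun 'I_1 -> 'I_N} => b ord0 : nat)) -[leqRHS](size_iota a).
apply: uniq_leq_size => [|j /mapP[b]]; last by rewrite mem_enum mem_iota => Hb ->; exact: Hb.
rewrite map_inj_uniq ?enum_uniq // => b c /val_inj bc.
by apply/ffunP => i; rewrite (ord1 i).
Qed.

(** A gap of [4 eps / (1 + 2 eps)] times the radius would balance lost and kept, while almost
    [4 eps] is affordable. For [g = 4 eps M - 2] the difference leaves a slack [4 eps^2 M], which
    has to pay for [3 / 2 + eps], at most [2]. *)
Lemma line_weights_ok (R : realType) (eps : R) (M g k : nat) :
  0 < eps <= 1 / 2 -> 2 <= 4 * eps ^+ 2 * M%:R -> 4 * eps * M%:R - 2 <= g%:R ->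
  (0 < k)%N -> (0 < M)%N ->
  (1 / 2 + eps) * ((M - g) * k)%:R <= (1 / 2 - eps) * ((M * k)%:R - 1) :> R.
Proof.
move=> /andP[e0 e1] M_large g_large k0 M0.
have k1 : 1 <= k%:R :> R by rewrite ler1n.
have [Mg|gM] := leqP M g.
  have -> : (M - g = 0)%N by apply/eqP; rewrite subn_eq0.
  by rewrite mul0n mulr0 mulr_ge0 ?subr_ge0 // ler1n muln_gt0 M0.
rewrite !natrM natrB 1?ltnW //.
have H1 : (1 / 2 + eps) * (M%:R - g%:R) <= (1 / 2 - eps) * M%:R - (1 / 2 - eps).
  have : (1 / 2 + eps) * (M%:R - g%:R) <= (1 / 2 + eps) * (M%:R - (4 * eps * M%:R - 2)).
    by apply: ler_wpM2l; lra.
  by move: M_large e0 e1; move: M%:R g%:R => m x; clear; lra.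
have : (1 / 2 + eps) * (M%:R - g%:R) * k%:R <= ((1 / 2 - eps) * M%:R - (1 / 2 - eps)) * k%:R.
  by apply: ler_wpM2r => //; lra.
have : 0 <= (1 / 2 - eps) * (k%:R - 1) by apply: mulr_ge0; lra.
by move: M%:R g%:R k%:R => m x y; clear; lra.
Qed.

Lemma subgraph_dim1 (R : realType) (eps : R) : 0 < eps <= 1 / 2 ->
  forall r : nat -> R,
     (forall n : nat, (0 < n)%N -> r n <= ln n%:R / (4 * eps * n%:R)) ->
   forall M : (forall n : nat, uniform_points R 1 n),
     aas_rgg M r (@has_disconnected_subgraph R (1 / 2 + eps)).
Proof.
move=> epsb r rle P; have /andP[e0 e1] := epsb.
pose M := (Num.trunc (2 * eps ^+ 2)^-1).+1.
have M0 : (0 < M)%N by [].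
have M_large : 2 <= 4 * eps ^+ 2 * M%:R.
  have p0 : 0 < 2 * eps ^+ 2 by rewrite mulr_gt0 // exprn_gt0.
  have /andP[_ H] : (Num.trunc (2 * eps ^+ 2)^-1)%:R <= (2 * eps ^+ 2)^-1 < M%:R.
    by apply: trunc_itv; rewrite invr_ge0 ltW.
  have : 1 <= (2 * eps ^+ 2) * M%:R by rewrite mulrC -ler_pdivrMr // div1r ltW.
  by move: (eps ^+ 2) M%:R => a b; clear; lra.
have MR : 0 < M%:R :> R by rewrite ltr0n.
move: (M) M0 M_large MR => {}M M0 M_large MR.
(* One below the integer part: the cost is [D * g] with [D = (4 eps M)^-1], so [g < 4 eps M] must be
   strict even when [4 eps M] is an integer. *)
pose g := (Num.trunc (4 * eps * M%:R)).-1.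
have x4 : 4 <= 4 * eps * M%:R.
  apply: le_trans (_ : 2 * (4 * eps ^+ 2 * M%:R) <= _); first by move: M_large; clear; lra.
  have -> : 2 * (4 * eps ^+ 2 * M%:R) = (4 * eps * M%:R) * (2 * eps) by ring.
  by apply: ler_piMr; [rewrite !mulr_ge0 // ltW|lra].
have [g1 glt g_large] : [/\ (0 < g)%N, g%:R < 4 * eps * M%:R & 4 * eps * M%:R - 2 <= g%:R].
  have x0 : 0 <= 4 * eps * M%:R by apply: le_trans x4.
  have := trunc_itv x0; rewrite /g; case: (Num.trunc _) => [|T] /=.
    by move=> /andP[_ H]; move: x4 H; clear; lra.
  rewrite -!natr1 => /andP[h1 h2]; split; [|by move: h1; clear; lra|by move: h2; clear; lra].
  by rewrite -(ltr_nat R) -(ltrD2r 2); move: h2 x4; clear; lra.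
move: g g1 glt g_large => g g1 glt g_large.
pose N := (2 * M + g)%N.
have N0 : (0 < N)%N by rewrite addn_gt0 g1 orbT.
pose L (n : nat) : R := ln n%:R / (4 * eps * n%:R).
(* [M] box sides make up the radius, or its upper bound when the radius is below the gap width at
   that scale. Either way the side is at least a fixed fraction of [L n], so the mean number of
   points per box tends to infinity. *)
pose t n := if r n <= g%:R * L n / M%:R then L n else r n.
pose s n := t n / M%:R.
have e4 : 0 < 4 * eps by rewrite mulr_gt0.
have Lsq n : (0 < n)%N -> n%:R * L n = ln n%:R / (4 * eps).
  by move=> n0; rewrite /L; field; rewrite gt_eqF //= pnatr_eq0 -lt0n.
have scale : \forall n \near \oo, [/\ 0 < L n, 0 < s n, s n <= L n / M%:R & L n / M%:R / M%:R <= s n].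
  near=> n; have [n1 ln0] : (1 < n)%N /\ 0 < ln (n%:R : R) by near: n; exact: near_ln_gt0.
  have nR : 0 < n%:R :> R by rewrite ltr0n ltnW.
  have L0 : 0 < L n by rewrite divr_gt0 // mulr_gt0.
  have rL : r n <= L n by apply: rle; exact: ltnW.
  have M1 : 1 <= M%:R :> R by rewrite ler1n.
  have LM : L n / M%:R <= L n by rewrite ler_pdivrMr // ler_peMr // ltW.
  have LM' : L n / M%:R <= g%:R * L n / M%:R.
    by rewrite ler_wpM2r ?invr_ge0 ?(ltW MR) // ler_peMl ?ler1n // ltW.
  have tb : L n / M%:R <= t n <= L n.
    rewrite /t; case: (leP (r n) (g%:R * L n / M%:R)) => H; first by rewrite LM lexx.
    by rewrite rL (le_trans LM' (ltW H)).
  have /andP[tb1 tb2] := tb.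
  have t0 : 0 < t n by apply: lt_le_trans tb1; rewrite divr_gt0.
  by split => //; rewrite ?divr_gt0 // ler_pM2r // invr_gt0.
pose gap (b : {ffun 'I_1 -> 'I_N}) := (M <= b ord0 < M + g)%N.
have D0 : 0 < (4 * eps * M%:R)^-1 by rewrite invr_gt0 mulr_gt0.
apply: (@template_aas R 1 N gap (fun=> 0) (4 * eps * M%:R)^-1 s) => //.
- by move=> b; rewrite lexx ler01.
- rewrite mulrC ltr_pdivrMr ?mul1r; last by rewrite mulr_gt0.
  exact: le_lt_trans (line_template_cost _ _ _ _) glt.
- near=> n.
  have n0 : (0 < n)%N by near: n; exact: nbhs_infty_gt.
  have [L0 s0 sL _] : [/\ 0 < L n, 0 < s n, s n <= L n / M%:R & L n / M%:R / M%:R <= s n] by near: n.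
  split => //; rewrite expr1 invfM mulrAC -[_^-1 * ln _]mulrC -Lsq // -mulrA.
  by rewrite ler_wpM2l.
near=> n => w z Hw.
have n0 : (0 < n)%N by near: n; exact: nbhs_infty_gt.
have [L0 s0 sL sth] : [/\ 0 < L n, 0 < s n, s n <= L n / M%:R & L n / M%:R / M%:R <= s n] by near: n.
have lnb : 2 * (4 * eps * M%:R * M%:R) <= ln n%:R by near: n; exact: near_ln_ge.
pose lam : R := n%:R * s n ^+ 1.
have lam2 : 2 <= lam.
  apply: (@le_trans _ _ (n%:R * (L n / M%:R / M%:R))); last by rewrite /lam expr1 ler_wpM2l.
  rewrite 2!(mulrA n%:R) Lsq // !ler_pdivlMr //; apply: le_trans lnb.
  by rewrite le_eqVlt; apply/orP; left; apply/eqP; ring.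
pose k := Num.trunc ((1 + 0) * lam).
have k_gt0 : (0 < k)%N.
  have x0 : 0 <= (1 + 0) * lam by rewrite addr0 mul1r; move: lam2; clear; lra.
  have := trunc_itv x0; rewrite -/k addr0 mul1r -(ltr_nat R) -natr1.
  by move: lam2; move: (k%:R) => x; clear; lra.
pose q i := Num.floor (tnth (up_pos (P n) i w) ord0 / s n) - z ord0.
have counts (j : nat) (jN : (j < N)%N) : #|[set i | q i == j%:Z]%SET| =
    if (M <= j < M + g)%N then 0%N else k.
  have := Hw [ffun=> Ordinal jN]; rewrite /template_count /gap ffunE /= => <-.
  apply: eq_card => i; rewrite !inE /q; apply/eqP/forallP => [H a|/(_ ord0)/eqP ->].
    by apply/eqP; rewrite ffunE (ord1 a) -H addrC subrK.
  by rewrite ffunE addrC addKr.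
have full (j : nat) : (j < M)%N || (M + g <= j < 2 * M + g)%N -> #|[set i | q i == j%:Z]%SET| = k.
  by move=> H; rewrite counts ?ifF //; move: H; rewrite /N; clear; lia.
have empty (j : nat) : (M <= j < M + g)%N -> #|[set i | q i == j%:Z]%SET| = 0%N.
  by move=> H; rewrite counts ?ifT //; move: H; rewrite /N; clear; lia.
have dist_le (m : nat) i j : euclidean_dist (up_pos (P n) i w) (up_pos (P n) j w) <= m%:R * s n ->
    `|q i - q j| <= m%:Z.
  rewrite euclidean_dist1 -ler_pdivrMr // -[(_ <= m%:Z)%R]ltzD1 -(ltr_int R) [(_ + 1)%:~R]intrD => H.
  have /andP[h _] := floor_dist (tnth (up_pos (P n) i w) ord0) (tnth (up_pos (P n) j w) ord0) (z ord0) s0.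
  by rewrite -ltrBlDr; exact: lt_le_trans h H.
have [small|big] := leP (r n) (g%:R * L n / M%:R).
  apply: (@line_no_crossing R eps n _ q M g k epsb M0 k_gt0 full empty) => i j /andP[_ dij].
  apply: dist_le; apply: le_trans dij _; apply: (le_trans small).
  by rewrite /s /t small mulrA.
have rs : r n = M%:R * s n by rewrite /s /t leNgt big /= mulrC divfK // gt_eqF.
apply: (@line_subgraph R eps n _ q M g k epsb M0 k_gt0 full empty).
- by move=> i j /andP[_ dij]; apply: dist_le; rewrite -rs.
- move=> i j ij qij; rewrite /= /rgg_adj ij /= rs euclidean_dist1 -ler_pdivrMr //.
  have /andP[_ h] := floor_dist (tnth (up_pos (P n) i w) ord0) (tnth (up_pos (P n) j w) ord0) (z ord0) s0.
  apply: (le_trans (ltW h)).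
  by rewrite -[1]/(1%:~R) -intrD -[M%:R]/(M%:Z%:~R) ler_int lezD1.
- exact: line_weights_ok.
Unshelve. all: by end_near. Qed.

(** * Dimension two *)

Section PlaneNorm.
Variable R : realType.

Definition norm2 (x y : R) : R := Num.sqrt (x ^+ 2 + y ^+ 2).

Lemma norm2_ge0 x y : 0 <= norm2 x y. Proof. exact: sqrtr_ge0. Qed.

Lemma sqr_norm2 x y : norm2 x y ^+ 2 = x ^+ 2 + y ^+ 2.
Proof. by rewrite sqr_sqrtr // addr_ge0 ?sqr_ge0. Qed.

Lemma norm2_le x y r : 0 <= r -> (norm2 x y <= r) = (x ^+ 2 + y ^+ 2 <= r ^+ 2).
Proof. by move=> r0; rewrite -ler_sqr ?nnegrE ?norm2_ge0 // sqr_norm2. Qed.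

Lemma norm2_lt x y r : 0 <= r -> (norm2 x y < r) = (x ^+ 2 + y ^+ 2 < r ^+ 2).
Proof. by move=> r0; rewrite -ltr_sqr ?nnegrE ?norm2_ge0 // sqr_norm2. Qed.

Lemma norm2D x y x' y' : norm2 (x + x') (y + y') <= norm2 x y + norm2 x' y'.
Proof.
rewrite norm2_le ?addr_ge0 ?norm2_ge0 // [leRHS]sqrrD !sqr_norm2.
have cs : x * x' + y * y' <= norm2 x y * norm2 x' y'.
  apply: le_trans (ler_norm _) _.
  rewrite -ler_sqr ?nnegrE ?mulr_ge0 ?norm2_ge0 //.
  rewrite real_normK ?num_real // exprMn !sqr_norm2.
  by have := sqr_ge0 (x * y' - y * x'); lra.
lra.
Qed.

Lemma norm2N x y : norm2 (- x) (- y) = norm2 x y.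
Proof. by rewrite /norm2 !sqrrN. Qed.

Lemma norm2_close x y x' y' d : norm2 (x - x') (y - y') <= d ->
  norm2 x y <= norm2 x' y' + d /\ norm2 x' y' <= norm2 x y + d.
Proof.
move=> h; split.
  by have := norm2D x' y' (x - x') (y - y'); rewrite ![_ + (_ - _)]addrC !subrK; lra.
have := norm2D x y (- (x - x')) (- (y - y')); rewrite norm2N !opprB ![_ + (_ - _)]addrC !subrK.
lra.
Qed.

(** Along the ray in direction [(c, s)] the squared norm has derivative [2 (r + c x + s y)],
    nonnegative once [norm2 x y <= r]. This is why centres on the boundary of the gap are the worst
    case: vertices further away lose less and keep more. *)
Lemma norm2_mono (c s r rho x y : R) : c ^+ 2 + s ^+ 2 = 1 -> r <= rho ->
  norm2 x y <= r ->
  norm2 (r * c + x) (r * s + y) <= norm2 (rho * c + x) (rho * s + y).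
Proof.
move=> cs rr xy; have r0 : 0 <= r := le_trans (norm2_ge0 x y) xy.
rewrite norm2_le ?norm2_ge0 // sqr_norm2.
rewrite norm2_le // in xy.
have dot : - r <= c * x + s * y.
  have : (c * x + s * y) ^+ 2 <= r ^+ 2.
    apply: le_trans xy.
    rewrite -[leRHS]mul1r -cs.
    by have := sqr_ge0 (c * y - s * x); lra.
  move=> d2; rewrite lerNl; apply: le_trans (ler_norm _) _.
  by rewrite -ler_sqr ?nnegrE // real_normK ?num_real // sqrrN.
have -> : (rho * c + x) ^+ 2 + (rho * s + y) ^+ 2 =
  (c ^+ 2 + s ^+ 2) * rho ^+ 2 + 2 * rho * (c * x + s * y) + (x ^+ 2 + y ^+ 2) by ring.
have -> : (r * c + x) ^+ 2 + (r * s + y) ^+ 2 =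
  (c ^+ 2 + s ^+ 2) * r ^+ 2 + 2 * r * (c * x + s * y) + (x ^+ 2 + y ^+ 2) by ring.
rewrite cs !mul1r.
have : 0 <= (rho - r) * (rho + r + 2 * (c * x + s * y)) by apply: mulr_ge0; lra.
lra.
Qed.

Lemma norm2_rot (c s x y : R) : c ^+ 2 + s ^+ 2 = 1 ->
  norm2 (c * x - s * y) (s * x + c * y) = norm2 x y.
Proof.
move=> cs; rewrite /norm2; congr Num.sqrt.
by rewrite -[RHS]mul1r -cs; ring.
Qed.

Definition near_rotation (c s : R) (f : int * int -> int * int) : Prop :=
  forall a b : int, norm2 ((f (a, b)).1%:~R - (c * a%:~R - s * b%:~R))
    ((f (a, b)).2%:~R - (s * a%:~R + c * b%:~R)) <= 5.

(* A rotation is a product of three shears, and rounding a shear of the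
   lattice to integers keeps it bijective. *)
Lemma lattice_rotation (c s : R) : c ^+ 2 + s ^+ 2 = 1 ->
  exists2 f, injective f & near_rotation c s f.
Proof.
wlog c0 : c s / 0 <= c.
  move=> wl cs; have [c0|c0] := leP 0 c; first exact: wl.
  have [||f finj fr] := wl (- c) (- s); rewrite ?sqrrN //; first by lra.
  exists (negp \o f); first by apply: inj_comp finj; exact: negp_inj.
  move=> a b; have := fr a b; rewrite /negp /= !rmorphN /= -norm2N.
  by congr (norm2 _ _ <= _); ring.
move=> cs; have c1 : 0 < 1 + c by lra.
(* The tangent of half the angle. The reduction to [0 <= c], by composing with [negp], keeps it
   between [- 1] and [1]. *)
pose tau := s / (1 + c).
have tauE : tau * (1 + c) = s by rewrite /tau divfK // gt_eqF.
have tau_s : tau * s = 1 - c.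
  by rewrite /tau mulrAC -expr2 (_ : s ^+ 2 = (1 - c) * (1 + c)) ?mulfK ?gt_eqF //; lra.
have s_le : - 1 <= s <= 1 by apply/andP; split; nra.
have tau_le : - 1 <= tau <= 1.
  by apply/andP; split; rewrite /tau ?ler_pdivrMr ?ler_pdivlMr //; nra.
pose sh1 (u : int * int) := (u.1 - Num.floor (tau * u.2%:~R), u.2).
pose sh2 (u : int * int) := (u.1, u.2 + Num.floor (s * u.1%:~R)).
have sh1i : injective sh1 by case=> a b [a' b'] [] /[swap] <- /addIr ->.
have sh2i : injective sh2 by case=> a b [a' b'] [] <- /addIr ->.
exists (sh1 \o sh2 \o sh1); first by apply: inj_comp => //; apply: inj_comp.
move=> a b; rewrite /sh1 /sh2 /=.
set a1 := a - _; set b1 := b + _.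
have frac (z : R) : exists2 e : R, 0 <= e <= 1 & (Num.floor z)%:~R = z - e.
  exists (z - (Num.floor z)%:~R); last by rewrite opprB addrC subrK.
  by have /andP[] := floor_itv z; rewrite intrD; lra.
have [e1 e1b E1] := frac (tau * b%:~R).
have [e2 e2b E2] := frac (s * a1%:~R).
have [e3 e3b E3] := frac (tau * b1%:~R).
have a1E : a1%:~R = a%:~R - tau * b%:~R + e1 by rewrite /a1 rmorphB /= E1; ring.
have b1E : b1%:~R = s * a%:~R + c * b%:~R + (s * e1 - e2).
  rewrite /b1 rmorphD /= E2 a1E.
  have -> : c = 1 - tau * s by rewrite tau_s; ring.
  by ring.
rewrite rmorphB /= E3 b1E a1E.
set A := a%:~R; set B := b%:~R.
have -> : A - tau * B + e1 - (tau * (s * A + c * B + (s * e1 - e2)) - e3) - (c * A - s * B)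
    = (1 - c - tau * s) * A + (s - tau * (1 + c)) * B + (e1 - tau * (s * e1 - e2) + e3).
  by ring.
have -> : s * A + c * B + (s * e1 - e2) - (s * A + c * B) = s * e1 - e2 by ring.
rewrite tau_s tauE !subrr !mul0r !add0r norm2_le //.
(* The three rounding errors lie in [[0, 1]], so the total errors are at most [4] and [2] in the two
   coordinates, and [16 + 4 <= 5^2]. *)
have /andP[y1 y2] : - 2 <= s * e1 - e2 <= 2.
  by move: s_le e1b e2b; clear=> /andP[? ?] /andP[? ?] /andP[? ?]; apply/andP; split; nra.
move: (s * e1 - e2) y1 y2 => y y1 y2.
have /andP[x1 x2] : - 4 <= e1 - tau * y + e3 <= 4.
  by move: tau_le e1b e3b y1 y2; clear=> /andP[? ?] /andP[? ?] /andP[? ?] ? ?; apply/andP; split; nra.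
move: (e1 - tau * y + e3) x1 x2 => x x1 x2.
have : x ^+ 2 <= 16 by move: x1 x2; clear; nra.
have : y ^+ 2 <= 4 by move: y1 y2; clear; nra.
lra.
Qed.

End PlaneNorm.

(** * Discs around lattice points compared with the reference discs *)

Definition normsq (q : int * int) : int := q.1 * q.1 + q.2 * q.2.

Definition lattice_close (m : int) (p q : int * int) : bool :=
  (0 <= m) && ((q.1 - p.1) * (q.1 - p.1) + (q.2 - p.2) * (q.2 - p.2) <= m * m).

Section Transfer.
Variable R : realType.

Lemma int_norm_lt (a b r : int) : 0 <= r ->
  (a * a + b * b < r * r) = (norm2 (a%:~R : R) b%:~R < r%:~R).
Proof.
by move=> r0; rewrite norm2_lt ?ler0z // !expr2 -!rmorphM -rmorphD /= ltr_int.
Qed.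

Lemma int_norm_le (a b r : int) : 0 <= r ->
  (a * a + b * b <= r * r) = (norm2 (a%:~R : R) b%:~R <= r%:~R).
Proof.
by move=> r0; rewrite norm2_le ?ler0z // !expr2 -!rmorphM -rmorphD /= ler_int.
Qed.

Lemma int_norm_ge (a b r : int) : 0 <= r ->
  (r * r <= a * a + b * b) = (r%:~R <= norm2 (a%:~R : R) b%:~R).
Proof. by move=> r0; rewrite leNgt int_norm_lt // -leNgt. Qed.

Lemma polar_form (x y : R) : exists c s : R,
  [/\ c ^+ 2 + s ^+ 2 = 1, x = norm2 x y * c & y = norm2 x y * s].
Proof.
have [n0|n0] := eqVneq (norm2 x y) 0.
  have := sqr_norm2 x y; rewrite n0 expr0n /= => /esym/eqP.
  rewrite paddr_eq0 ?sqr_ge0 // !sqrf_eq0 => /andP[/eqP -> /eqP ->].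
  by exists 1, 0; rewrite expr1n expr0n /= addr0 !mul0r.
exists (x / norm2 x y), (y / norm2 x y); split; last 2 first.
- by rewrite mulrC divfK.
- by rewrite mulrC divfK.
by rewrite !expr_div_n -mulrDl -sqr_norm2 mulfV // sqrf_eq0.
Qed.

Lemma inverse_rotation_close (c s rho : R) (f : int * int -> int * int) (a b : int) :
  c ^+ 2 + s ^+ 2 = 1 -> near_rotation c s f ->
  let x := (f (a, b)).1%:~R in let y := (f (a, b)).2%:~R in
  [/\ norm2 x y <= norm2 (a%:~R : R) b%:~R + 5,
      norm2 (rho * c + x) (rho * s + y) <= norm2 (rho + a%:~R) b%:~R + 5 &
      norm2 (rho + a%:~R) b%:~R <= norm2 (rho * c + x) (rho * s + y) + 5].
Proof.
move=> cs /(_ a b) H x y; rewrite -/x -/y in H.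
have [h1 _] := norm2_close H; rewrite norm2_rot // in h1.
have H' : norm2 (rho * c + x - (c * (rho + a%:~R) - s * b%:~R))
    (rho * s + y - (s * (rho + a%:~R) + c * b%:~R)) <= 5.
  by apply: le_trans H; rewrite le_eqVlt; apply/orP; left; apply/eqP; congr norm2; ring.
by have [h2 h3] := norm2_close H'; rewrite norm2_rot // in h2 h3.
Qed.

Lemma rotation_back_close (c s rho : R) (f : int * int -> int * int) (a b : int) :
  c ^+ 2 + s ^+ 2 = 1 -> near_rotation c (- s) f ->
  let x := (f (a, b)).1%:~R in let y := (f (a, b)).2%:~R in
  [/\ norm2 x y <= norm2 (a%:~R : R) b%:~R + 5,
      norm2 (rho + x) y <= norm2 (rho * c + a%:~R) (rho * s + b%:~R) + 5 &
      norm2 (rho * c + a%:~R) (rho * s + b%:~R) <= norm2 (rho + x) y + 5].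
Proof.
move=> cs /(_ a b) H x y; rewrite -/x -/y in H.
have cs' : c ^+ 2 + (- s) ^+ 2 = 1 by rewrite sqrrN.
have [h1 _] := norm2_close H; rewrite norm2_rot // in h1.
have H' : norm2 (rho + x - (c * (rho * c + a%:~R) - (- s) * (rho * s + b%:~R)))
    (y - ((- s) * (rho * c + a%:~R) + c * (rho * s + b%:~R))) <= 5.
  apply: le_trans H; rewrite le_eqVlt; apply/orP; left; apply/eqP.
  congr norm2; last by ring.
  by rewrite -[X in X + x]mulr1 -cs; ring.
by have [h2 h3] := norm2_close H'; rewrite norm2_rot // in h2 h3.
Qed.

Variables (M Rr : int) (W : nat) (q0 : int * int).
Hypothesis M7 : 7 <= M.
Hypothesis RrM : M + 2 <= Rr.
Hypothesis gridW : `|q0.1| + M <= W%:Z /\ `|q0.2| + M <= W%:Z.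

Let shift (u : int * int) : int * int := (q0.1 + u.1, q0.2 + u.2).

Lemma shift_inj : injective shift.
Proof. by case=> a b [a' b'] [] /addrI -> /addrI ->. Qed.

Lemma shift_in_grid m u : m <= M -> (0 <= m) && (u.1 * u.1 + u.2 * u.2 <= m * m) ->
  in_grid W (shift u).
Proof.
case: u => a b mM /andP[m0 H]; rewrite /in_grid /shift; cbn [fst snd] in *.
have s1 : 0 <= a * a by rewrite -expr2 sqr_ge0.
have s2 : 0 <= b * b by rewrite -expr2 sqr_ge0.
have /andP[h1 h1'] : - m <= a <= m by apply: sqr_le_abs => //; lia.
have /andP[h2 h2'] : - m <= b <= m by apply: sqr_le_abs => //; lia.
by case: gridW => g1 g2; apply/andP; split; lia.
Qed.

Lemma close_shift m u : lattice_close m q0 (shift u) = (0 <= m) && (u.1 * u.1 + u.2 * u.2 <= m * m).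
Proof.
by rewrite /lattice_close /shift /= ![_ + u.1 - _]addrAC ![_ + u.2 - _]addrAC !subrr !add0r.
Qed.

Let rho : R := norm2 q0.1%:~R q0.2%:~R.

(** Kept points must not be overcounted, so the reference disc is injected into the disc around
    [q0]. The rounded rotation costs [5] in both radii, from [M - 7] to [M - 2] and from [Rr - 5] to
    [Rr]; then [norm2_mono] moves the centre inward from radius [Rr] to that of [q0]. *)
Lemma inner_kept_count W0 : (M + 2) * (M + 2) <= normsq q0 -> normsq q0 < Rr * Rr ->
  (lattice_count W0 (ball_in (M - 7) Rr (Rr - 5)) <=
   lattice_count W (fun q => lattice_close (M - 2) q0 q && (normsq q < Rr * Rr)%R))%N.
Proof.
move=> q0lo q0hi; have [c [s [cs q01 q02]]] := polar_form q0.1%:~R q0.2%:~R.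
rewrite -/rho in q01 q02.
have [f finj fr] := lattice_rotation cs.
have rlo : (M + 2)%:~R <= rho by rewrite /rho -int_norm_ge //; lia.
have rhi : rho < Rr%:~R by rewrite /rho -int_norm_lt //; lia.
apply: (@lattice_count_inj _ _ _ _ (shift \o f)) => [|[a b]].
  exact: inj_comp shift_inj finj.
rewrite ball_inE => /andP[/andP[m0 ab] Rab].
have [] := @inverse_rotation_close c s Rr%:~R f a b cs fr.
move: ab Rab; rewrite int_norm_le // -rmorphD int_norm_lt; last by lia.
rewrite !rmorphB /= => ab Rab.
set x := (f (a, b)).1; set y := (f (a, b)).2 => xy1 xy2 _.
rewrite rmorphD /= in rlo Rab.
have xyM : norm2 (x%:~R : R) y%:~R <= M%:~R - 2%:~R.
  apply: le_trans xy1 _; rewrite -(_ : 7%:~R = 7) // in ab *; lra.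
have xym : (0 <= M - 2) && (x * x + y * y <= (M - 2) * (M - 2)).
  have m2 : 0 <= M - 2 by lia.
  by rewrite m2 /= int_norm_le // rmorphB.
rewrite (shift_in_grid _ xym) ?andbT; last by lia.
rewrite close_shift /normsq /shift /= -/x -/y.
rewrite xym /= int_norm_lt; last by lia.
rewrite !rmorphD /= q01 q02.
apply: le_lt_trans (norm2_mono cs (ltW rhi) _) _; first by apply: (le_trans xyM); lra.
have E5 : 5%:~R = 5 :> R by [].
by apply: le_lt_trans xy2 _; rewrite -ltrBrDr -E5.
Qed.

(** Lost points must not be undercounted, so the injection goes the other way, by a rounded inverse
    rotation, and the radii become [M + 7] and [Ro - 5]. *)
Lemma inner_lost_count W0 (Ro : int) : M + 7 <= W0%:Z -> 5 <= Ro ->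
  (M + 2) * (M + 2) <= normsq q0 -> normsq q0 < Rr * Rr ->
  (lattice_count W (fun q => lattice_close (M + 2) q0 q && (Ro * Ro <= normsq q)%R) <=
   lattice_count W0 (ball_out (M + 7) Rr (Ro - 5)))%N.
Proof.
move=> MW0 Ro5 q0lo q0hi; have [c [s [cs q01 q02]]] := polar_form q0.1%:~R q0.2%:~R.
rewrite -/rho in q01 q02.
have cs' : c ^+ 2 + (- s) ^+ 2 = 1 by rewrite sqrrN.
have [f finj fr] := lattice_rotation cs'.
have rlo : (M + 2)%:~R <= rho by rewrite /rho -int_norm_ge //; lia.
have rhi : rho < Rr%:~R by rewrite /rho -int_norm_lt //; lia.
apply: (@lattice_count_inj _ _ _ _ (f \o (fun q => (q.1 - q0.1, q.2 - q0.2)))) => [|q].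
  by apply: inj_comp finj _ => -[x y] [x' y'] [] /addIr -> /addIr ->.
have [[a b] ->] : exists u, q = shift u.
  by exists (q.1 - q0.1, q.2 - q0.2); case: q => x y; rewrite /shift /= ![_ + (_ - _)]addrC !subrK.
rewrite close_shift /normsq /shift /= ![_ + a - _]addrAC ![_ + b - _]addrAC !subrr !add0r.
have m2 : 0 <= M + 2 by lia.
have m7 : 0 <= M + 7 by lia.
have Ro0 : 0 <= Ro by lia.
have Ro50 : 0 <= Ro - 5 by lia.
rewrite m2 /= int_norm_le // int_norm_ge // [(M + 2)%:~R]intrD [(_ + a)%:~R]intrD [(_ + b)%:~R]intrD q01 q02.
move=> /andP[ab Roq].
have [] := @rotation_back_close c s Rr%:~R f a b cs fr.
set x := (f (a, b)).1; set y := (f (a, b)).2 => xy1 _ xy2.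
have E5 : 5%:~R = 5 :> R by [].
have E2 : 2%:~R = 2 :> R by [].
have E7 : 7%:~R = 7 :> R by [].
have xy : (0 <= M + 7) && (x * x + y * y <= (M + 7) * (M + 7)).
  rewrite m7 /= int_norm_le // intrD E7.
  by move: xy1 ab; rewrite E2; lra.
apply/andP; split; last exact: in_grid_of_ball xy.
rewrite [f (a, b)]surjective_pairing -/x -/y ball_outE xy /= int_norm_ge // intrB intrD E5.
have abr : norm2 (a%:~R : R) b%:~R <= rho.
  by apply: le_trans ab _; rewrite -intrD.
have := norm2_mono cs (ltW rhi) abr.
by move: Roq xy2; lra.
Qed.

Lemma outer_kept_count W0 (Ro : int) : M + 2 <= Ro -> Ro * Ro <= normsq q0 ->
  (lattice_count W0 (ball_out (M - 7) Ro (Ro + 5)) <=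
   lattice_count W (fun q => lattice_close (M - 2) q0 q && (Ro * Ro <= normsq q)%R))%N.
Proof.
move=> RoM q0lo; have [c [s [cs q01 q02]]] := polar_form q0.1%:~R q0.2%:~R.
rewrite -/rho in q01 q02.
have [f finj fr] := lattice_rotation cs.
have Ro0 : 0 <= Ro by lia.
have Ro50 : 0 <= Ro + 5 by lia.
have rlo : Ro%:~R <= rho by rewrite /rho -int_norm_ge.
apply: (@lattice_count_inj _ _ _ _ (shift \o f)) => [|[a b]].
  exact: inj_comp shift_inj finj.
rewrite ball_outE => /andP[/andP[m0 ab] Rab].
have [] := @inverse_rotation_close c s Ro%:~R f a b cs fr.
move: ab Rab; rewrite int_norm_le // int_norm_ge // intrB [(Ro + 5)%:~R]intrD [(Ro + a)%:~R]intrD => ab Rab.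
set x := (f (a, b)).1; set y := (f (a, b)).2 => xy1 _ xy2.
have E5 : 5%:~R = 5 :> R by [].
have E2 : 2%:~R = 2 :> R by [].
have E7 : 7%:~R = 7 :> R by [].
have xyM : norm2 (x%:~R : R) y%:~R <= M%:~R - 2%:~R.
  by move: xy1 ab; rewrite E2 E7; lra.
have m2 : 0 <= M - 2 by lia.
have xym : (0 <= M - 2) && (x * x + y * y <= (M - 2) * (M - 2)).
  by rewrite m2 /= int_norm_le // intrB.
have mM : M - 2 <= M by lia.
rewrite [X in X && _]/= (shift_in_grid mM xym) andbT close_shift -/x -/y xym /=.
rewrite /normsq /shift /= int_norm_ge // [(q0.1 + _)%:~R]intrD [(q0.2 + _)%:~R]intrD q01 q02 -/x -/y.
have xyr : norm2 (x%:~R : R) y%:~R <= Ro%:~R.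
  apply: (le_trans xyM); rewrite -intrB ler_int; lia.
apply: le_trans (norm2_mono cs rlo xyr).
by move: xy2 Rab; rewrite E5; lra.
Qed.

Lemma outer_lost_count W0 (Ro : int) : M + 7 <= W0%:Z -> M + 2 <= Ro ->
  Ro * Ro <= normsq q0 ->
  (lattice_count W (fun q => lattice_close (M + 2) q0 q && (normsq q < Rr * Rr)%R) <=
   lattice_count W0 (ball_in (M + 7) Ro (Rr + 5)))%N.
Proof.
move=> MW0 RoM q0lo; have [c [s [cs q01 q02]]] := polar_form q0.1%:~R q0.2%:~R.
rewrite -/rho in q01 q02.
have cs' : c ^+ 2 + (- s) ^+ 2 = 1 by rewrite sqrrN.
have [f finj fr] := lattice_rotation cs'.
have Ro0 : 0 <= Ro by lia.
have Rr0 : 0 <= Rr by lia.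
have Rr5 : 0 <= Rr + 5 by lia.
have rlo : Ro%:~R <= rho by rewrite /rho -int_norm_ge.
apply: (@lattice_count_inj _ _ _ _ (f \o (fun q => (q.1 - q0.1, q.2 - q0.2)))) => [|q].
  by apply: inj_comp finj _ => -[x y] [x' y'] [] /addIr -> /addIr ->.
have [[a b] ->] : exists u, q = shift u.
  by exists (q.1 - q0.1, q.2 - q0.2); case: q => x y; rewrite /shift /= ![_ + (_ - _)]addrC !subrK.
rewrite close_shift /normsq /shift /= ![_ + a - _]addrAC ![_ + b - _]addrAC !subrr !add0r.
have m2 : 0 <= M + 2 by lia.
have m7 : 0 <= M + 7 by lia.
rewrite m2 /= int_norm_le // int_norm_lt // [(M + 2)%:~R]intrD [(_ + a)%:~R]intrD [(_ + b)%:~R]intrD q01 q02.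
move=> /andP[ab Roq].
have [] := @rotation_back_close c s Ro%:~R f a b cs fr.
set x := (f (a, b)).1; set y := (f (a, b)).2 => xy1 xy2 _.
have E5 : 5%:~R = 5 :> R by [].
have E2 : 2%:~R = 2 :> R by [].
have E7 : 7%:~R = 7 :> R by [].
have xy : (0 <= M + 7) && (x * x + y * y <= (M + 7) * (M + 7)).
  rewrite m7 /= int_norm_le // intrD E7.
  by move: xy1 ab; rewrite E2; lra.
apply/andP; split; last exact: in_grid_of_ball xy.
rewrite [f (a, b)]surjective_pairing -/x -/y ball_inE xy /= int_norm_lt // [(Rr + 5)%:~R]intrD [(Ro + x)%:~R]intrD E5.
have abr : norm2 (a%:~R : R) b%:~R <= Ro%:~R.
  by apply: le_trans ab _; rewrite -intrD ler_int.
have := norm2_mono cs rlo abr.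
by move: Roq xy2; lra.
Qed.

End Transfer.

Lemma vertex_count (n W k : nat) (q : 'I_n -> int * int) (P : pred (int * int)) :
  (forall b : {ffun 'I_2 -> 'I_(2 * W).+1}, P (grid_point b) ->
     #|[set i | q i == grid_point b]%SET| = k) ->
  #|[set i | in_grid W (q i) && P (q i)]%SET| = (lattice_count W P * k)%N.
Proof.
move=> H; rewrite -sum1_card (partition_big (fun i => grid_box W (q i))
  (mem [set b | P (grid_point b)]%SET)) /=; last first.
  by move=> i; rewrite !inE => /andP[gi Pi]; rewrite grid_boxK.
rewrite (eq_bigr (fun=> k)) ?sum_nat_const // => b; rewrite inE => Pb.
rewrite -(H b Pb) -sum1_card; apply: eq_bigl => i; rewrite !inE.
apply/andP/eqP => [[/andP[gi _] /eqP <-]|qi]; first by rewrite grid_boxK.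
by rewrite qi grid_point_in Pb grid_pointK.
Qed.

Lemma normsq_close (R : realType) (m x : int) (p q : int * int) :
  lattice_close m p q -> 0 <= x -> (x + m) * (x + m) <= normsq p -> x * x <= normsq q.
Proof.
case: p q => a b [a' b'] /andP[/= m0 h] x0; rewrite /normsq /=.
rewrite (int_norm_le R) // in h.
rewrite (int_norm_ge R) ?addr_ge0 // (int_norm_ge R) //.
have := norm2D (a'%:~R : R) b'%:~R (- (a'%:~R - a%:~R)) (- (b'%:~R - b%:~R)).
rewrite norm2N !opprB ![_ + (_ - _)]addrC !subrK -!intrB [(x + m)%:~R]intrD.
by move: h; lra.
Qed.

Lemma closeC m p q : lattice_close m p q = lattice_close m q p.
Proof. by rewrite /lattice_close -[q.1 - _]opprB -[q.2 - _]opprB !mulrNN. Qed.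

Lemma sqr_mono (x y : int) : 0 <= x <= y -> x * x <= y * y.
Proof. by move=> /andP[x0 xy]; apply: ler_pM. Qed.

Lemma close_weaken m m' p q : 0 <= m <= m' -> lattice_close m p q -> lattice_close m' p q.
Proof.
move=> mm /andP[m0 H]; have /andP[_ mm'] := mm; rewrite /lattice_close (le_trans m0 mm') /=.
exact: le_trans H (sqr_mono mm).
Qed.

(** * The annulus template in the plane *)

Section Template.
Variables (R : realType) (eps : R) (n : nat) (G : sgraph 'I_n) (q : 'I_n -> int * int).
Variables (M Rr g W k0 k1 : nat).
Hypotheses (epsle : 0 < eps <= 1 / 2) (M8 : (100 <= M)%N) (Mg : (8 * g <= M)%N)
  (g1 : (1 <= g)%N) (RM : (81 * M <= Rr)%N).
Hypothesis WE : W = (Rr + 8 * g + 3 * M)%N.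
Hypotheses (k0_gt0 : (0 < k0)%N).

Let Ro : int := Rr%:Z + 8 * g%:Z.

Definition template_kappa (p : int * int) : nat :=
  if shell Rr%:Z (Rr%:Z + 8 * g%:Z) p then 0%N
  else if shell (Rr%:Z - 3 * M%:Z) Rr%:Z p then k1 else k0.

Let lin7 : 7 <= M%:Z. Proof. by lia. Qed.
Let linR : M%:Z + 2 <= Rr%:Z. Proof. by lia. Qed.
Let linW0 : M%:Z + 7 <= (M + 7)%N%:Z. Proof. by lia. Qed.
Let linC : 0 <= Rr%:Z <= Rr%:Z + 8 * g%:Z + 2 * M%:Z. Proof. by lia. Qed.
Let linC' : 0 <= Rr%:Z + M%:Z + 2 <= Rr%:Z + 8 * g%:Z + 2 * M%:Z. Proof. by lia. Qed.
Let linM : 0 <= M%:Z + 2 <= Rr%:Z - M%:Z. Proof. by lia. Qed.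
Let lin5 : 5 <= Ro. Proof. by rewrite /Ro; lia. Qed.
Let linRo : M%:Z + 2 <= Ro. Proof. by rewrite /Ro; lia. Qed.
Let linRRo : 0 <= Rr%:Z <= Ro. Proof. by rewrite /Ro; lia. Qed.
Let lin3 : 0 <= Rr%:Z - 3 * M%:Z. Proof. by lia. Qed.
Let lin3' : 0 <= Rr%:Z - 3 * M%:Z + (M%:Z + 2) <= Rr%:Z - M%:Z. Proof. by lia. Qed.
Let lin3o : 0 <= Rr%:Z - 3 * M%:Z + (M%:Z + 2) <= Ro. Proof. by rewrite /Ro; lia. Qed.
Let lin2 : 0 <= M%:Z - 2 <= M%:Z + 2. Proof. by lia. Qed.
Let linRM : 0 <= Rr%:Z - M%:Z. Proof. by lia. Qed.
Let linRMo : 0 <= Rr%:Z - M%:Z + (M%:Z + 2) <= Ro. Proof. by rewrite /Ro; lia. Qed.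
Let linWh : 0 <= Rr%:Z + M%:Z + 2 <= W%:Z. Proof. by rewrite WE; lia. Qed.
Let linWR : 0 <= Rr%:Z <= W%:Z. Proof. by rewrite WE; lia. Qed.
Let lin8 : 0 <= 8 * g%:Z <= M%:Z + 2. Proof. by lia. Qed.

Hypothesis counts : forall b : {ffun 'I_2 -> 'I_(2 * W).+1},
  #|[set i | q i == grid_point b]%SET| = template_kappa (grid_point b).

Let A (i : 'I_n) : bool := normsq (q i) < Rr%:Z * Rr%:Z.

Lemma grid_vertex (p : int * int) : in_grid W p -> (0 < template_kappa p)%N ->
  exists i, q i = p.
Proof.
move=> gp kp; have := counts (grid_box W p); rewrite grid_boxK // => H.
have : (0 < #|[set i | q i == p]%SET|)%N by rewrite H.
by case/card_gt0P => i; rewrite inE => /eqP; exists i.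
Qed.

Lemma some_inner : exists u, A u.
Proof.
have [||i qi] := @grid_vertex (0, 0); first by rewrite /in_grid /=; lia.
  have s1 : shell Rr%:Z (Rr%:Z + 8 * g%:Z) (0, 0) = false.
    by apply/negbTE; rewrite /shell /=; apply/negP => /andP[]; move: RM M8; nia.
  have s2 : shell (Rr%:Z - 3 * M%:Z) Rr%:Z (0, 0) = false.
    by apply/negbTE; rewrite /shell /=; apply/negP => /andP[]; move: RM M8; nia.
  by rewrite /template_kappa s1 s2.
by exists i; rewrite /A qi /normsq /=; move: RM M8; nia.
Qed.

Lemma some_outer : exists v, ~~ A v.
Proof.
have [||i qi] := @grid_vertex (Ro, 0).
- by rewrite /in_grid /Ro /= WE; lia.
- have s1 : shell Rr%:Z (Rr%:Z + 8 * g%:Z) (Ro, 0) = false.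
    by apply/negbTE; rewrite /shell /= /Ro; apply/negP => /andP[_]; lia.
  have s2 : shell (Rr%:Z - 3 * M%:Z) Rr%:Z (Ro, 0) = false.
    by apply/negbTE; rewrite /shell /= /Ro; apply/negP => /andP[_]; nia.
  by rewrite /template_kappa s1 s2.
exists i; rewrite /A qi /normsq /= /Ro -leNgt; nia.
Qed.

Lemma outside_gap i : in_grid W (q i) -> ~~ A i -> Ro * Ro <= normsq (q i).
Proof.
move=> gi; rewrite /A -leNgt => Rq; rewrite leNgt; apply/negP => qR.
have := counts (grid_box W (q i)); rewrite grid_boxK // /template_kappa.
have -> : shell Rr%:Z (Rr%:Z + 8 * g%:Z) (q i) by rewrite /shell -/(normsq _) Rq.
by move/eqP; rewrite cards_eq0 => /eqP/setP/(_ i); rewrite !inE eqxx.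
Qed.

Lemma normsq_grid (m : int) p : 0 <= m -> m <= W%:Z -> normsq p <= m * m -> in_grid W p.
Proof. by move=> m0 mW H; apply: (in_grid_of_ball mW); rewrite m0. Qed.

Let MZ : 0 <= M%:Z + 2. Proof. by lia. Qed.

(** Confines both ends of a crossing edge to the vicinity of the gap. From there a disc of radius
    [M] stays in the grid and its inner part stays in the raised annulus, which is [3 M] wide for
    this purpose. *)
Lemma crossing_bounds u v : lattice_close (M%:Z + 2) (q u) (q v) -> A u -> ~~ A v ->
  [/\ in_grid W (q v), Ro * Ro <= normsq (q v),
     (Rr%:Z - M%:Z) * (Rr%:Z - M%:Z) <= normsq (q u) &
     normsq (q v) < (Rr%:Z + M%:Z + 2) * (Rr%:Z + M%:Z + 2)].
Proof.
move=> uv Au Av.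
have hi : normsq (q v) < (Rr%:Z + M%:Z + 2) * (Rr%:Z + M%:Z + 2).
  rewrite ltNge; apply/negP => H; move: Au; rewrite /A ltNge => /negP; apply.
  apply: (normsq_close R (m := M%:Z + 2) (p := q v)) => //; first by rewrite closeC.
  by rewrite addrA.
have gv : in_grid W (q v).
  by have /andP[w0 w1] := linWh; apply: (normsq_grid w0 w1 (ltW hi)).
have lo := outside_gap gv Av; split => //.
apply: (normsq_close R (m := M%:Z + 2) (p := q v)); rewrite 1?closeC //.
exact: le_trans (sqr_mono linRMo) lo.
Qed.

Lemma no_crossing_subgraph :
  (forall i j, adj G i j -> lattice_close (8 * g%:Z) (q i) (q j)) ->
  has_disconnected_subgraph (1 / 2 + eps) G.
Proof.
move=> near; apply: (@cut_subgraph R eps n G A some_inner some_outer) => v.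
rewrite (_ : [set w | adj G v w && (A w != A v)]%SET = finset.set0) ?cards0.
  by rewrite mulr0 mulr_ge0 //; move: epsle; lra.
have no i j : adj G i j -> A i -> A j.
  move=> /near ij Ai; apply/negPn/negP => Aj.
  have ij' : lattice_close (M%:Z + 2) (q i) (q j).
    exact: close_weaken ij.
  have [_ lo _ _] := crossing_bounds ij' Ai Aj.
  move: Ai; rewrite /A ltNge => /negP; apply.
  by apply: (normsq_close R (m := 8 * g%:Z) (p := q j)); rewrite 1?closeC.
apply/setP => w; rewrite !inE; apply/negbTE; apply/negP => /andP[vw].
case Av : (A v); case Aw : (A w) => //= _.
  by have := no _ _ vw Av; rewrite Aw.
by have := no w v; rewrite adj_sym vw Aw Av => /(_ isT isT).
Qed.

Let cnt := lattice_count (M + 7).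
Hypotheses
  (adj_close : forall i j, adj G i j -> lattice_close (M%:Z + 2) (q i) (q j))
  (close_adj : forall i j, i != j -> lattice_close (M%:Z - 2) (q i) (q j) -> adj G i j).

Lemma kept_ge (v : 'I_n) (P : pred (int * int)) (k : nat) :
  (forall b : {ffun 'I_2 -> 'I_(2 * W).+1},
     lattice_close (M%:Z - 2) (q v) (grid_point b) && P (grid_point b) ->
     template_kappa (grid_point b) = k) ->
  (forall i, P (q i) -> A i == A v) ->
  (lattice_count W (fun p => lattice_close (M%:Z - 2) (q v) p && P p) * k <=
   #|[set w | adj G v w && (A w == A v)]%SET| + 1)%N.
Proof.
move=> kapE PA.
rewrite -(@vertex_count n W k q (fun p => lattice_close (M%:Z - 2) (q v) p && P p)); last first.
  by move=> b H; rewrite counts kapE.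
apply: (@leq_trans #|[set v]%SET :|: [set w | adj G v w && (A w == A v)]%SET|); last first.
  by apply: leq_trans (leq_card_setU _ _) _; rewrite cards1 addnC.
apply: subset_leq_card; apply/fintype.subsetP => i; rewrite !inE => /and3P[_ vi Pi].
have [//|vi'] := eqVneq i v.
have -> : adj G v i by apply: close_adj => //; rewrite eq_sym.
by rewrite PA.
Qed.

Lemma lost_le (v : 'I_n) (P : pred (int * int)) (k : nat) :
  (forall b : {ffun 'I_2 -> 'I_(2 * W).+1},
     lattice_close (M%:Z + 2) (q v) (grid_point b) && P (grid_point b) ->
     template_kappa (grid_point b) = k) ->
  (forall i, adj G v i -> A i != A v -> in_grid W (q i) && P (q i)) ->
  (#|[set w | adj G v w && (A w != A v)]%SET| <=
   lattice_count W (fun p => lattice_close (M%:Z + 2) (q v) p && P p) * k)%N.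
Proof.
move=> kapE PA.
rewrite -(@vertex_count n W k q (fun p => lattice_close (M%:Z + 2) (q v) p && P p)); last first.
  by move=> b H; rewrite counts kapE.
apply: subset_leq_card; apply/fintype.subsetP => i; rewrite !inE => /andP[vi Ai].
by have /andP[-> ->] := PA i vi Ai; rewrite adj_close.
Qed.

Hypothesis inner_ok : (1 / 2 + eps) *
   (cnt (ball_out (M%:Z + 7) Rr%:Z (Ro - 5)) * k0)%:R <=
   (1 / 2 - eps) * ((cnt (ball_in (M%:Z - 7) Rr%:Z (Rr%:Z - 5)) * k1)%:R - 1) :> R.
Hypothesis outer_ok : (1 / 2 + eps) *
   (cnt (ball_in (M%:Z + 7) Ro (Rr%:Z + 5)) * k1)%:R <=
   (1 / 2 - eps) * ((cnt (ball_out (M%:Z - 7) Ro (Ro + 5)) * k0)%:R - 1) :> R.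

Lemma kappa_outer p : Ro * Ro <= normsq p -> template_kappa p = k0.
Proof.
move=> H; rewrite /template_kappa /shell -/(normsq p) -/Ro [normsq p < Ro * Ro]ltNge H andbF.
have H' : Rr%:Z * Rr%:Z <= normsq p by exact: le_trans (sqr_mono linRRo) H.
by rewrite [normsq p < Rr%:Z * _]ltNge H' andbF.
Qed.

Lemma kappa_raised p : (Rr%:Z - 3 * M%:Z) * (Rr%:Z - 3 * M%:Z) <= normsq p ->
  normsq p < Rr%:Z * Rr%:Z -> template_kappa p = k1.
Proof.
by move=> lo hi; rewrite /template_kappa /shell -/(normsq p) [Rr%:Z * _ <= _]leNgt hi lo.
Qed.

Lemma coords_le p : normsq p <= (Rr%:Z + 8 * g%:Z + 2 * M%:Z) * (Rr%:Z + 8 * g%:Z + 2 * M%:Z) ->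
  `|p.1| + M%:Z <= W%:Z /\ `|p.2| + M%:Z <= W%:Z.
Proof.
move=> H; have /andP[] : in_grid (Rr + 8 * g + 2 * M) p.
  apply: (@in_grid_of_ball _ (Rr%:Z + 8 * g%:Z + 2 * M%:Z)); first by lia.
  by apply/andP; split => //; lia.
by move=> h1 h2; split; rewrite WE; lia.
Qed.

Lemma template_subgraph : has_disconnected_subgraph (1 / 2 + eps) G.
Proof.
apply: (@cut_subgraph R eps n G A some_inner some_outer) => v.
have [none|/set0Pn[w]] := eqVneq [set w | adj G v w && (A w != A v)]%SET finset.set0.
  rewrite none cards0 mulr0 mulr_ge0 //; have /andP[e0 e1] := epsle; lra.
rewrite inE => /andP[vw Aw]; have cvw := adj_close vw.
case Av : (A v).
  rewrite Av in Aw; have {}Aw : ~~ A w by case: (A w) Aw.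
  have [gw ow iv _] := crossing_bounds cvw Av Aw.
  have gW : `|(q v).1| + M%:Z <= W%:Z /\ `|(q v).2| + M%:Z <= W%:Z.
    by apply: coords_le; move: Av; rewrite /A => /ltW/le_trans; apply; exact: sqr_mono linC.
  have lo : (M%:Z + 2) * (M%:Z + 2) <= normsq (q v).
    exact: le_trans (sqr_mono linM) iv.
  have kept := @inner_kept_count R M%:Z Rr%:Z W (q v) lin7 linR gW (M + 7) lo Av.
  have lost := @inner_lost_count R M%:Z Rr%:Z W (q v) lin7 linR gW (M + 7) Ro linW0 lin5 lo Av.
  have k := @kept_ge v (fun p => normsq p < Rr%:Z * Rr%:Z) k1.
  have l := @lost_le v (fun p => Ro * Ro <= normsq p) k0.
  rewrite Av in k l.
  apply: (@cut_ineq R eps epsle _ _ _ _ (leq_trans (l _ _) (leq_mul lost (leqnn k0)))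
     (leq_trans (leq_mul kept (leqnn k1)) (k _ _)) inner_ok).
  - by move=> b /andP[_ H]; exact: kappa_outer.
  - move=> i vi Ai; have {}Ai : ~~ A i by case: (A i) Ai.
    by have [-> ->] := crossing_bounds (adj_close vi) Av Ai.
  - move=> b /andP[cb H]; apply: kappa_raised => //.
    apply: (normsq_close R (close_weaken lin2 cb)) => //.
    exact: le_trans (sqr_mono lin3') iv.
  - by move=> i Ai; rewrite /A Ai.
rewrite Av in Aw; have {}Aw : A w by case: (A w) Aw.
have {}Av : ~~ A v by rewrite Av.
have cwv : lattice_close (M%:Z + 2) (q w) (q v) by rewrite closeC.
have [gv ov _ hi] := crossing_bounds cwv Aw Av.
have gW : `|(q v).1| + M%:Z <= W%:Z /\ `|(q v).2| + M%:Z <= W%:Z.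
  by apply: coords_le; exact: le_trans (ltW hi) (sqr_mono linC').
have kept := @outer_kept_count R M%:Z Rr%:Z W (q v) lin7 linR gW (M + 7) Ro linRo ov.
have lost := @outer_lost_count R M%:Z Rr%:Z W (q v) lin7 linR gW (M + 7) Ro linW0 linRo ov.
have k := @kept_ge v (fun p => Ro * Ro <= normsq p) k0.
have l := @lost_le v (fun p => normsq p < Rr%:Z * Rr%:Z) k1.
rewrite (negbTE Av) in k l.
apply: (@cut_ineq R eps epsle _ _ _ _ (leq_trans (l _ _) (leq_mul lost (leqnn k1)))
   (leq_trans (leq_mul kept (leqnn k0)) (k _ _)) outer_ok).
- move=> b /andP[cb H]; apply: kappa_raised => //.
  apply: (normsq_close R cb) => //.
  exact: le_trans (sqr_mono lin3o) ov.
- move=> i vi Ai; have {}Ai : A i by case: (A i) Ai.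
  rewrite -/(A i) Ai andbT; have /andP[w0 w1] := linWR.
  by apply: (normsq_grid w0 w1); exact: ltW.
- by move=> b /andP[_ H]; exact: kappa_outer.
- move=> i H; have H' : Rr%:Z * Rr%:Z <= normsq (q i).
    exact: le_trans (sqr_mono linRRo) H.
  by rewrite /A ltNge H'.
Qed.

End Template.

(** * Choice of the parameters of the annulus *)

Lemma annulus_cost_le (R : realType) (C h cg cr k l M : R) :
  0 < C -> 1 <= k -> 1 <= l -> 0 < M -> 0 <= h -> 0 <= cr -> h * k ^+ 2 <= 72 ->
  (640 * C) ^+ 2 <= k -> 60 * k ^+ 2 * C ^+ 2 <= l ->
  k * l * cg <= 15 * (k * k * k * (M * M)) -> cr <= 19 * (k * k * k * (M * M)) ->
  C ^+ 2 / M ^+ 2 * (cg + h ^+ 2 * cr) < 1.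
Proof.
move=> C0 k1 l1 M0 h0 cr0 hk kC lC gl rl.
have k0 : 0 < k by lra.
have l0 : 0 < l by lra.
have M2 : 0 < M ^+ 2 by rewrite exprn_gt0.
have C2 : 0 < C ^+ 2 by rewrite exprn_gt0.
(* Gap and raised region each get a quarter of the budget [M^2]. For the gap, [60 = 4 * 15]. *)
have gC : C ^+ 2 * cg <= M ^+ 2 / 4.
  have g1 : l * cg <= 15 * k ^+ 2 * M ^+ 2.
    rewrite -(ler_pM2l k0) mulrA; apply: (le_trans gl).
    by rewrite le_eqVlt; apply/orP; left; apply/eqP; ring.
  rewrite -(ler_pM2l l0).
  have g2 : C ^+ 2 * (l * cg) <= C ^+ 2 * (15 * k ^+ 2 * M ^+ 2) by rewrite ler_pM2l.
  have g3 : 60 * k ^+ 2 * C ^+ 2 * M ^+ 2 <= l * M ^+ 2 by rewrite ler_pM2r.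
  by move: g2 g3; clear; lra.
(* Here [4 * 19 * 72^2 = 393984] is below [640^2]. *)
have rC : C ^+ 2 * (h ^+ 2 * cr) <= M ^+ 2 / 4.
  have h2 : h ^+ 2 * k ^+ 4 <= 72 ^+ 2.
    have -> : h ^+ 2 * k ^+ 4 = (h * k ^+ 2) ^+ 2 by ring.
    have hk0 : 0 <= h * k ^+ 2 by rewrite mulr_ge0 ?sqr_ge0.
    by move: (h * k ^+ 2) hk hk0; clear => x; nra.
  have k3 : 0 < k ^+ 3 by rewrite exprn_gt0.
  rewrite -(ler_pM2l k0).
  have r1 : h ^+ 2 * cr <= h ^+ 2 * (19 * (k * k * k * (M * M))).
    by rewrite ler_wpM2l ?sqr_ge0.
  have r2 : k * (h ^+ 2 * cr) <= k * (h ^+ 2 * (19 * (k * k * k * (M * M)))).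
    by rewrite ler_pM2l.
  have r3 : k * (h ^+ 2 * (19 * (k * k * k * (M * M)))) <= 72 ^+ 2 * (19 * M ^+ 2).
    have -> : k * (h ^+ 2 * (19 * (k * k * k * (M * M)))) = h ^+ 2 * k ^+ 4 * (19 * M ^+ 2) by ring.
    by rewrite ler_pM2r // mulr_gt0.
  have r4 : C ^+ 2 * (k * (h ^+ 2 * cr)) <= C ^+ 2 * (72 ^+ 2 * (19 * M ^+ 2)).
    by rewrite ler_pM2l //; exact: le_trans r2 r3.
  have r5 : 640 * 640 * (C ^+ 2 * M ^+ 2) <= k * M ^+ 2.
    by apply: le_trans (_ : (640 * C) ^+ 2 * M ^+ 2 <= _); [rewrite le_eqVlt; apply/orP; left; apply/eqP; ring|rewrite ler_pM2r].
  have CM : 0 <= C ^+ 2 * M ^+ 2 by rewrite mulr_ge0 ?sqr_ge0.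
  by move: r4 r5 CM; clear; lra.
rewrite mulrAC ltr_pdivrMr // mul1r mulrDr.
by move: gC rC M2; clear; lra.
Qed.

(** Nothing here depends on [n] or [r], which is why [eps] can be found from [C] alone. *)
Lemma annulus_template (R : realType) (C : R) : 0 < C ->
  exists M Rr g : nat, exists h : R,
  [/\ [/\ (100 <= M)%N, (8 * g <= M)%N, (1 <= g)%N & (81 * M <= Rr)%N],
      0 <= h <= 1 /\ (lattice_count (M + 7) (ball_out (M%:Z + 7) Rr%:Z (Rr%:Z + 8 * g%:Z - 5)) <=
        lattice_count (M + 7)
          (ball_out (M%:Z - 7) (Rr%:Z + 8 * g%:Z) (Rr%:Z + 8 * g%:Z + 5)))%N,
      (lattice_count (M + 7) (ball_out (M%:Z + 7) Rr%:Z (Rr%:Z + 8 * g%:Z - 5)))%:R + 1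
        <= (1 + h) * (lattice_count (M + 7) (ball_in (M%:Z - 7) Rr%:Z (Rr%:Z - 5)))%:R,
      (1 + h) * (lattice_count (M + 7)
          (ball_in (M%:Z + 7) (Rr%:Z + 8 * g%:Z) (Rr%:Z + 5)))%:R + 1
        <= (lattice_count (M + 7)
          (ball_out (M%:Z - 7) (Rr%:Z + 8 * g%:Z) (Rr%:Z + 8 * g%:Z + 5)))%:R &
      forall W, C ^+ 2 / M%:R ^+ 2 *
        ((lattice_count W (shell Rr%:Z (Rr%:Z + 8 * g%:Z)))%:R +
         h ^+ 2 * (lattice_count W (shell (Rr%:Z - 3 * M%:Z) Rr%:Z))%:R) < 1].
Proof.
move=> C0.
have [k [k9 kC]] : exists k : nat, (9 <= k)%N /\ (640 * C) ^+ 2 <= k%:R.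
  exists (9 + (Num.trunc ((640 * C) ^+ 2)).+1)%N; split; first by rewrite leq_addr.
  have x0 : 0 <= (640 * C) ^+ 2 by rewrite sqr_ge0.
  have /andP[_ H] := trunc_itv x0.
  by rewrite natrD; apply: (le_trans (ltW H)); rewrite lerDr.
have [l [l1 lC]] : exists l : nat, (1 <= l)%N /\ 60 * k%:R ^+ 2 * C ^+ 2 <= l%:R.
  exists (Num.trunc (60 * k%:R ^+ 2 * C ^+ 2)).+1; split => //.
  have x0 : 0 <= 60 * k%:R ^+ 2 * C ^+ 2 by rewrite mulr_ge0 ?sqr_ge0 // mulr_ge0 ?sqr_ge0.
  by have /andP[_ H] := trunc_itv x0; exact: ltW.
have [t t0] : exists t, (1000 * (k * l) * (k * l) * (k * l) <= t)%N.
  by exists (1000 * (k * l) * (k * l) * (k * l))%N.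
have O := inner_lost_lt_outer_kept k9 l1 t0; have I := outer_lost_lt_inner_kept k9 l1 t0; have IO := inner_kept_le_outer_kept k9 l1 t0.
have o1k := inner_lost_le k9 l1 t0; have i1k := inner_kept_ge k9 l1 t0.
have gc := gap_count k9 l1 t0; have rc := raised_count k9 l1 t0.
have kl9 : (9 <= k * l)%N by move: k9 l1; clear; nia.
have t1000 : (1000 <= t)%N.
  by apply: leq_trans t0; move: (k * l)%N kl9; clear; nia.
have g1 : (1 <= t * t)%N by move: t1000; clear; nia.
have Mg : (8 * (t * t) <= 8 * (k * l) * (k * l) * (t * t))%N.
  by rewrite leq_mul2r; apply/orP; right; move: (k * l)%N kl9; clear; nia.
have M100 : (100 <= 8 * (k * l) * (k * l) * (t * t))%N.
  by apply: leq_trans Mg; move: t1000; clear; nia.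
have RM : (81 * (8 * (k * l) * (k * l) * (t * t)) <= k * k * (8 * (k * l) * (k * l) * (t * t)))%N.
  by rewrite leq_mul2r; apply/orP; right; move: k9; clear; nia.
rewrite /inner_lost /inner_kept /outer_kept /outer_lost in O I IO o1k i1k; cbv zeta in *.
move: g1 Mg M100 RM O I IO o1k i1k gc rc; move: (8 * (k * l) * (k * l) * (t * t))%N => M.
move: (t * t)%N (k * k * M)%N => g Rr g1 Mg M100 RM.
set O1 := lattice_count _ (ball_out (M%:Z + 7) _ _).
set O2 := lattice_count _ (ball_out (M%:Z - 7) _ _).
set I2 := lattice_count _ (ball_in (M%:Z + 7) _ _).
set I1 := lattice_count _ (ball_in (M%:Z - 7) _ _).
move=> O I IO o1k i1k gc rc.
(* The density [1 + h] turns the inner kept count into exactly [z], the least value that exceeds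
   [O1] and keeps [h] nonnegative. Since [I1 <= O2] and [O1 < O2], also [z <= O2]; and [I2 < I1]
   gives [(1 + h) (I2 + 1) <= z], hence the outer inequality. *)
pose z := maxn I1 (O1 + 1).
have I1_gt0 : 0 < I1%:R :> R by rewrite ltr0n; apply: leq_ltn_trans I.
exists M, Rr, g, (z%:R / I1%:R - 1); rewrite -/O1 -/O2 -/I1 -/I2.
have zE : (1 + (z%:R / I1%:R - 1)) * I1%:R = z%:R :> R.
  by rewrite addrC subrK divfK // gt_eqF.
have zI : I1%:R <= z%:R :> R by rewrite ler_nat leq_maxl.
have h0 : 0 <= z%:R / I1%:R - 1 :> R by rewrite subr_ge0 ler_pdivlMr // mul1r.
have hk : (z%:R / I1%:R - 1) * k%:R ^+ 2 <= 72 :> R.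
  have : (k * k * z <= k * k * I1 + 72 * I1)%N.
    by rewrite /z; case: (leqP I1 (O1 + 1)) => _ //; rewrite leq_addr.
  rewrite -(ler_nat R) natrD !natrM => H.
  rewrite -(ler_pM2r I1_gt0) mulrAC mulrBl mul1r divfK ?gt_eqF //.
  by move: H; clear; lra.
have k9R : 9 <= k%:R :> R by rewrite ler_nat.
split => //.
- split; last exact: ltnW.
  apply/andP; split => //.
  have kk : 72 <= k%:R ^+ 2 :> R by move: k9R; clear; nra.
  rewrite leNgt; apply/negP => h1.
  have : 1 * k%:R ^+ 2 < (z%:R / I1%:R - 1) * k%:R ^+ 2 :> R.
    by rewrite ltr_pM2r //; apply: lt_le_trans kk.
  by move: hk kk; clear; lra.
- by rewrite zE natr1 ler_nat -addn1 leq_maxr.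
- have zO2 : (z <= O2)%N by rewrite geq_max IO addn1.
  apply: (@le_trans _ _ z%:R); last by rewrite ler_nat.
  have I2R : I2%:R + 1 <= I1%:R :> R by rewrite natr1 ler_nat.
  have hp : 0 <= 1 + (z%:R / I1%:R - 1) :> R by rewrite addr_ge0.
  have : (1 + (z%:R / I1%:R - 1)) * (I2%:R + 1) <= (1 + (z%:R / I1%:R - 1)) * I1%:R :> R.
    by rewrite ler_wpM2l.
  rewrite zE mulrDr mulr1; apply: le_trans; rewrite lerD2l lerDl.
  exact: h0.
move=> W; apply: (@annulus_cost_le R C _ _ _ k%:R l%:R) => //.
- by rewrite ler1n; apply: leq_trans k9.
- by rewrite ler1n.
- by rewrite ltr0n; apply: leq_trans M100.
- by have := gc W; rewrite -(ler_nat R) !natrM.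
- by have := rc W; rewrite -(ler_nat R) !natrM.
Qed.

(** * From positions to box indices, and the planar case *)

Definition square_index (R : realType) (s : R) (c : int * int) (x : 2.-tuple R) : int * int :=
  (Num.floor (tnth x ord0 / s) - c.1, Num.floor (tnth x ord_max / s) - c.2).

Lemma euclidean_dist2 (R : realType) (x y : 2.-tuple R) :
  euclidean_dist x y = norm2 (tnth x ord0 - tnth y ord0) (tnth x ord_max - tnth y ord_max).
Proof.
rewrite /euclidean_dist /norm2 !big_ord_recl big_ord0 addr0.
by rewrite (_ : lift ord0 ord0 = ord_max) //; apply: val_inj.
Qed.

Lemma norm2Z (R : realType) (a x y : R) : 0 <= a -> norm2 (a * x) (a * y) = a * norm2 x y.
Proof.
move=> a0; rewrite /norm2 !exprMn -mulrDr sqrtrM ?sqr_ge0 //.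
by rewrite sqrtr_sqr ger0_norm.
Qed.

(** Rounding both points down shifts each coordinate of the difference by at most [1], hence the
    norm by at most [2]: the origin of the radii [M - 2] and [M + 2]. *)
Lemma square_index_dist (R : realType) (s : R) c (x y : 2.-tuple R) : 0 < s ->
  let u := (square_index s c y).1 - (square_index s c x).1 in
  let v := (square_index s c y).2 - (square_index s c x).2 in
  norm2 (u%:~R : R) v%:~R <= s^-1 * euclidean_dist x y + 2 /\
  s^-1 * euclidean_dist x y <= norm2 (u%:~R : R) v%:~R + 2.
Proof.
move=> s0 u v; rewrite euclidean_distC euclidean_dist2 -norm2Z ?invr_ge0 ?(ltW s0) //.
apply: norm2_close; rewrite norm2_le //.
have fr (z z' : R) : - 1 <= (Num.floor (z / s) - Num.floor (z' / s))%:~R - s^-1 * (z - z') <= 1.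
  have := floor_itv (z / s); have := floor_itv (z' / s).
  rewrite !intrD intrN mulrBr ![s^-1 * _]mulrC => /andP[? ?] /andP[? ?]; lra.
have -> : u = Num.floor (tnth y ord0 / s) - Num.floor (tnth x ord0 / s).
  by rewrite /u /square_index /= opprB addrA subrK.
have -> : v = Num.floor (tnth y ord_max / s) - Num.floor (tnth x ord_max / s).
  by rewrite /v /square_index /= opprB addrA subrK.
have := fr (tnth y ord0) (tnth x ord0); have := fr (tnth y ord_max) (tnth x ord_max).
move: (_ - s^-1 * _) (_ - s^-1 * _) => a b; clear; nra.
Qed.

Lemma dist_close (R : realType) (s : R) c (x y : 2.-tuple R) (m : int) : 0 < s -> 0 <= m ->
  euclidean_dist x y <= m%:~R * s -> lattice_close (m + 2) (square_index s c x) (square_index s c y).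
Proof.
move=> s0 m0 H; have [h _] := square_index_dist c x y s0.
rewrite /lattice_close addr_ge0 //= (int_norm_le R) ?addr_ge0 // [(m + 2)%:~R]intrD.
have E2 : 2%:~R = 2 :> R by [].
rewrite E2; apply: (le_trans h); rewrite lerD2r mulrC ler_pdivrMr //.
Qed.

Lemma close_dist (R : realType) (s : R) c (x y : 2.-tuple R) (m : int) : 0 < s ->
  lattice_close m (square_index s c x) (square_index s c y) -> euclidean_dist x y <= (m + 2)%:~R * s.
Proof.
move=> s0 /andP[m0 H]; have [_ h] := square_index_dist c x y s0.
rewrite (int_norm_le R) // in H.
rewrite -ler_pdivrMr // mulrC; apply: (le_trans h); rewrite [(m + 2)%:~R]intrD.
have E2 : 2%:~R = 2 :> R by [].
by rewrite E2 lerD2r.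
Qed.

(** The unit by which the weighted counts differ is worth about [lam / 2] on each side. With
    [eps = (8 S)^-1] the terms in [eps] cost at most [lam / 4], and the roundings of [k0] and [k1]
    cost at most about [S / 2], which [2 S <= lam] covers. *)
Lemma template_weights_ok (R : realType) (eps h lam : R) (i o o' i' k0 k1 : nat) (S := (i + o' + 1)%:R : R) :
  o%:R + 1 <= (1 + h) * i%:R -> (1 + h) * i'%:R + 1 <= o'%:R ->
  (o <= o')%N -> eps = (8 * S)^-1 -> 0 <= h -> 2 * S <= lam ->
  lam - 1 <= k0%:R <= lam -> (1 + h) * lam - 1 <= k1%:R <= (1 + h) * lam ->
  (1 / 2 + eps) * (o * k0)%:R <= (1 / 2 - eps) * ((i * k1)%:R - 1) /\
  (1 / 2 + eps) * (i' * k1)%:R <= (1 / 2 - eps) * ((o' * k0)%:R - 1).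
Proof.
rewrite /S -(ler_nat R) !natrD !natrM.
have : 0 <= i%:R :> R by []. have : 0 <= o%:R :> R by [].
have : 0 <= o'%:R :> R by []. have : 0 <= i'%:R :> R by [].
move: i%:R o%:R o'%:R i'%:R k0%:R k1%:R; clear=> i o o' i' k0 k1 i'0 o'0 o0 i0 oi i'o' oo epsE h0.
move=> lamS /andP[k0l k0u] /andP[k1l k1u].
have S0 : 0 < i + o' + 1 by lra.
have epsS : eps * (i + o' + 1) = 1 / 8.
  by rewrite epsE; field; rewrite gt_eqF.
have eps0 : 0 < eps by rewrite epsE invr_gt0 mulr_gt0.
have eps1 : eps <= 1 / 8 by move: epsS eps0 i0 o'0; clear; nra.
have lam0 : 0 <= lam by lra.
split.
  have a1 : (1 / 2 + eps) * (o * k0) <= (1 / 2 + eps) * (o * lam).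
    by apply: ler_wpM2l; [lra|exact: ler_wpM2l].
  have a2 : (o + 1) * lam - i <= i * k1.
    have b1 : i * ((1 + h) * lam - 1) <= i * k1 by exact: ler_wpM2l.
    have b2 : (o + 1) * lam <= (1 + h) * i * lam by exact: ler_wpM2r.
    by move: b1 b2; clear; lra.
  have a3 : (1 / 2 - eps) * ((o + 1) * lam - i - 1) <= (1 / 2 - eps) * (i * k1 - 1).
    by apply: ler_wpM2l; [|move: a2; clear]; lra.
  apply: (le_trans a1); apply: le_trans a3.
  have a4 : eps * (2 * o + 1) <= 1 / 4.
    have : eps * (2 * o + 1) <= eps * (2 * (i + o' + 1)) by apply: ler_wpM2l; lra.
    by move: epsS; clear; lra.
  have a5 : eps * (2 * o + 1) * lam <= 1 / 4 * lam by exact: ler_wpM2r.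
  have a6 : 0 <= eps * (i + 1) by rewrite mulr_ge0 ?ltW //; lra.
  by move: a5 a6 lamS o'0; clear; lra.
have a1 : i' * k1 <= (o' - 1) * lam.
  have b1 : i' * k1 <= i' * ((1 + h) * lam) by exact: ler_wpM2l.
  have b2 : (1 + h) * i' * lam <= (o' - 1) * lam by apply: ler_wpM2r => //; lra.
  by move: b1 b2; clear; lra.
have a2 : (1 / 2 + eps) * (i' * k1) <= (1 / 2 + eps) * ((o' - 1) * lam).
  by apply: ler_wpM2l => //; lra.
have a3 : (1 / 2 - eps) * (o' * (lam - 1) - 1) <= (1 / 2 - eps) * (o' * k0 - 1).
  apply: ler_wpM2l; first lra.
  by rewrite lerD2r; exact: ler_wpM2l.
apply: (le_trans a2); apply: le_trans a3.
have a4 : eps * (2 * o') <= 1 / 4.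
  have : eps * (2 * o') <= eps * (2 * (i + o' + 1)) by apply: ler_wpM2l; lra.
  by move: epsS; clear; lra.
have a5 : eps * (2 * o') * lam <= 1 / 4 * lam by exact: ler_wpM2r.
have a6 : 0 <= eps * (o' + 1) by rewrite mulr_ge0 ?ltW //; lra.
have a7 : 0 <= eps * lam by rewrite mulr_ge0 // ltW.
by move: a5 a6 a7 lamS i0; clear; lra.
Qed.

Lemma grid_template_cost (R : realType) (W : nat) (P Q : pred (int * int)) (h : R) :
  template_cost (fun b : {ffun 'I_2 -> 'I_(2 * W).+1} => P (grid_point b))
     (fun b => if Q (grid_point b) then h else 0)
  <= (lattice_count W P)%:R + h ^+ 2 * (lattice_count W Q)%:R.
Proof.
have sumE (S : pred (int * int)) : (lattice_count W S)%:R =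
    \sum_(b : {ffun 'I_2 -> 'I_(2 * W).+1}) (S (grid_point b))%:R :> R.
  rewrite /lattice_count -sum1_card natr_sum big_mkcond; apply: eq_bigr => b _.
  by rewrite inE; case: (S _).
rewrite !sumE mulr_sumr -big_split; apply: ler_sum => b _ /=.
by case: (P _); case: (Q _); rewrite /= ?mulr1 ?mulr0 ?expr0n ?addr0 ?add0r ?lerDl ?sqr_ge0.
Qed.

Lemma squares_template (R : realType) (n W M Rr g k0 k1 : nat) (s : R) (x : 'I_n -> 2.-tuple R)
    (z : 'I_2 -> int) (kappa : {ffun 'I_2 -> 'I_(2 * W).+1} -> nat) :
  (forall b : {ffun 'I_2 -> 'I_(2 * W).+1},
     #|[set i | [forall k, Num.floor (tnth (x i) k / s) == z k + (b k)%:Z]]%SET|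
     = kappa b) ->
  (forall b, kappa b = template_kappa M Rr g k0 k1 (grid_point b)) ->
  forall b : {ffun 'I_2 -> 'I_(2 * W).+1}, #|[set i | square_index s (z ord0 + W%:Z, z ord_max + W%:Z) (x i)
     == grid_point b]%SET| = template_kappa M Rr g k0 k1 (grid_point b).
Proof.
move=> H kE b; rewrite -kE -H; apply: eq_card => i; rewrite !inE.
rewrite /square_index /grid_point xpair_eqE /=.
apply/andP/forallP => [[/eqP h0 /eqP h1] k|h].
  have [->|k1'] := eqVneq k ord0; first by apply/eqP; move: h0; lia.
  have -> : k = ord_max by apply: val_inj => /=; case: k k1' => [[|[|]]].
  by apply/eqP; move: h1; lia.
by have /eqP := h ord0; have /eqP := h ord_max; lia.
Qed.

Lemma subgraph_dim2 (R : realType) (C : R) : 0 < C ->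
   exists eps : R, 0 < eps <= 1 / 2 /\
   forall r : nat -> R,
     (forall n : nat, (0 < n)%N -> r n <= C * (ln n%:R / n%:R) `^ (1 / 2)) ->
   forall M : (forall n : nat, uniform_points R 2 n),
     aas_rgg M r (@has_disconnected_subgraph R (1 / 2 + eps)).
Proof.
move=> C0; have [M [Rr [g [h [[M100 Mg g1 RM] [h01 O12] ineq1 ineq2 cost]]]]] := annulus_template C0.
move: O12 ineq1 ineq2.
set O1 := lattice_count _ (ball_out (M%:Z + 7) _ _).
set O2 := lattice_count _ (ball_out (M%:Z - 7) _ _).
set I2 := lattice_count _ (ball_in (M%:Z + 7) _ _).
set I1 := lattice_count _ (ball_in (M%:Z - 7) _ _).
move=> O12 ineq1 ineq2.
pose S : R := (I1 + O2 + 1)%:R.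
have S1 : 1 <= S by rewrite /S natrD lerDr.
have MR : 0 < M%:R :> R by rewrite ltr0n; apply: leq_trans M100.
have epsb : 0 < (8 * S)^-1 <= 1 / 2.
  have S8 : 0 < 8 * S by lra.
  by rewrite invr_gt0 S8 /= div1r lef_pV2 ?posrE //; lra.
exists (8 * S)^-1; split => // r rle P.
pose W := (Rr + 8 * g + 3 * M)%N.
pose L (n : nat) : R := C * (ln n%:R / n%:R) `^ (1 / 2).
(* Two box sides less than the gap width [8 g], because [dist_close] adds [2] in passing from
   distances to box indices. *)
pose th : R := (8 * g%:Z - 2)%:~R / M%:R.
have th0 : 0 < th by rewrite divr_gt0 // ltr0z; move: g1; clear; lia.
have th1 : th <= 1.
  rewrite /th ler_pdivrMr // mul1r -[M%:R]/(M%:Z%:~R) ler_int.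
  by move: Mg; clear; lia.
(* If [r n] is below the width of the gap, the scale is the upper bound [L n] *)
pose t n := if r n <= th * L n then L n else r n.
pose s n := t n / M%:R.
have scale : \forall n \near \oo, [/\ 0 < L n, 0 < s n, s n <= L n / M%:R & th * L n / M%:R <= s n].
  near=> n; have [n1 ln0] : (1 < n)%N /\ 0 < ln (n%:R : R) by near: n; exact: near_ln_gt0.
  have nR : 0 < n%:R :> R by rewrite ltr0n ltnW.
  have L0 : 0 < L n by rewrite mulr_gt0 // powR_gt0 // divr_gt0.
  have rL : r n <= L n by apply: rle; exact: ltnW.
  have thL : th * L n <= L n by rewrite ger_pMl.
  have tb : th * L n <= t n <= L n.
    by rewrite /t; case: (leP (r n) (th * L n)) => H; rewrite ?thL ?lexx ?(ltW H) ?rL.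
  have /andP[tb1 tb2] := tb.
  have t0 : 0 < t n by apply: lt_le_trans tb1; rewrite mulr_gt0.
  by split => //; rewrite ?divr_gt0 // ler_pM2r // invr_gt0.
have Lsq n : (0 < n)%N -> n%:R * L n ^+ 2 = C ^+ 2 * ln n%:R.
  move=> n0; have nR : 0 < n%:R :> R by rewrite ltr0n.
  have l0 : 0 <= ln n%:R :> R by rewrite ln_ge0 // ler1n.
  have q0 : 0 <= ln n%:R / n%:R :> R by rewrite divr_ge0 // ltW.
  rewrite /L exprMn div1r powR12_sqrt // sqr_sqrtr //.
  by field; rewrite gt_eqF.
pose gap (b : {ffun 'I_2 -> 'I_(2 * W).+1}) := shell Rr%:Z (Rr%:Z + 8 * g%:Z) (grid_point b).
pose hb (b : {ffun 'I_2 -> 'I_(2 * W).+1}) : R :=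
  if shell (Rr%:Z - 3 * M%:Z) Rr%:Z (grid_point b) then h else 0.
have D0 : 0 < C ^+ 2 / M%:R ^+ 2 by rewrite divr_gt0 // exprn_gt0.
apply: (@template_aas R 2 (2 * W).+1 gap hb (C ^+ 2 / M%:R ^+ 2) s) => //.
- by move=> b; rewrite /hb; case: ifP => // _; rewrite lexx ler01.
- by apply: le_lt_trans (cost W); rewrite ler_pM2l //; exact: grid_template_cost.
- near=> n.
  have n0 : (0 < n)%N by near: n; exact: nbhs_infty_gt.
  have [L0 s0 sL _] : [/\ 0 < L n, 0 < s n, s n <= L n / M%:R & th * L n / M%:R <= s n] by near: n.
  split => //; rewrite mulrAC -Lsq // -mulrA -expr_div_n.
  by rewrite ler_wpM2l // lerXn2r ?nnegrE ?(le_trans (ltW s0) sL) // ltW.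
near=> n => w z Hw.
have n0 : (0 < n)%N by near: n; exact: nbhs_infty_gt.
have [L0 s0 sL sth] : [/\ 0 < L n, 0 < s n, s n <= L n / M%:R & th * L n / M%:R <= s n] by near: n.
have lnb : 2 * S / (th ^+ 2 * C ^+ 2 / M%:R ^+ 2) <= ln n%:R by near: n; exact: near_ln_ge.
pose lam : R := n%:R * s n ^+ 2.
have lamS : 2 * S <= lam.
  have p0 : 0 < th ^+ 2 * C ^+ 2 / M%:R ^+ 2.
    by apply: divr_gt0; [apply: mulr_gt0|]; exact: exprn_gt0.
  rewrite ler_pdivrMr // in lnb; apply: (le_trans lnb).
  have -> : ln n%:R * (th ^+ 2 * C ^+ 2 / M%:R ^+ 2) = n%:R * (th * L n / M%:R) ^+ 2.
    rewrite [(th * L n / _) ^+ 2]expr_div_n [(th * L n) ^+ 2]exprMn.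
    have -> : n%:R * (th ^+ 2 * L n ^+ 2 / M%:R ^+ 2) = (n%:R * L n ^+ 2) * th ^+ 2 / M%:R ^+ 2.
      by move: (M%:R ^- 2) => v; ring.
    by rewrite Lsq //; move: (M%:R ^- 2) => v; ring.
  rewrite ler_wpM2l // lerXn2r ?nnegrE ?(ltW s0) //.
  by apply: divr_ge0; [apply: mulr_ge0|]; exact: ltW.
have lam1 : 2 <= lam by lra.
pose k0 := Num.trunc ((1 + 0) * lam); pose k1 := Num.trunc ((1 + h) * lam).
have k0b : lam - 1 <= k0%:R <= lam.
  have x0 : 0 <= (1 + 0) * lam by rewrite addr0 mul1r; lra.
  by have := trunc_itv x0; rewrite -/k0 addr0 mul1r -natr1; move: (k0%:R) => x; clear; lra.
have k1b : (1 + h) * lam - 1 <= k1%:R <= (1 + h) * lam.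
  have x0 : 0 <= (1 + h) * lam.
    have /andP[hh _] := h01; rewrite mulr_ge0 //; first by rewrite addr_ge0.
    by move: lam1; clear; lra.
  by have := trunc_itv x0; rewrite -/k1 -natr1; move: (k1%:R) ((1 + h) * lam) => x y; clear; lra.
have k0_gt0 : (0 < k0)%N.
  by rewrite -(ltr_nat R); have /andP[kk _] := k0b; move: kk lam1; clear; lra.
have kE b : template_count gap hb lam b = template_kappa M Rr g k0 k1 (grid_point b).
  rewrite /template_count /template_kappa /gap /hb.
  by case: ifP => // _; case: ifP.
have counts := squares_template Hw kE.
set c := (_, _) in counts.
have /andP[h0 _] := h01.
have [ok1 ok2] := template_weights_ok ineq1 ineq2 O12 erefl h0 lamS k0b k1b.
have [small|big] := leP (r n) (th * L n).
  apply: (@no_crossing_subgraph R _ n _ _ M Rr g W k0 k1 epsb M100 Mg g1 RM erefl k0_gt0 counts).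
  move=> i j /andP[_ dij].
  have -> : 8 * g%:Z = (8 * g%:Z - 2) + 2 by rewrite subrK.
  apply: dist_close => //; first by move: g1; clear; lia.
  apply: le_trans dij _; apply: (le_trans small).
  rewrite /s /t small /th le_eqVlt; apply/orP; left; apply/eqP.
  by move: (_%:~R) (M%:R^-1) (L n) => a b d; ring.
have rs : r n = M%:Z%:~R * s n.
  by rewrite /s /t leNgt big /= mulrC divfK // gt_eqF.
apply: (@template_subgraph R _ n _ _ M Rr g W k0 k1 epsb M100 Mg g1 RM erefl k0_gt0 counts).
- move=> i j /andP[_ dij]; apply: dist_close => //.
  by rewrite -rs.
- move=> i j ij cij; rewrite /= /rgg_adj ij /= rs.
  by have := close_dist s0 cij; rewrite subrK.
- exact: ok1.
- exact: ok2.
Unshelve. all: by end_near.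
Qed.

Theorem theorem1p6 (R : realType) :
  (forall eps : R, 0 < eps <= 1 / 2 ->
   forall r : nat -> R,
     (forall n : nat, (0 < n)%N -> r n <= ln n%:R / (4 * eps * n%:R)) ->
   forall M : (forall n : nat, uniform_points R 1 n),
     aas_rgg M r (@has_disconnected_subgraph R (1 / 2 + eps)))
  /\
  (forall C : R, 0 < C ->
   exists eps : R, 0 < eps <= 1 / 2 /\
   forall r : nat -> R,
     (forall n : nat, (0 < n)%N -> r n <= C * (ln n%:R / n%:R) `^ (1 / 2)) ->
   forall M : (forall n : nat, uniform_points R 2 n),
     aas_rgg M r (@has_disconnected_subgraph R (1 / 2 + eps))).
Proof. by split; [exact: subgraph_dim1|exact: subgraph_dim2]. Qed.
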